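(* The following categories are of superexponential growth. (a) The category $\mathrm{Rep}\big(\mathrm{SL}_{\mathbb{Z}_{\geq 0}}(\mathbb{C}),\mathbb{C}^{\mathbb{Z}_{\geq 0}}\big)$. (b) The Deligne category $\mathrm{Rep}(S_t,\mathbb{C})$, where $t\in\mathbb{C}\setminus\mathbb{Z}$. (c) The Delannoy categories.
   Context: For an additive Krull--Schmidt monoidal category $\mathcal{C}$ and $X\in\mathcal{C}$, let $b_n$ be the number of indecomposable direct summands of $X^{\otimes n}$, counted with multiplicity. A function $f\colon\mathbb{Z}_{\geq 0}\to\mathbb{R}_{\geq 0}$ grows superexponentially if for every real $\gamma>1$ there are $A>0$ and $n_0$ with $f(n)\geq A\gamma^n$ for all $n>n_0$. The category $\mathcal{C}$ is of superexponential growth if there exists an object $X\in\mathcal{C}$ such that $n\mapsto b_n$ grows superexponentially. (a) $\mathrm{SL}_{\mathbb{Z}_{\geq 0}}(\mathbb{C})=\bigcup_n\mathrm{SL}_n(\mathbb{C})$ is the infinite rank special linear group and $\mathbb{C}^{\mathbb{Z}_{\geq 0}}$ its defining representation (with basis indexed by $\mathbb{Z}_{\geq 0}$); the category consists of the direct summands of finite direct sums of tensor powers of the defining representation. (b) $\mathrm{Rep}(S_t,\mathbb{C})$ is the Karoubian Deligne category (in the conventions of Comes--Ostrik): the additive Karoubi envelope of the partition category over $\mathbb{C}$ with loop parameter $t$, i.e. the $\mathbb{C}$-linear monoidal category with objects $n\in\mathbb{Z}_{\geq 0}$ and morphisms $m\to n$ the formal linear combinations of set partitions of $m+n$ points, where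 composition is stacking with each removed component replaced by the factor $t$. (c) The Delannoy category (Harman--Snowden--Snyder) over a field $k$ is the Karoubi envelope of the following category. Let $\mathbb{G}=\mathrm{Aut}(\mathbb{R},<)$ and $\mathbb{R}^{(n)}=\{x_1<\dots<x_n\}\subset\mathbb{R}^n$. Objects are the finite disjoint unions $X$ of sets $\mathbb{R}^{(n)}$; morphisms $X\to Y$ are $\mathbb{G}$-invariant functions $Y\times X\to k$; the composition of $\varphi\colon X\to Y$ and $\psi\colon Y\to Z$ is $(\psi\varphi)(z,x)=\int_Y\psi(z,y)\varphi(y,x)\,dy$, the integral being taken with respect to the compactly supported Euler characteristic; the tensor product is the Cartesian product of sets (decomposed into $\mathbb{G}$-orbits). *)

(* Defs.v *)
(* MathComp world; the complex numbers are R[i] for R : realType. *)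
From mathcomp Require Import all_boot all_order all_algebra.
From mathcomp Require Import reals.
From mathcomp Require classical_sets.
From mathcomp Require Import finmap.
From mathcomp.multinomials Require Import monalg.
From mathcomp.real_closed Require Import complex.

Set Implicit Arguments.
Unset Strict Implicit.
Unset Printing Implicit Defensive.

Import Order.TTheory GRing.Theory Num.Theory.
Local Open Scope ring_scope.

(** * Preadditive categories with a tensor product *)

(* The data of a preadditive monoidal category. The objects and the morphisms
   are those elements of the carriers [obj] and [hom X Y] that satisfy [is_obj]
   and [is_mor]; morphisms are equal when they are equal in the carrier. Only
   the data is recorded: neither the axioms nor the associativity and unit
   isomorphisms enter the definitions below. *)
Record monoidal := Monoidal {
  obj : Type;
  is_obj : obj -> Prop;
  hom : obj -> obj -> Type;
  is_mor : forall X Y, hom X Y -> Prop;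
  mor0 : forall X Y, hom X Y;
  morD : forall X Y, hom X Y -> hom X Y -> hom X Y;
  mor1 : forall X, hom X X;
  comp : forall X Y Z, hom Y Z -> hom X Y -> hom X Z;
  tunit : obj;
  tens : obj -> obj -> obj;
  tensm : forall X Y X' Y',
    hom X Y -> hom X' Y' -> hom (tens X X') (tens Y Y')
}.

Arguments is_obj {m} X.
Arguments is_mor {m X Y} f.
Arguments mor0 {m} X Y.
Arguments morD {m X Y} f g.
Arguments mor1 {m} X.
Arguments comp {m X Y Z} g f.
Arguments tunit {m}.
Arguments tens {m} X Y.
Arguments tensm {m X Y X' Y'} f g.

Section Growth.
Variable C : monoidal.
Implicit Types X : obj C.

Definition is_zero X := mor1 X = mor0 X X.

Definition is_iso X Y (f : hom X Y) :=
  is_mor f /\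
  exists g : hom Y X, [/\ is_mor g, comp g f = mor1 X & comp f g = mor1 Y].

Definition is_direct_sum X N (Y : 'I_N -> obj C) :=
  exists (inj : forall i, hom (Y i) X) (proj : forall i, hom X (Y i)),
    [/\ forall i, is_mor (inj i) /\ is_mor (proj i),
        forall i, comp (proj i) (inj i) = mor1 (Y i),
        forall i j, i != j -> comp (proj i) (inj j) = mor0 (Y j) (Y i)
      & \big[morD/mor0 X X]_(i < N) comp (inj i) (proj i) = mor1 X].

Definition indecomposable X :=
  [/\ is_obj X, ~ is_zero X
    & forall Y : 'I_2 -> obj C, (forall i, is_obj (Y i)) ->
        is_direct_sum X Y -> exists i, is_zero (Y i)].

Definition has_local_end X :=
  ~ is_zero X /\
  forall f g : hom X X, is_mor f -> is_mor g -> morD f g = mor1 X ->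
    is_iso f \/ is_iso g.

Definition krull_schmidt :=
  forall X, is_obj X ->
    exists N (Y : 'I_N -> obj C),
      (forall i, is_obj (Y i) /\ has_local_end (Y i)) /\ is_direct_sum X Y.

(* In a Krull-Schmidt category, exactly one N has this property. *)
Definition number_of_summands X N :=
  exists Y : 'I_N -> obj C,
    (forall i, indecomposable (Y i)) /\ is_direct_sum X Y.

Fixpoint tpower X n :=
  if n is n'.+1 then tens (tpower X n') X else tunit.

Definition grows_superexponentially (R : realType) (f : nat -> R) :=
  forall gamma : R, 1 < gamma ->
    exists (A : R) (n0 : nat), 0 < A /\
      forall n, (n0 < n)%N -> A * gamma ^+ n <= f n.

Definition superexponential_growth (R : realType) :=
  krull_schmidt /\
  exists (X : obj C) (b : nat -> nat),
    [/\ is_obj X, forall n, number_of_summands (tpower X n) (b n)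
      & grows_superexponentially (fun n => (b n)%:R : R)].

End Growth.

(** * Additive and idempotent completion *)

Section AdditiveEnvelope.
Variable C : monoidal.

Record family := Family { index : finType; entry : index -> obj C }.

Definition matrix_hom (X Y : family) :=
  forall (j : index Y) (i : index X), hom (entry i) (entry j).

Definition matrix_mor1 (X : family) : matrix_hom X X := fun j i =>
  match @eqP _ i j with
  | ReflectT e => eq_rect i (fun l => hom (entry i) (entry l)) (mor1 _) j e
  | ReflectF _ => mor0 _ _
  end.

Definition additive_envelope : monoidal := {|
  obj := family;
  is_obj := fun X => forall i : index X, is_obj (entry i);
  hom := matrix_hom;
  is_mor := fun X Y f => forall j i, is_mor (f j i);
  mor0 := fun X Y j i => mor0 _ _;
  morD := fun X Y f g j i => morD (f j i) (g j i);
  mor1 := matrix_mor1;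
  comp := fun X Y Z g f k i =>
    \big[morD/mor0 _ _]_(j : index Y) comp (g k j) (f j i);
  tunit := @Family unit (fun=> tunit);
  tens := fun X Y => @Family (index X * index Y)%type
    (fun p => tens (entry p.1) (entry p.2));
  tensm := fun X Y X' Y' f g q p => tensm (f q.1 p.1) (g q.2 p.2)
|}.

End AdditiveEnvelope.

Section KaroubiEnvelope.
Variable C : monoidal.

Record idempotent := Idempotent { carrier : obj C; idem : hom carrier carrier }.

Definition karoubi_envelope : monoidal := {|
  obj := idempotent;
  is_obj := fun X => [/\ is_obj (carrier X), is_mor (idem X)
                       & comp (idem X) (idem X) = idem X];
  hom := fun X Y => hom (carrier X) (carrier Y);
  is_mor := fun X Y f => is_mor f /\ comp (idem Y) (comp f (idem X)) = f;
  mor0 := fun X Y => mor0 _ _;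
  morD := fun X Y => @morD C _ _;
  mor1 := fun X => idem X;
  comp := fun X Y Z => @comp C _ _ _;
  tunit := Idempotent (mor1 tunit);
  tens := fun X Y => Idempotent (tensm (idem X) (idem Y));
  tensm := fun X Y X' Y' => @tensm C _ _ _ _
|}.

End KaroubiEnvelope.

(** * The infinite rank special linear group *)

Section SpecialLinear.
Variable F : fieldType.

(* The n-th tensor power of the space with basis indexed by nat: finitely
   supported functions on the n-tuples of naturals. *)
Definition tpow n := {malg F[{ffun 'I_n -> nat}]}.

Definition basis n (w : {ffun 'I_n -> nat}) : tpow n := mkmalgU w 1.

(* The linear extension of a function on basis vectors. *)
Definition extend m n (f : {ffun 'I_m -> nat} -> tpow n) (u : tpow m) : tpow n :=
  \sum_(w <- msupp u) mcoeff w u *: f w.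

Definition left_part m n (w : {ffun 'I_(m + n) -> nat}) : {ffun 'I_m -> nat} :=
  [ffun i => w (lshift n i)].
Definition right_part m n (w : {ffun 'I_(m + n) -> nat}) : {ffun 'I_n -> nat} :=
  [ffun i => w (rshift m i)].
Definition concat m n (v : {ffun 'I_m -> nat}) (w : {ffun 'I_n -> nat}) :
    {ffun 'I_(m + n) -> nat} :=
  [ffun i => match split i with inl j => v j | inr j => w j end].

Definition tpow_mul m n (u : tpow m) (v : tpow n) : tpow (m + n) :=
  extend (fun a => extend (fun b => basis (concat a b)) v) u.

Definition tpow_map m n m' n' (f : tpow m -> tpow n) (g : tpow m' -> tpow n') :
    tpow (m + m') -> tpow (n + n') :=
  extend (fun w => tpow_mul (f (basis (left_part w)))
                            (g (basis (right_part w)))).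

Definition basis1 (j : nat) : tpow 1 := basis [ffun=> j].

(* The action of A in SL_N on the defining representation: A acts on the span
   of the first N basis vectors and fixes the others. *)
Definition act1 N (A : 'M[F]_N) : tpow 1 -> tpow 1 :=
  extend (fun w => if insub (w ord0) is Some j
                   then \sum_(i < N) A i j *: basis1 i
                   else basis w).

Fixpoint act N (A : 'M[F]_N) n : tpow n -> tpow n :=
  if n is n'.+1 then @tpow_map 1 1 n' n' (act1 A) (@act N A n') else id.

(* The group is the union of the SL_N, so equivariance is tested on each. *)
Definition equivariant m n (f : tpow m -> tpow n) :=
  forall N (A : 'M[F]_N), \det A = 1 -> forall u, f (act A u) = act A (f u).

Definition tensor_powers : monoidal := {|
  obj := nat;
  is_obj := fun=> True;
  hom := fun m n => tpow m -> tpow n;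
  is_mor := fun m n f => linear f /\ equivariant f;
  mor0 := fun m n u => 0;
  morD := fun m n f g u => f u + g u;
  mor1 := fun m u => u;
  comp := fun m l n g f u => g (f u);
  tunit := 0%N;
  tens := addn;
  tensm := tpow_map
|}.

(* A direct summand of a sum of tensor powers is the image of an equivariant
   idempotent. *)
Definition Rep_SL_infinity := karoubi_envelope (additive_envelope tensor_powers).

End SpecialLinear.

(** * The partition category *)

Section PartitionCategory.
Variables (F : fieldType) (t : F).

Definition diagram m n :=
  {P : {set {set 'I_m + 'I_n}} | partition P [set: 'I_m + 'I_n]}.

Section Stacking.
Variables m l n : nat.

Definition lower (x : 'I_m + 'I_l) : 'I_m + 'I_l + 'I_n := inl x.
Definition upper (x : 'I_l + 'I_n) : 'I_m + 'I_l + 'I_n :=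
  match x with inl j => inl (inr j) | inr k => inr k end.
Definition outer (x : 'I_m + 'I_n) : 'I_m + 'I_l + 'I_n :=
  match x with inl i => inl (inl i) | inr k => inr k end.

Implicit Types (q : diagram l n) (p : diagram m l).

Definition stack_rel q p : rel ('I_m + 'I_l + 'I_n) := fun x y =>
  [exists B in val p, (x \in lower @: B) && (y \in lower @: B)]
  || [exists B in val q, (x \in upper @: B) && (y \in upper @: B)].

Definition components q p : {set {set 'I_m + 'I_l + 'I_n}} :=
  equivalence_partition (connect (stack_rel q p)) [set: _].

Definition stack q p : {set {set 'I_m + 'I_n}} :=
  [set outer @^-1: K | K : {set 'I_m + 'I_l + 'I_n} in components q p] :\ set0.

Definition removed q p : nat :=
  #|[set K : {set 'I_m + 'I_l + 'I_n} in components q p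
      | outer @^-1: K == set0]|.

Definition diagram_comp (g : {ffun diagram l n -> F})
    (f : {ffun diagram m l -> F}) : {ffun diagram m n -> F} :=
  [ffun r => \sum_q \sum_(p | stack q p == val r)
               g q * f p * t ^+ removed q p].

End Stacking.

Section Juxtaposition.
Variables m n m' n' : nat.

Definition to_left (x : 'I_m + 'I_n) : 'I_(m + m') + 'I_(n + n') :=
  match x with inl i => inl (lshift m' i) | inr j => inr (lshift n' j) end.
Definition to_right (x : 'I_m' + 'I_n') : 'I_(m + m') + 'I_(n + n') :=
  match x with inl i => inl (rshift m i) | inr j => inr (rshift n j) end.

Definition juxtapose (p : diagram m n) (p' : diagram m' n') :
    {set {set 'I_(m + m') + 'I_(n + n')}} :=
  [set to_left @: B | B : {set 'I_m + 'I_n} in val p]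
  :|: [set to_right @: B | B : {set 'I_m' + 'I_n'} in val p'].

Definition diagram_tens (f : {ffun diagram m n -> F})
    (g : {ffun diagram m' n' -> F}) :
    {ffun diagram (m + m') (n + n') -> F} :=
  [ffun r => \sum_p \sum_(p' | juxtapose p p' == val r) f p * g p'].

End Juxtaposition.

Definition identity_diagram n : {set {set 'I_n + 'I_n}} :=
  [set [set inl i; inr i] | i in 'I_n].

Definition partition_category : monoidal := {|
  obj := nat;
  is_obj := fun=> True;
  hom := fun m n => {ffun diagram m n -> F};
  is_mor := fun m n f => True;
  mor0 := fun m n => [ffun=> 0];
  morD := fun m n f g => [ffun r => f r + g r];
  mor1 := fun n => [ffun r => (val r == identity_diagram n)%:R];
  comp := diagram_comp;
  tunit := 0%N;
  tens := addn;
  tensm := diagram_tens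
|}.

Definition Rep_St := karoubi_envelope (additive_envelope partition_category).

End PartitionCategory.

(** * The Delannoy category *)

Section Euler.
Variables (R : realType) (k : fieldType).
Implicit Types (A : seq R) (f : R -> k) (F : seq R -> k).

(* [f] is constant on each open interval cut out by the points of [A]. *)
Definition breakpoints f A :=
  sorted <%R A /\
  forall x y, x \notin A -> y \notin A ->
    (forall a, a \in A -> (a < x) = (a < y)) -> f x = f y.

(* One point in each of the open intervals cut out by a sorted [A]. *)
Definition gap_points A : seq R :=
  if A is a :: s
  then (a - 1) :: rcons (pairmap (fun x y => (x + y) / 2) a s) (last a s + 1)
  else [:: 0].

(* The compactly supported Euler characteristic of a point is 1 and that of an
   open interval, bounded or not, is -1. The value does not depend on the
   chosen [A] (it is meaningless if [f] has no breakpoints). *)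
Definition euler1 f : k :=
  let A := classical_sets.xget [::] (breakpoints f) in
  \sum_(a <- A) f a - \sum_(a <- gap_points A) f a.

(* The iterated integral over R^n. *)
Fixpoint euler n F : k :=
  if n is n'.+1 then euler1 (fun x => euler n' (fun s => F (x :: s)))
  else F [::].

End Euler.

Section Delannoy.
Variables (R : realType) (k : fieldType).

(* The disjoint union of the R^(arity i) for i : orbit. *)
Record gset := GSet { orbit : finType; arity : orbit -> nat }.

Definition is_point (X : gset) (p : orbit X * seq R) :=
  (size p.2 == arity p.1) && sorted <%R p.2.

Definition point (X : gset) := {p : orbit X * seq R | is_point p}.

Definition integral (X : gset) (f : point X -> k) : k :=
  \sum_i euler (arity i) (fun s => oapp f 0 (insub (i, s))).

Definition translate (g : R -> R) (X : gset) (x x' : point X) :=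
  (val x').1 = (val x).1 /\ (val x').2 = map g (val x).2.

Definition invariant_kernel (X Y : gset) (f : point Y -> point X -> k) :=
  forall g : R -> R, {homo g : a b / a < b} -> bijective g ->
  forall y y' x x', translate g y y' -> translate g x x' -> f y' x' = f y x.

(* The orbits on R^(m) x R^(n): a word lists the elements of the union of the
   two sets in increasing order, recording for each whether it belongs to the
   first set and whether it belongs to the second. The orbit of a word of
   length l is isomorphic to R^(l). *)
Definition is_word m n (w : seq (bool * bool)) :=
  [&& (false, false) \notin w, count fst w == m & count snd w == n].

Lemma mask_sorted_size (f : bool * bool -> bool) w (s : seq R) :
    size s = size w -> sorted <%R s ->
  (size (mask (map f w) s) == count f w) && sorted <%R (mask (map f w) s).
Proof.
move=> sz ss; rewrite size_mask ?size_map // count_map eqxx.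
exact: (sorted_mask lt_trans).
Qed.

Section Product.
Variables X Y : gset.

(* The bound makes the type of words finite; it excludes none. *)
Definition max_length := (\max_i @arity X i + \max_j @arity Y j)%N.

Definition prod_orbit :=
  {o : orbit X * orbit Y * max_length.-bseq (bool * bool) |
    is_word (arity o.1.1) (arity o.1.2) o.2}.

Definition gset_prod : gset :=
  @GSet prod_orbit (fun o => size (val o).2).

Implicit Type z : point gset_prod.

Definition proj1_val z : orbit X * seq R :=
  let: (i, j, w) := val (val z).1 in (i, mask (map fst w) (val z).2).
Definition proj2_val z : orbit Y * seq R :=
  let: (i, j, w) := val (val z).1 in (j, mask (map snd w) (val z).2).

Lemma proj1_subproof z : is_point (proj1_val z).
Proof.
case: z => [[[[[i j] w] hw] s] hz]; have /andP[/eqP sz ss] := hz.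
have /and3P[_ /eqP hi _] := hw; rewrite /proj1_val /is_point /= -hi.
exact: mask_sorted_size.
Qed.

Lemma proj2_subproof z : is_point (proj2_val z).
Proof.
case: z => [[[[[i j] w] hw] s] hz]; have /andP[/eqP sz ss] := hz.
have /and3P[_ _ /eqP hj] := hw; rewrite /proj2_val /is_point /= -hj.
exact: mask_sorted_size.
Qed.

Definition proj1 z : point X := @exist _ _ (proj1_val z) (proj1_subproof z).
Definition proj2 z : point Y := @exist _ _ (proj2_val z) (proj2_subproof z).

End Product.

Definition gset_category : monoidal := {|
  obj := gset;
  is_obj := fun=> True;
  hom := fun X Y => point Y -> point X -> k;
  is_mor := invariant_kernel;
  mor0 := fun X Y y x => 0;
  morD := fun X Y f g y x => f y x + g y x;
  mor1 := fun X y x => (y == x)%:R;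
  comp := fun X Y Z g f z x => integral (fun y => g z y * f y x);
  tunit := @GSet unit (fun=> 0%N);
  tens := gset_prod;
  tensm := fun X Y X' Y' f g y x =>
    f (proj1 y) (proj1 x) * g (proj2 y) (proj2 x)
|}.

Definition Delannoy := karoubi_envelope gset_category.

End Delannoy.

(* Main.v *)
Require Import Defs.
From HB Require Import structures.
From mathcomp Require Import all_boot all_order all_algebra all_fingroup.
From mathcomp Require Import reals finmap ring lra.
From mathcomp Require boolp classical_sets.
From mathcomp.multinomials Require Import monalg.
From mathcomp.real_closed Require Import complex.
Import Defs.

(** The three categories are idempotent completions of linear categories with
    finite-dimensional morphism spaces. In a finite-dimensional algebra every
    element of a corner [e A e] is a unit of it, is nilpotent, or splits [e] into
    two smaller idempotents ([fitting]); since orthogonal nonzero idempotents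
    are linearly independent, every system of orthogonal idempotents refines to
    one of primitive idempotents, whose corners are local rings. This is the
    Krull-Schmidt property ([karoubi_krull_schmidt]), and it bounds the number
    of indecomposable summands of an object from below by the number of members
    of any system of nonzero orthogonal idempotents of it with sum one
    ([growth_from_idempotents]). It remains to find superexponentially many
    such idempotents on the tensor powers of a suitable object; about the
    square root of [n!] of them are enough.

    In (a) and (b) the symmetric group on [n] letters acts on the [n]-th tensor
    power by linearly independent endomorphisms. Its complex group algebra is
    semisimple, because [a * star a] is never nilpotent for [a != 0]; hence the
    spaces [e A f] for primitive [e] and [f] are at most one-dimensional, and by
    the Peirce decomposition a system of [N] primitive idempotents satisfies
    [n! <= N ^ 2] ([card_le_primitives]). These idempotents act as nonzero
    idempotents on the tensor power ([growth_from_symmetric_groups]).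

    For (a), morphism spaces are finite-dimensional because an equivariant map
    out of the [m]-th tensor power is determined by the image of
    [e_0 (x) ... (x) e_(m-1)], which for weight reasons involves only the
    letters below [m] ([support_inc_word], [inc_word_determines]). For (b), the
    associativity of the composition of partition diagrams is obtained from
    that of matrices: a diagram is determined by the colourings of its points
    that are constant on its blocks, and the colourings of a stack by a set [T]
    are counted by [#|T|] to the number of removed components
    ([card_sem_stack], [stack_assoc]).

    For (c), the [n]-th power of the line decomposes into at least [n!] orbits,
    and each of them gives an idempotent ([orbit_system], [card_top_orbits]).
    The associativity of the composition is Fubini's theorem for the Euler
    characteristic. It is reduced to the plane, where the two iterated
    integrals differ from those of a function that is constant on products of
    cells only by contributions of the squares of the gaps between breakpoints;
    these are symmetric because, for [l < c < h] in a gap, an increasing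
    bijection carries [(l, c)] to [(c, h)] ([euler1_gap_symmetric], [fubini]). *)

Set Implicit Arguments.
Unset Strict Implicit.
Unset Printing Implicit Defensive.

Import Order.TTheory GRing.Theory Num.Theory.
Local Open Scope ring_scope.

(** * Idempotents of finite-dimensional algebras *)

Section Idempotents.
Variables (F : fieldType) (A : pzRingType) (sc : {rmorphism F -> A}).
Implicit Types e u x y : A.

(** The structure map of an algebra, so that scalars need no module structure
    and the zero algebra is allowed. *)
Definition central_scalars := forall c x, sc c * x = x * sc c.

(** Finite-dimensionality, witnessed by an injective linear map to [F ^ T]. *)
Definition finite_coordinates (T : finType) (phi : A -> T -> F) :=
  [/\ forall x y t, phi (x + y) t = phi x t + phi y t,
      forall c x t, phi (sc c * x) t = c * phi x t
    & forall x y, phi x =1 phi y -> x = y].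

Definition in_corner e x := e * x = x /\ x * e = x.

Definition primitive e :=
  [/\ e * e = e, e != 0
    & forall u, u * u = u -> in_corner e u -> u = 0 \/ u = e].

Definition corner_unit e x :=
  exists y, [/\ in_corner e y, x * y = e & y * x = e].

Definition orthogonal_system N (s : 'I_N -> A) (e : A) :=
  [/\ forall i, s i * s i = s i, forall i j, i != j -> s i * s j = 0,
      forall i, s i != 0 & \sum_i s i = e].

Variables (T : finType) (phi : A -> T -> F).
Hypothesis scC : central_scalars.
Hypothesis coordP : finite_coordinates phi.

Lemma coord0 t : phi 0 t = 0.
Proof.
by case: coordP => D _ _; apply: (@addrI _ (phi 0 t)); rewrite -D !addr0.
Qed.

Lemma coord_sum (I : finType) (f : I -> A) t :
  phi (\sum_i f i) t = \sum_i phi (f i) t.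
Proof.
case: coordP => D _ _.
by apply: (big_morph (phi^~ t)) => [x y|]; [apply: D | apply: coord0].
Qed.

Lemma linear_dependence n (x : 'I_n -> A) : (#|T| < n)%N ->
  exists c : 'I_n -> F, (exists i, c i != 0) /\ \sum_i sc (c i) * x i = 0.
Proof.
move=> ltTn; case: (coordP) => _ Z inj.
pose M : 'M[F]_(n, #|T|) := \matrix_(i, t) phi (x i) (enum_val t).
have : kermx M != 0.
  by rewrite kermx_eq0 neq_ltn (leq_ltn_trans (rank_leq_col M) ltTn).
case/rowV0Pn => v /sub_kermxP vM v0; exists (v 0); split.
  by case/rV0Pn: v0 => i vi; exists i.
apply: inj => t; rewrite coord_sum coord0.
have /= := congr1 (fun B : 'M_(_, _) => B 0 (enum_rank t)) vM.
rewrite [LHS]mxE [RHS]mxE => E; rewrite -[RHS]E.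
by apply: eq_bigr => i _; rewrite mxE enum_rankK Z.
Qed.

(** A linear relation between the powers of [x] can be divided by its lowest
    power of [x]. The exponent is kept positive because [x ^+ 0 = 1] lies
    outside the corners to which this is applied. *)
Lemma power_recursion x :
  exists n q, [/\ x * q = q * x, (0 < n)%N & x ^+ n = x ^+ n.+1 * q].
Proof.
have [c [[i0 ci0] dep]] := linear_dependence (fun i : 'I_#|T|.+1 => x ^+ i)
  (ltnSn _).
case: (@arg_minnP _ i0 (fun i => c i != 0) val ci0) => i ci imin.
pose q := - sc (c i)^-1 *
  \sum_(j < #|T|.+1 | (i < j)%N) sc (c j) * x ^+ (j - i.+1).
have comx (y : F) : GRing.comm x (sc y) by rewrite /GRing.comm scC.
have xq : x * q = q * x.
  apply: commrM; first by apply: commrN; apply: comx.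
  by apply: commr_sum => j _; apply: commrM => //; apply: commrX.
have xi : x ^+ i = x ^+ i.+1 * q.
  have dep' : sc (c i) * x ^+ i =
      - \sum_(j < #|T|.+1 | (i < j)%N) sc (c j) * x ^+ j.
    apply/eqP; rewrite -addr_eq0 -[X in _ == X]dep [X in _ == X](bigD1 i) //=.
    rewrite [X in _ == _ + X](bigID (fun j : 'I__ => (i < j)%N)) /=.
    rewrite [X in _ == _ + (_ + X)]big1 ?addr0 => [|j /andP[jni ij]].
      apply/eqP; congr (_ + _); apply: eq_bigl => j.
      by case: (eqVneq j i) => [->|]; rewrite ?ltnn.
    have [->|/imin ilej] := eqVneq (c j) 0; first by rewrite rmorph0 mul0r.
    by move: ij; rewrite -leqNgt leq_eqVlt val_eqE (negPf jni) ltnNge ilej.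
  have -> : x ^+ i = sc (c i)^-1 * (sc (c i) * x ^+ i).
    by rewrite mulrA -rmorphM mulVf // rmorph1 mul1r.
  rewrite dep' /q mulNr !mulrN; congr (- _).
  rewrite mulrA -(scC _ (x ^+ i.+1)) -[RHS]mulrA; congr (_ * _).
  rewrite mulr_sumr; apply: eq_bigr => j ij.
  by rewrite mulrA -(scC _ (x ^+ _)) -mulrA -exprD subnKC.
by exists i.+1, q; split=> //; rewrite exprS {1}xi mulrA -exprS.
Qed.

(** Fitting's lemma. If [x ^+ n = x ^+ (n + n) * q ^+ n] for some [q] that
    commutes with [x], then [u = x ^+ n * q ^+ n] is an idempotent with
    [x ^+ n = x ^+ n * u]: if [u = 0] then [x] is nilpotent, and if [u = e] then
    [x] is a unit with inverse [e * (x ^+ n.-1 * q ^+ n)]. *)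
Lemma fitting e x : e * e = e -> in_corner e x ->
  [\/ exists u, [/\ u * u = u, in_corner e u, u != 0 & u != e],
      exists n, x ^+ n = 0 | corner_unit e x].
Proof.
move=> ee [ex xe]; have [n [q [xq n0 xn]]] := power_recursion x.
have cxq : GRing.comm x q by [].
have {}xn k : x ^+ n = x ^+ (n + k) * q ^+ k.
  elim: k => [|k IH]; first by rewrite addn0 mulr1.
  rewrite IH exprS mulrA; congr (_ * _).
  by rewrite addnS -addSn !exprD xn -!mulrA (commrX k (commr_sym cxq)).
have {}xn : x ^+ n = x ^+ n * x ^+ n * q ^+ n by rewrite -exprD -xn.
have cxqn : x ^+ n * q ^+ n = q ^+ n * x ^+ n.
  by apply: commrX; apply: commr_sym; apply: commrX; apply: commr_sym.
have exn : e * x ^+ n = x ^+ n by case: (n) n0 => // m _;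
  rewrite exprS mulrA ex.
have xne : x ^+ n * e = x ^+ n.
  by case: (n) n0 => // m _; rewrite exprSr -mulrA xe.
set u := x ^+ n * q ^+ n.
have uu : u * u = u.
  by rewrite /u !mulrA -(mulrA _ (q ^+ n) (x ^+ n)) -cxqn mulrA -xn.
have eu : in_corner e u.
  by split; rewrite /u; [rewrite mulrA exn | rewrite cxqn -mulrA xne].
have xu : x ^+ n = x ^+ n * u by rewrite /u mulrA.
have [u0|un0] := eqVneq u 0.
  by apply: Or32; exists n; rewrite xu u0 mulr0.
have [ue|une] := eqVneq u e; last by apply: Or31; exists u.
apply: Or33; case: n n0 @u uu eu xu ue {xn exn xne un0} cxqn =>
  // n _ u uu eu xu ue c.
(* A right and a left inverse, which coincide after multiplication by [e]. *)
pose w := x ^+ n * q ^+ n.+1 * e; pose w' := e * (q ^+ n.+1 * x ^+ n).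
have xw : x * w = e by rewrite /w !mulrA -exprS -/u ue.
have w'x : w' * x = e by rewrite /w' -!mulrA -exprSr -c -/u ue.
have ew : w' * e = e * w by rewrite -[in LHS]xw mulrA w'x.
exists (e * w); split.
- by split; [rewrite mulrA ee | rewrite /w -!mulrA ee].
- by rewrite mulrA xe.
- by rewrite -ew -mulrA ex.
Qed.

Lemma primitive_nilpotent_or_unit e x : primitive e -> in_corner e x ->
  (exists n, x ^+ n = 0) \/ corner_unit e x.
Proof.
case=> ee _ prim ex; case: (fitting ee ex) => [[u [uu eu u0 ue]]||];
  last 2 first.
- by left.
- by right.
by case: (prim u uu eu) => Eu; move: u0 ue; rewrite Eu ?eqxx.
Qed.

(** If [x] is nilpotent, the geometric series inverts [e - x]. *)
Lemma primitive_local e x y : primitive e -> in_corner e x -> in_corner e y ->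
  x + y = e -> corner_unit e x \/ corner_unit e y.
Proof.
move=> pe ex ey xy; have [ee _ _] := pe.
case: (primitive_nilpotent_or_unit pe ex) => [[n xn]|]; last by left.
right; have {xy} -> : y = e * (1 - x) by case: ex => ex _;
  rewrite mulrBr mulr1 ex -xy addrC addKr.
have comm : e * (1 - x) = (1 - x) * e.
  by case: ex => ex xe; rewrite mulrBr mulrBl ex xe mulr1 mul1r.
pose z := \sum_(i < n) x ^+ i.
have z1 : (1 - x) * z = 1.
  by rewrite -[LHS]opprK -mulNr opprB -subrX1 xn opprB subr0.
have z2 : z * (1 - x) = 1.
  rewrite -[RHS]z1; apply: commr_sym; apply: commr_sum => i _.
  by apply: commrX; apply: commr_sym; apply: commrB => //; apply: commr1.
exists (e * z * e); split.
- by split; rewrite ?mulrA ?ee // -!mulrA ee.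
- by rewrite !mulrA comm -(mulrA (1 - x)) ee -comm -(mulrA e) z1 mulr1 ee.
- by rewrite -!mulrA (mulrA e e) ee comm (mulrA z) z2 mul1r ee.
Qed.

(** Multiplying a linear relation by one of the idempotents isolates its term. *)
Lemma orthogonal_system_bound N (s : 'I_N -> A) e :
  orthogonal_system s e -> (N <= #|T|)%N.
Proof.
case=> ss orth s0 _; rewrite leqNgt; apply/negP => /linear_dependence-/(_ s).
case=> c [[i ci] dep]; move/eqP: (s0 i); apply.
have := congr1 (fun z => sc (c i)^-1 * (s i * z)) dep.
rewrite mulr0 mulr0 mulr_sumr (bigD1 i) //= big1 => [|j ji].
  by rewrite addr0 [s i * _]mulrA -scC -mulrA ss mulrA -rmorphM mulVf //
    rmorph1 mul1r.
by rewrite mulrA -scC -mulrA orth 1?eq_sym // mulr0.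
Qed.

Lemma orthogonal_system_absorb N (s : 'I_N -> A) e i :
  orthogonal_system s e -> in_corner e (s i).
Proof.
case=> ss orth _ <-; rewrite /in_corner mulr_suml mulr_sumr.
by split; rewrite (bigD1 i) //= ss big1 ?addr0 // => j ji;
  rewrite orth // eq_sym.
Qed.

Lemma split_orthogonal_system N (s : 'I_N -> A) e i u :
    orthogonal_system s e -> u * u = u -> in_corner (s i) u ->
    u != 0 -> u != s i ->
  exists s' : 'I_N.+1 -> A, orthogonal_system s' e.
Proof.
case=> ss orth s0 sum uu [su us] u0 usi.
pose r k := if k == i then u else s k.
pose s' (j : 'I_N.+1) := if unlift ord0 j is Some k then r k else s i - u.
have s'0 : s' ord0 = s i - u by rewrite /s' unlift_none.
have s'l k : s' (lift ord0 k) = r k by rewrite /s' liftK.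
have usk k : k != i -> u * s k = 0 by move=> ki;
  rewrite -us -mulrA orth 1?eq_sym // mulr0.
have sku k : k != i -> s k * u = 0 by move=> ki;
  rewrite -su mulrA orth // mul0r.
exists s'; split.
- move=> j; case: (unliftP ord0 j) => [k|] ->; rewrite ?s'0 ?s'l.
    by rewrite /r; case: eqP.
  by rewrite mulrBr !mulrBl ss su us uu subrr subr0.
- move=> j k; case: (unliftP ord0 j) => [j'|] ->;
    case: (unliftP ord0 k) => [k'|] ->;
    rewrite ?s'0 ?s'l ?eqxx // /r.
  + rewrite (inj_eq lift_inj) => jk; case: (eqVneq j' i) => [E|ji].
      have ki : k' != i by rewrite eq_sym -E.
    by rewrite (negPf ki) usk.
    by case: (eqVneq k' i) => [E|ki]; [rewrite sku | rewrite orth].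
  + move=> _; case: (eqVneq j' i) => [E|ji];
      first by rewrite mulrBr us uu subrr.
    by rewrite mulrBr orth // sku // subr0.
  + move=> _; case: (eqVneq k' i) => [E|ki];
      first by rewrite mulrBl su uu subrr.
    by rewrite mulrBl orth 1?eq_sym // usk // subr0.
- move=> j; case: (unliftP ord0 j) => [k|] ->; rewrite ?s'0 ?s'l /r.
    by case: (k == i).
  by rewrite subr_eq0 eq_sym.
- rewrite big_ord_recl s'0 -sum (bigD1 i) //= [in RHS](bigD1 i) //= s'l /r eqxx.
  rewrite addrA subrK; congr (_ + _); apply: eq_bigr => k ki.
  by rewrite s'l /r (negPf ki).
Qed.

(** Splitting a summand that is not primitive lengthens the system, and the
    length is bounded by the dimension. *)
Lemma refine_to_primitives M (s : 'I_M -> A) e : orthogonal_system s e ->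
  exists N (s' : 'I_N -> A),
    [/\ (M <= N)%N, orthogonal_system s' e & forall i, primitive (s' i)].
Proof.
have [n] := ubnP (#|T| - M)%N; elim: n M s => // n IH M s ltn os.
case: (boolp.pselect (forall i, primitive (s i))) => [prim|].
  by exists M, s.
move=> /boolp.existsNP[i npi]; case: (os) => ss _ s0 _.
have [u [uu su u0 us]] : exists u, [/\ u * u = u, in_corner (s i) u,
  u != 0 & u != s i].
  apply: boolp.contrapT => nu; apply: npi; split=> // u uu su.
  have [|u0] := eqVneq u 0; first by left.
  have [|us] := eqVneq u (s i); first by right.
  by case: nu; exists u.
have [s' os'] := split_orthogonal_system os uu su u0 us.
have bound := orthogonal_system_bound os'.
have [|N [s'' [MN os'' pr]]] := IH M.+1 s' _ os'.
  by rewrite ltnS in ltn; apply: leq_trans ltn;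
    rewrite subnS prednK // subn_gt0.
by exists N, s''; split=> //; apply: ltnW.
Qed.

End Idempotents.

(** * Group algebras *)

Section GroupAlgebra.
Variables (F : numClosedFieldType) (gT : finGroupType).

(** An alias, so that the product is the convolution and not the pointwise
    product of functions. *)
Definition galg := {ffun gT -> F}.
HB.instance Definition _ := GRing.Zmodule.on galg.

Definition galg1 : galg := [ffun g => (g == 1%g)%:R].
Definition galg_mul (a b : galg) : galg :=
  [ffun g => \sum_h a h * b (h^-1 * g)%g].

Fact galg_mulA : associative galg_mul.
Proof.
move=> a b c; apply/ffunP => g; rewrite !ffunE.
under eq_bigr => h _ do rewrite ffunE mulr_sumr.
under [RHS]eq_bigr => h _ do rewrite ffunE mulr_suml.
rewrite exchange_big [RHS]exchange_big /=.
rewrite [LHS]exchange_big /=; apply: eq_bigr => h _.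
rewrite [RHS](reindex_inj (mulgI h)) /=; apply: eq_bigr => k _.
by rewrite mulKg invMg mulgA mulrA.
Qed.

Fact galg_mul1l : left_id galg1 galg_mul.
Proof.
move=> a; apply/ffunP => g; rewrite ffunE (bigD1 1%g) //= ffunE eqxx mul1r.
rewrite invg1 mul1g big1 ?addr0 // => h /negPf h1.
by rewrite ffunE h1 mul0r.
Qed.

Fact galg_mul1r : right_id galg1 galg_mul.
Proof.
move=> a; apply/ffunP => g; rewrite ffunE (bigD1 g) //= ffunE mulVg eqxx mulr1.
rewrite big1 ?addr0 // => h hg.
by rewrite ffunE -eq_invg_mul invgK (negPf hg) mulr0.
Qed.

Fact galg_mulDl : left_distributive galg_mul +%R.
Proof.
move=> a b c; apply/ffunP => g; rewrite !ffunE -big_split.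
by apply: eq_bigr => h _; rewrite ffunE mulrDl.
Qed.

Fact galg_mulDr : right_distributive galg_mul +%R.
Proof.
move=> a b c; apply/ffunP => g; rewrite !ffunE -big_split.
by apply: eq_bigr => h _; rewrite ffunE mulrDr.
Qed.

Fact galg1_neq0 : galg1 != 0.
Proof.
by apply/eqP => /ffunP/(_ 1%g); rewrite !ffunE eqxx => /eqP; rewrite oner_eq0.
Qed.

HB.instance Definition _ := GRing.Zmodule_isNzRing.Build galg
  galg_mulA galg_mul1l galg_mul1r galg_mulDl galg_mulDr galg1_neq0.

Lemma galgM (a b : galg) g : (a * b) g = \sum_h a h * b (h^-1 * g)%g.
Proof. by rewrite ffunE. Qed.

Definition galg_sc (c : F) : galg := [ffun g => if g == 1%g then c else 0].

Lemma galg_scE c (a : galg) g : (galg_sc c * a) g = c * a g.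
Proof.
rewrite galgM (bigD1 1%g) //= ffunE eqxx invg1 mul1g big1 ?addr0 // => h.
by move/negPf => h1; rewrite ffunE h1 mul0r.
Qed.

Fact galg_sc_zmod_morphism : zmod_morphism galg_sc.
Proof. by move=> c d; apply/ffunP => g; rewrite !ffunE; case: ifP;
  rewrite ?subr0. Qed.
Fact galg_sc_monoid_morphism : monoid_morphism galg_sc.
Proof.
split; first by apply/ffunP => g; rewrite !ffunE; case: eqP.
by move=> c d; apply/ffunP => g; rewrite galg_scE !ffunE; case: ifP;
  rewrite ?mulr0.
Qed.
HB.instance Definition _ :=
  GRing.isZmodMorphism.Build F galg galg_sc galg_sc_zmod_morphism.
HB.instance Definition _ :=
  GRing.isMonoidMorphism.Build F galg galg_sc galg_sc_monoid_morphism.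

Lemma galg_scC : central_scalars galg_sc.
Proof.
move=> c a; apply/ffunP => g; rewrite galg_scE galgM (bigD1 g) //= ffunE mulVg
  eqxx.
rewrite mulrC big1 ?addr0 // => h hg.
by rewrite ffunE -eq_invg_mul invgK (negPf hg) mulr0.
Qed.

Lemma galg_coordinates :
  finite_coordinates galg_sc (fun (a : galg) g => a g).
Proof.
split=> [a b g|c a g|a b ab]; [by rewrite ffunE | exact: galg_scE |
  exact/ffunP].
Qed.

(** The conjugate-linear anti-involution [star] makes the group algebra
    semisimple: [(a * star a) 1] is a sum of squared moduli, so [a * star a]
    is never nilpotent for [a != 0]. *)
Definition star (a : galg) : galg := [ffun g => (a g^-1%g)^*].

Lemma starM a b : star (a * b) = star b * star a.
Proof.
apply/ffunP => g; rewrite [LHS]ffunE !galgM rmorph_sum /=.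
rewrite [LHS](reindex_inj (mulgI g^-1%g)) /=; apply: eq_bigr => h _.
by rewrite !ffunE rmorphM mulrC !invMg !invgK mulgK.
Qed.

Lemma star_star a : star (star a) = a.
Proof. by apply/ffunP => g; rewrite !ffunE invgK conjCK. Qed.

Lemma mul_star_eq0 a : a * star a = 0 -> a = 0.
Proof.
move=> /ffunP/(_ 1%g); rewrite galgM !ffunE => S0; apply/ffunP => g;
  rewrite ffunE.
have pos h : true -> 0 <= a h * star a (h^-1 * 1)%g.
  by move=> _; rewrite ffunE mulg1 invgK mul_conjC_ge0.
have /(_ g isT)/eqP := psumr_eq0P pos S0.
by rewrite ffunE mulg1 invgK mul_conjC_eq0 => /eqP.
Qed.

Lemma mul_star_not_nilpotent a n : a != 0 -> (a * star a) ^+ n != 0.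
Proof.
move=> a0; set z := a * star a.
have zz : star z = z by rewrite starM star_star.
have stars k : star (z ^+ k) = z ^+ k.
  elim: k => [|k IH]; last by rewrite [in LHS]exprS starM IH zz -exprSr.
  by apply/ffunP => g; rewrite !ffunE invg_eq1 rmorph_nat.
have pow k : z ^+ (2 ^ k) != 0.
  elim: k => [|k]; first by rewrite expn0 expr1; apply: contra_neq a0;
    apply: mul_star_eq0.
  by apply: contra_neq; rewrite expnS mul2n -addnn exprD -{2}(stars (2 ^ k)%N)
    => /mul_star_eq0.
apply: contra_neq (pow n) => zn.
by rewrite -(subnK (ltnW (ltn_expl n (ltnSn 1)))) exprD zn mulr0.
Qed.


Lemma corner_unit_not_nilpotent e (y v : galg) n : e != 0 -> e * e = e ->
  in_corner e y -> y * v = e -> y ^+ n != 0.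
Proof.
move=> e0 ee [ey ye] yv; apply/eqP => yn; move/eqP: e0; apply.
have yve k : y ^+ k * v ^+ k * e = e.
  elim: k => [|k IH]; first by rewrite !expr0 !mul1r.
  have ec : GRing.comm e (y ^+ k) by apply: commrX; rewrite /GRing.comm ey ye.
  rewrite exprSr exprS !mulrA -(mulrA _ y) yv -ec -!mulrA (mulrA (y ^+ k)) IH.
  exact: ee.
by rewrite -(yve n) yn !mul0r.
Qed.

(** The scalars are algebraically closed, so some [x - sc c * e] fails to be a
    unit of the corner of [e]; it is then nilpotent, and hence zero because a
    nonzero [y] in this corner has the non-nilpotent multiple
    [y * (e * star y * e)]. *)
Lemma corner_scalar e (x : galg) : primitive e -> in_corner e x ->
  exists c, x = galg_sc c * e.
Proof.
move=> pe [ex xe]; have [ee e0 _] := pe.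
have comx : commr_rmorph galg_sc x by move=> c; rewrite /GRing.comm galg_scC.
pose ev : {rmorphism {poly F} -> galg} := horner_morph comx.
  have evE q : ev q = \sum_(i < size q) galg_sc q`_i * x ^+ i.
    rewrite /ev /= /horner_morph (@horner_coef_wide _ (size q)) ?size_poly //.
    by apply: eq_bigr => i _; rewrite coef_map.
  have evX : ev 'X = x by apply: horner_morphX.
  have evC c : ev c%:P = galg_sc c by apply: horner_morphC.
(* Otherwise the factors of a split polynomial that kills [x] are all units. *)
have [c nu] : exists c, ~ corner_unit e (x - galg_sc c * e).
  apply: boolp.contrapT => /boolp.forallNP nu.
  have {}nu c : corner_unit e (x - galg_sc c * e) := boolp.contrapT (nu c).
  have prod0 (s : seq F) z : e * z = z ->
      ev (\prod_(r <- s) ('X - r%:P)) * z = 0 -> z = 0.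
    move=> ez; elim: s => [|r s IH]; first by rewrite big_nil rmorph1 mul1r.
    rewrite big_cons rmorphM => /= H; apply: IH; set w := _ * z.
    have ew : e * w = w.
      have cex : GRing.comm e x by rewrite /GRing.comm ex xe.
      rewrite /w mulrA; set P := ev _.
      suff -> : e * P = P * e by rewrite -mulrA ez.
      rewrite /P evE mulr_sumr mulr_suml; apply: eq_bigr => i _.
      rewrite mulrA -galg_scC -!mulrA; congr (_ * _).
      by apply: commrX.
    have [y [_ _ yx]] := nu r.
    move: H; rewrite rmorphB /= evX evC -mulrA -/w => H.
    by rewrite -ew -yx -mulrA mulrBl -mulrA ew -mulrBl H mulr0.
  have [a [[i ai] dep]] :=
    linear_dependence galg_coordinates (fun i : 'I_#|gT|.+1 =>
      x ^+ i) (ltnSn _).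
  pose p := \poly_(j < #|gT|.+1) (if insub j is Some i then a i else 0).
  have pa (j : 'I_#|gT|.+1) : p`_j = a j by rewrite coef_poly ltn_ord valK.
  have p0 : p != 0 by apply: contra_neq ai => p0; rewrite -pa p0 coef0.
  have evp : ev p = 0.
    rewrite /ev /= /horner_morph (@horner_coef_wide _ #|gT|.+1).
      by rewrite -[RHS]dep; apply: eq_bigr => j _; rewrite coef_map pa.
    by rewrite (leq_trans (size_poly _ _)) // size_poly.
  have [s ps] := closed_field_poly_normal p.
  move: evp; rewrite ps -mul_polyC rmorphM /= evC => H.
  case/eqP: e0; apply: (prod0 s) => //.
  rewrite -[X in X * e]mul1r -(rmorph1 galg_sc) -(mulVf (x := lead_coef p))
    ?lead_coef_eq0 //.
  by rewrite rmorphM -(mulrA _ _ (ev _)) H mulr0 mul0r.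
exists c; apply/eqP; rewrite -subr_eq0; apply/negP => /negP y0.
set y := x - _ in nu y0; have cy : in_corner e y.
  by rewrite /in_corner mulrBr mulrBl mulrA -galg_scC -!mulrA !ee ex xe.
have [ey ye] := cy.
have [[n yn]|//] := primitive_nilpotent_or_unit galg_scC galg_coordinates pe cy.
pose w := e * star y * e.
have pow k : (y * star y) ^+ k.+1 = (y * w) ^+ k * (y * star y).
  elim: k => [|k IH]; first by rewrite expr0 mul1r.
  rewrite exprSr IH [in RHS]exprSr -!mulrA; congr (_ * _).
  by rewrite /w !mulrA ye -!mulrA (mulrA e y) ey.
have cyw : in_corner e (y * w) by rewrite /in_corner mulrA ey /w -!mulrA ee.
have [[k ywk]|[v [_ ywv _]]] := primitive_nilpotent_or_unit galg_scC
  galg_coordinates pe cyw.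
  by have := mul_star_not_nilpotent k.+1 y0; rewrite pow ywk mul0r eqxx.
have := corner_unit_not_nilpotent (v := w * v) n e0 ee cy.
by rewrite yn eqxx mulrA => /(_ ywv).
Qed.

(** Schur's lemma: for a nonzero [x0] in [e A f], the element
    [y = f * star x0 * e] makes [x0 * y] and [y * x0] nonzero multiples of [e] and
    [f], and then [x = x * f] is a multiple of [x * y * x0], hence of [x0]. *)
Lemma hom_between_primitives e f : primitive e -> primitive f ->
  exists u, forall x : galg, e * x = x -> x * f = x -> exists c,
    x = galg_sc c * u.
Proof.
move=> pe pf; have [ee _ _] := pe; have [ff _ _] := pf.
case: (boolp.pselect (exists x, [/\ e * x = x, x * f = x & x != 0]));
  last first.
  move=> nx; exists 0 => x ex xf; exists 0; rewrite mulr0.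
  by apply/eqP; apply/negP => /negP x0; apply: nx; exists x.
case=> x0 [ex0 x0f nz]; exists x0 => x ex xf.
pose y := f * star x0 * e.
have [c xy] : exists c, x0 * y = galg_sc c * e.
  by apply: corner_scalar => //; split; rewrite /y !mulrA ?ex0 // -!mulrA ee.
have [d yx] : exists d, y * x0 = galg_sc d * f.
  by apply: corner_scalar => //; split; rewrite /y ?mulrA ?ff // -!mulrA x0f.
have [a xya] : exists a, x * y = galg_sc a * e.
  by apply: corner_scalar => //; split; rewrite /y !mulrA ?ex // -!mulrA ee.
have d0 : d != 0.
  apply: contra_neq (mul_star_not_nilpotent 3 nz) => d0.
  have E : x0 * star x0 * (x0 * star x0) = x0 * (y * x0) * star x0.
    by rewrite /y !mulrA x0f -!mulrA (mulrA e) ex0.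
  by rewrite 2!exprS expr1 E yx d0 rmorph0 mul0r mulr0 mul0r mulr0.
have E : galg_sc d * x = galg_sc a * x0.
  by rewrite -{1}xf mulrA galg_scC -mulrA -yx mulrA xya -mulrA ex0.
exists (d^-1 * a); rewrite rmorphM -mulrA -E mulrA -rmorphM mulVf //.
by rewrite rmorph1 mul1r.
Qed.

(** The Peirce decomposition writes the algebra as the sum of the spaces
    [s i * galg * s j], which are at most one-dimensional. *)
Lemma card_le_primitives N (s : 'I_N -> galg) :
  orthogonal_system s 1 -> (forall i, primitive (s i)) -> (#|gT| <= N ^ 2)%N.
Proof.
move=> [ss _ _ sum] prim.
have [u uP] := boolp.choice (fun p : 'I_N * 'I_N =>
  hom_between_primitives (prim p.1) (prim p.2)).
pose d g : galg := [ffun h => (h == g)%:R].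
have /boolp.choice[c cP] : forall q : gT * ('I_N * 'I_N), exists c,
    s q.2.1 * d q.1 * s q.2.2 = galg_sc c * u q.2.
  by move=> q; apply: uP; rewrite ?mulrA ?ss // -!mulrA ss.
have dE g : d g = \sum_p galg_sc (c (g, p)) * u p.
  rewrite -[LHS]mul1r -[LHS]mulr1 -sum mulr_suml mulr_suml.
  under eq_bigr => i _ do rewrite mulr_sumr.
  by rewrite pair_bigA; apply: eq_bigr => p _; rewrite -cP.
have -> : (N ^ 2)%N = #|{: 'I_N * 'I_N}| by rewrite card_prod card_ord mulnn.
pose B : 'M[F]_(#|gT|, #|{: 'I_N * 'I_N}|) :=
  \matrix_(i, p) c (enum_val i, enum_val p).
pose D : 'M[F]_(#|{: 'I_N * 'I_N}|, #|gT|) :=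
  \matrix_(p, j) u (enum_val p) (enum_val j).
apply: (@mulmx1_min _ _ _ B D); apply/matrixP => i j; rewrite !mxE.
have := congr1 (fun a : galg => a (enum_val j)) (dE (enum_val i)).
rewrite ffunE eq_sym (inj_eq enum_val_inj) => ->.
rewrite sum_ffunE (reindex (@enum_val {: 'I_N * 'I_N} predT)) /=; last first.
  by apply: onW_bij; apply: enum_val_bij.
by apply: eq_bigr => p _; rewrite !mxE galg_scE.
Qed.

End GroupAlgebra.

(** Linear independence makes the extension of [rho] to the group algebra
    injective, so that primitive idempotents have nonzero images. *)
Lemma idempotents_from_group (F : numClosedFieldType) (gT : finGroupType)
    (A : pzRingType) (sc : {rmorphism F -> A}) (rho : gT -> A) :
    central_scalars sc -> rho 1%g = 1 ->
    (forall g h, rho (g * h)%g = rho g * rho h) ->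
    (forall a : gT -> F, \sum_g sc (a g) * rho g = 0 -> forall g, a g = 0) ->
  exists N (s : 'I_N -> A), orthogonal_system s 1 /\ (#|gT| <= N ^ 2)%N.
Proof.
move=> scC rho1 rhoM free.
have sys1 : orthogonal_system (fun _ : 'I_1 => 1 : galg F gT) 1.
  by split=> [i|i j|i|]; rewrite ?mulr1 ?oner_eq0 ?big_ord1 // !ord1.
have [N [s [_ os prim]]] :=
  refine_to_primitives (@galg_scC F gT) (galg_coordinates F gT) sys1.
pose ext (a : galg F gT) : A := \sum_g sc (a g) * rho g.
have ext0 : ext 0 = 0 by apply: big1 => g _; rewrite ffunE rmorph0 mul0r.
have extD a b : ext (a + b) = ext a + ext b.
  by rewrite -big_split; apply: eq_bigr => g _; rewrite ffunE rmorphD mulrDl.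
have extM a b : ext (a * b) = ext a * ext b.
  rewrite /ext mulr_suml; under [RHS]eq_bigr => g _ do rewrite mulr_sumr.
  under [LHS]eq_bigr => g _ do rewrite galgM rmorph_sum mulr_suml.
  rewrite [LHS]exchange_big; apply: eq_bigr => g _.
  rewrite (reindex_inj (mulgI g)) /=; apply: eq_bigr => h _.
  rewrite mulKg rhoM rmorphM -!mulrA; congr (_ * _).
  by rewrite !mulrA scC.
have ext1 : ext 1 = 1.
  rewrite /ext (bigD1 1%g) //= ffunE eqxx rmorph1 mul1r rho1 big1 ?addr0 // =>
    g.
  by move/negPf => g1; rewrite ffunE g1 rmorph0 mul0r.
exists N, (fun i => ext (s i)); split; last exact: card_le_primitives os prim.
case: os => ss orth s0 sum; split.
- by move=> i; rewrite -extM ss.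
- by move=> i j ij; rewrite -extM orth.
- move=> i; apply/eqP => /free H; move/eqP: (s0 i); apply.
  by apply/ffunP => g; rewrite H ffunE.
- by rewrite -ext1 -sum; apply: esym; apply: (big_morph ext).
Qed.

(** * Krull-Schmidt decompositions in a Karoubi envelope *)

(** The laws that make the data a [F]-linear category with finite-dimensional
    morphism spaces. The additive laws hold on the ambient types [hom X Y],
    while composition is only required to behave well on morphisms. *)
Record linear_category (F : fieldType) (C : monoidal) := LinearCategory {
  opp : forall X Y : obj C, hom X Y -> hom X Y;
  scale : forall X Y : obj C, F -> hom X Y -> hom X Y;
  all_obj : forall X : obj C, is_obj X;
  morDA : forall X Y : obj C, associative (@morD C X Y);
  morDC : forall X Y : obj C, commutative (@morD C X Y);
  mor0D : forall X Y : obj C, left_id (mor0 X Y) morD;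
  morND : forall X Y : obj C, left_inverse (mor0 X Y) (@opp X Y) morD;
  scaleA : forall (X Y : obj C) a b (f : hom X Y),
    scale a (scale b f) = scale (a * b) f;
  scale1 : forall (X Y : obj C) (f : hom X Y), scale 1 f = f;
  scaleDr : forall (X Y : obj C) a (f g : hom X Y),
    scale a (morD f g) = morD (scale a f) (scale a g);
  scaleDl : forall (X Y : obj C) (f : hom X Y) a b,
    scale (a + b) f = morD (scale a f) (scale b f);
  is_mor0 : forall X Y : obj C, is_mor (mor0 X Y);
  is_morD : forall (X Y : obj C) (f g : hom X Y),
    is_mor f -> is_mor g -> is_mor (morD f g);
  is_mor_scale : forall (X Y : obj C) a (f : hom X Y),
    is_mor f -> is_mor (scale a f);
  is_mor1 : forall X : obj C, is_mor (mor1 X);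
  is_mor_comp : forall (X Y Z : obj C) (g : hom Y Z) (f : hom X Y),
    is_mor g -> is_mor f -> is_mor (comp g f);
  compA : forall (X Y Z W : obj C) (h : hom Z W) (g : hom Y Z) (f : hom X Y),
    is_mor h -> is_mor g -> is_mor f -> comp h (comp g f) = comp (comp h g) f;
  comp1m : forall (X Y : obj C) (f : hom X Y), is_mor f -> comp (mor1 Y) f = f;
  compm1 : forall (X Y : obj C) (f : hom X Y), is_mor f -> comp f (mor1 X) = f;
  compDl : forall (X Y Z : obj C) (g h : hom Y Z) (f : hom X Y),
    is_mor g -> is_mor h -> is_mor f ->
    comp (morD g h) f = morD (comp g f) (comp h f);
  compDr : forall (X Y Z : obj C) (h : hom Y Z) (f g : hom X Y),
    is_mor h -> is_mor f -> is_mor g ->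
    comp h (morD f g) = morD (comp h f) (comp h g);
  comp_scalel : forall (X Y Z : obj C) a (g : hom Y Z) (f : hom X Y),
    is_mor g -> is_mor f -> comp (scale a g) f = scale a (comp g f);
  comp_scaler : forall (X Y Z : obj C) a (g : hom Y Z) (f : hom X Y),
    is_mor g -> is_mor f -> comp g (scale a f) = scale a (comp g f);
  coordinates : forall X Y : obj C,
    exists (T : finType) (phi : hom X Y -> T -> F),
    [/\ forall f g t, phi (morD f g) t = phi f t + phi g t,
        forall a f t, phi (scale a f) t = a * phi f t
      & forall f g, is_mor f -> is_mor g -> phi f =1 phi g -> f = g]
}.

Section LinearCategoryTheory.
Variables (F : fieldType) (C : monoidal) (L : linear_category F C).
Implicit Types X Y Z : obj C.

(** An alias whose extra argument carries the vector space structure. *)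
Definition Hom (_ : linear_category F C) X Y := @hom C X Y.
HB.instance Definition _ X Y := boolp.gen_eqMixin (Hom L X Y).
HB.instance Definition _ X Y := boolp.gen_choiceMixin (Hom L X Y).
HB.instance Definition _ X Y := GRing.isZmodule.Build (Hom L X Y)
  (@morDA _ _ L X Y) (@morDC _ _ L X Y) (@mor0D _ _ L X Y) (@morND _ _ L X Y).
HB.instance Definition _ X Y := GRing.Zmodule_isLmodule.Build F (Hom L X Y)
  (@scaleA _ _ L X Y) (@scale1 _ _ L X Y) (@scaleDr _ _ L X Y)
  (@scaleDl _ _ L X Y).

Lemma morDE X Y (f g : hom X Y) : morD f g = (f : Hom L X Y) + g. Proof. by [].
  Qed.

Lemma comp0m X Y Z (f : hom X Y) : is_mor f -> comp (mor0 Y Z) f = mor0 X Z.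
Proof.
move=> mf; have E (V W : obj C) (g : hom V W) : scale L 0 g = mor0 V W.
  exact: (scale0r (g : Hom L V W)).
by rewrite -(E Y Z (mor0 Y Z)) (comp_scalel L) ?E //; apply: is_mor0 L _ _.
Qed.

Lemma compm0 X Y Z (g : hom Y Z) : is_mor g -> comp g (mor0 X Y) = mor0 X Z.
Proof.
move=> mg; have E (V W : obj C) (f : hom V W) : scale L 0 f = mor0 V W.
  exact: (scale0r (f : Hom L V W)).
by rewrite -(E X Y (mor0 X Y)) (comp_scaler L) ?E //; apply: is_mor0 L _ _.
Qed.

Lemma is_mor_sum X Y (I : Type) (r : seq I) (P : pred I) (f : I -> Hom L X Y) :
  (forall i, P i -> is_mor (f i)) -> is_mor (\sum_(i <- r | P i) f i).
Proof.
by move=> mf; apply: big_ind mf => [|g h];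
  [apply: is_mor0 L X Y | apply: is_morD L _ _ _ _].
Qed.

Lemma comp_suml X Y Z (I : Type) (r : seq I) (g : I -> Hom L Y Z) (f : hom X Y)
  :
  (forall i, is_mor (g i)) -> is_mor f ->
  comp (\sum_(i <- r) g i) f = \sum_(i <- r) (comp (g i) f : Hom L X Z).
Proof.
move=> mg mf; elim: r => [|i r IH]; first by rewrite !big_nil; apply: comp0m.
rewrite !big_cons -IH; apply: (compDl L) => //; exact: is_mor_sum.
Qed.

Lemma comp_sumr X Y Z (I : Type) (r : seq I) (g : hom Y Z) (f : I -> Hom L X Y)
  :
  is_mor g -> (forall i, is_mor (f i)) ->
  comp g (\sum_(i <- r) f i) = \sum_(i <- r) (comp g (f i) : Hom L X Z).
Proof.
move=> mg mf; elim: r => [|i r IH]; first by rewrite !big_nil; apply: compm0.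
rewrite !big_cons -IH; apply: (compDr L) => //; exact: is_mor_sum.
Qed.

Definition endo (_ : linear_category F C) X := {f : hom X X | is_mor f}.

Section EndomorphismRing.
Variable X : obj C.
Implicit Types f g h : endo L X.

Lemma endo_inj f g : sval f = sval g -> f = g.
Proof. by case: f g => f mf [g mg] /= E; case: _ / E mg => mg;
  rewrite (boolp.Prop_irrelevance mf mg). Qed.

Lemma sval_eq f g : f = g -> sval f = sval g. Proof. by move->. Qed.

HB.instance Definition _ := boolp.gen_eqMixin (endo L X).
HB.instance Definition _ := boolp.gen_choiceMixin (endo L X).

Definition endo0 : endo L X := exist _ (mor0 X X) (is_mor0 L X X).
Definition endo1 : endo L X := exist _ (mor1 X) (is_mor1 L X).
Definition endoD f g : endo L X :=
  exist _ (morD (sval f) (sval g)) (is_morD L (svalP f) (svalP g)).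
Definition endoM f g : endo L X :=
  exist _ (comp (sval f) (sval g)) (is_mor_comp L (svalP f) (svalP g)).
Definition endo_scale a f : endo L X :=
  exist _ (scale L a (sval f)) (is_mor_scale L a (svalP f)).

Fact endoDA : associative endoD. Proof. by move=> f g h; apply: endo_inj;
  apply: morDA L _ _ _ _ _. Qed.
Fact endoDC : commutative endoD. Proof. by move=> f g; apply: endo_inj;
  apply: morDC L _ _ _ _. Qed.
Fact endo0D : left_id endo0 endoD. Proof. by move=> f; apply: endo_inj;
  apply: mor0D L _ _ _. Qed.
Fact endoND : left_inverse endo0 (endo_scale (-1)) endoD.
Proof.
move=> f; apply: endo_inj; have := addNr (sval f : Hom L X X).
by rewrite -scaleN1r.
Qed.
Fact endoMA : associative endoM.
Proof. by move=> f g h; apply: endo_inj;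
  apply: compA L _ _ _ _ _ _ _ (svalP f) (svalP g) (svalP h). Qed.
Fact endo1M : left_id endo1 endoM. Proof. by move=> f; apply: endo_inj;
  apply: comp1m L _ _ _ (svalP f). Qed.
Fact endoM1 : right_id endo1 endoM. Proof. by move=> f; apply: endo_inj;
  apply: compm1 L _ _ _ (svalP f). Qed.
Fact endoMDl : left_distributive endoM endoD.
Proof. by move=> f g h; apply: endo_inj;
  apply: compDl L _ _ _ _ _ _ (svalP f) (svalP g) (svalP h). Qed.
Fact endoMDr : right_distributive endoM endoD.
Proof. by move=> f g h; apply: endo_inj;
  apply: compDr L _ _ _ _ _ _ (svalP f) (svalP g) (svalP h). Qed.

HB.instance Definition _ := GRing.isPzRing.Build (endo L X)
  endoDA endoDC endo0D endoND endoMA endo1M endoM1 endoMDl endoMDr.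

Definition endo_sc a : endo L X := endo_scale a endo1.

Lemma endo_scE a f : endo_sc a * f = endo_scale a f.
Proof.
apply: endo_inj => /=; rewrite (comp_scalel L) ?(comp1m L) //;
  by [apply: svalP | apply: is_mor1 L _].
Qed.

Fact endo_sc_zmod_morphism : zmod_morphism endo_sc.
Proof.
move=> a b; apply: endo_inj => /=.
apply: etrans (scalerBl a b (mor1 X : Hom L X X)) _.
by rewrite -scaleN1r.
Qed.
Fact endo_sc_monoid_morphism : monoid_morphism endo_sc.
Proof.
split; first by apply: endo_inj; apply: scale1.
by move=> a b; rewrite endo_scE; apply: endo_inj; rewrite /= (scaleA L).
Qed.
HB.instance Definition _ :=
  GRing.isZmodMorphism.Build F (endo L X) endo_sc endo_sc_zmod_morphism.
HB.instance Definition _ :=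
  GRing.isMonoidMorphism.Build F (endo L X) endo_sc endo_sc_monoid_morphism.

Lemma endo_scC : central_scalars endo_sc.
Proof.
move=> a f; rewrite endo_scE; apply: endo_inj => /=.
rewrite (comp_scaler L) ?(compm1 L) //; by [apply: svalP | apply: is_mor1 L _].
Qed.

Lemma endo_coordinates : exists (T : finType) (phi : endo L X -> T -> F),
  finite_coordinates endo_sc phi.
Proof.
have [T [phi [D Z inj]]] := coordinates L X X.
exists T, (fun f => phi (sval f)); split => [f g t|a f t|f g fg].
- exact: D.
- by rewrite endo_scE; apply: Z.
- by apply: endo_inj; apply: inj fg; apply: svalP.
Qed.

Lemma val_endo_sum N (f : 'I_N -> endo L X) :
  sval (\sum_i f i) = \big[morD/mor0 X X]_(i < N) sval (f i).
Proof. by apply: (big_morph sval). Qed.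

End EndomorphismRing.

Section Karoubi.
Local Notation K := (karoubi_envelope C).
Implicit Types A B : obj K.

Lemma karoubi_comp_idem A B (f : hom A B) : is_obj A -> is_obj B ->
  is_mor f -> comp f (mor1 A) = f /\ comp (mor1 B) f = f.
Proof.
move=> [_ mA AA] [_ mB BB] [mf fE]; rewrite /=.
have mAf := is_mor_comp L mf mA; have mBAf := is_mor_comp L mB mAf.
have E1 : comp (idem B) (comp f (idem A)) = f by exact: fE.
split; rewrite -[in RHS]E1 -[in LHS]E1.
  by rewrite -(compA L) // -(compA L) // AA.
by rewrite (compA L) // BB.
Qed.

Lemma karoubi_is_mor_comp A B D (g : hom B D) (f : hom A B) :
  is_obj A -> is_obj B -> is_obj D ->
  is_mor g -> is_mor f -> is_mor (comp g f).
Proof.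
move=> oA oB oD mg mf.
have [mg' _] := mg; have [mf' _] := mf.
have [_ gD] := karoubi_comp_idem oB oD mg.
have [fA _] := karoubi_comp_idem oA oB mf.
have [_ mA _] := oA; have [_ mD _] := oD.
split; first exact: is_mor_comp L _ _ _ _ _ _ _.
rewrite /= in gD fA mg' mf' *.
by rewrite -(compA L mg' mf' mA) fA (compA L mD mg' mf') gD.
Qed.

(** The projectors onto two complementary summands add up to the identity, so
    one of them is invertible, and it kills the other summand. *)
Lemma local_indecomposable A : is_obj A -> has_local_end A -> indecomposable A.
Proof.
move=> oA [nz loc]; split=> // B oB [inj [proj [mor ip orth sum]]].
have minj i : is_mor (inj i) by case: (mor i).
have mproj i : is_mor (proj i) by case: (mor i).
have kill i j : i != j -> is_iso (comp (inj i) (proj i)) -> is_zero (B j).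
  move=> ij [_ [v [mv _ uv]]].
  have [pA _] := karoubi_comp_idem oA (oB j) (mproj j).
  have [mj _] := minj j; have [mi _] := minj i.
  have [pj _] := mproj j; have [pi _] := mproj i; have [mv' _] := mv.
  have p0 : proj j = mor0 _ _.
    rewrite -pA -uv /= !(compA L) //; last exact: is_mor_comp L _ _ _ _ _ _ _.
    have /= -> := orth j i; last by rewrite eq_sym.
    by rewrite comp0m ?comp0m.
  by rewrite /is_zero -ip p0; apply: comp0m.
have S : morD (comp (inj ord0) (proj ord0)) (comp (inj ord_max) (proj ord_max))
     = mor1 A.
  rewrite -sum !big_ord_recl big_ord0 /=.
  have -> : lift ord0 ord0 = ord_max :> 'I_2 by apply: val_inj.
  by congr (morD _ _); rewrite (morDC L) (mor0D L).
have mc i : is_mor (comp (inj i) (proj i)) by apply: karoubi_is_mor_comp.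
case: (loc _ _ (mc ord0) (mc ord_max) S) => iso.
- by exists ord_max; apply: (kill ord0).
- by exists ord0; apply: (kill ord_max).
Qed.

(** The summands are the images of primitive idempotents: the endomorphism ring
    of such an image is the corner of the idempotent, which is local. *)
Lemma karoubi_decomposition A M (s : 'I_M -> endo L (carrier A)) e :
    orthogonal_system s e -> sval e = idem A ->
  exists N (Y : 'I_N -> obj K), [/\ (M <= N)%N,
    forall i, is_obj (Y i) /\ has_local_end (Y i) & is_direct_sum A Y].
Proof.
move=> os eA; have [T [phi phiP]] := endo_coordinates (carrier A).
have [N [r [MN [rr orth r0 sum] prim]]] := refine_to_primitives (@endo_scC _)
  phiP os.
have osr : orthogonal_system r e by split.
exists N, (fun i => Idempotent (sval (r i))); split=> // [i|].
  have mcorner (f : @hom K (Idempotent (sval (r i))) (Idempotent (sval (r i))))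
    :
      is_mor f -> exists2 g : endo L (carrier A),
        sval g = f & in_corner (r i) g.
    case=> mf fE; pose g : endo L (carrier A) := exist _ f mf.
    exists g => //; have E : r i * (g * r i) = g by apply: endo_inj.
    by split; rewrite -E ?mulrA ?rr // -!mulrA rr.
  have cornerm (g : endo L (carrier A)) : in_corner (r i) g ->
      @is_mor K (Idempotent (sval (r i))) (Idempotent (sval (r i))) (sval g).
    case=> rg gr; split; first exact: svalP g.
    by rewrite -[RHS](sval_eq rg) -[in RHS]gr.
  split.
    by split; [apply: all_obj L _ | apply: svalP | apply: sval_eq (rr i)].
  split.
    move=> z; move/eqP: (r0 i); apply; exact: endo_inj.
  move=> f g /mcorner[f' <- cf] /mcorner[g' <- cg] fg.
  have {}fg : f' + g' = r i by apply: endo_inj.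
  have isoP (h : endo L (carrier A)) : in_corner (r i) h -> corner_unit (r i) h
    ->
      @is_iso K (Idempotent (sval (r i))) (Idempotent (sval (r i))) (sval h).
    move=> ch [y [cy hy yh]]; split; first exact: cornerm.
    exists (sval y); split; first exact: cornerm.
      exact: (sval_eq yh).
    exact: (sval_eq hy).
  by case: (primitive_local (@endo_scC _) phiP (prim i) cf cg fg) => u;
    [left | right]; apply: isoP.
exists (fun i => sval (r i)), (fun i => sval (r i)).
have absorb i : in_corner e (r i) by apply: orthogonal_system_absorb osr.
split=> [i|i|i j ij|].
- have [er re] := absorb i.
  by split; (split; first exact: svalP (r i)); rewrite /= -?eA;
    [have := sval_eq (rr i) | have := sval_eq re]; rewrite /= => ->;
    [apply: (sval_eq er) | apply: (sval_eq (rr i))].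
- exact: sval_eq (rr i).
- exact: sval_eq (orth i j ij).
- rewrite [RHS]/= -eA -sum val_endo_sum; apply: eq_bigr => i _.
  exact: sval_eq (rr i).
Qed.

Theorem karoubi_krull_schmidt : krull_schmidt K.
Proof.
move=> A [_ mA AA].
pose e : endo L (carrier A) := exist _ (idem A) mA.
have ee : e * e = e by apply: endo_inj.
(* The zero object is the empty sum. *)
have [e0|e0] := eqVneq e 0.
  have os : orthogonal_system (fun _ : 'I_0 => 0 : endo L (carrier A)) e.
    by split=> [[]|[]|[]|] //; rewrite big_ord0.
  by have [N [Y [_ loc sum]]] := karoubi_decomposition os erefl; exists N, Y.
have os : orthogonal_system (fun _ : 'I_1 => e) e.
  by split=> // [i j|]; rewrite ?ord1 ?big_ord1 // (ord1 j) eqxx.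
by have [N [Y [_ loc sum]]] := karoubi_decomposition os erefl; exists N, Y.
Qed.

End Karoubi.

End LinearCategoryTheory.

Lemma factorial_superexponential (R : realType) (c : R) : 1 <= c ->
  exists A : R, 0 < A /\ forall n, A * c ^+ n <= (n`!)%:R.
Proof.
move=> c1; have c0 : 0 < c by apply: lt_le_trans c1.
have [K cK] : exists K : nat, c <= K%:R.
  by exists (Num.bound c); apply/ltW/archi_boundP/ltW.
(* Below [K] the left side is at most [1], and beyond [K] each step multiplies
   the right side by more than [c]. *)
exists (c ^- K); split; first by rewrite invr_gt0 exprn_gt0.
elim=> [|n IH]; first by rewrite mulr1 invf_le1 ?exprn_gt0 // exprn_ege1.
have [nK|Kn] := leqP n.+1 K.
  apply: (@le_trans _ _ 1); last by rewrite ler1n fact_gt0.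
  by rewrite mulrC ler_pdivrMr ?exprn_gt0 // mul1r ler_weXn2l.
rewrite factS natrM exprS mulrCA; apply: ler_pM => //.
- exact: ltW.
- by rewrite mulr_ge0 ?invr_ge0 ?exprn_ge0 // ltW.
- by apply: le_trans cK _; rewrite ler_nat ltnW.
Qed.

(** Refining the given systems bounds the numbers of summands from below. A
    square root of [n!] suffices since the square of [gamma] is as good as
    [gamma]. *)
Lemma growth_from_idempotents (R : realType) (F : fieldType) (C : monoidal)
    (L : linear_category F C) (X : obj (karoubi_envelope C)) :
    is_obj X ->
    (forall n, exists M (s : 'I_M -> endo L (carrier (tpower X n))) e,
       [/\ orthogonal_system s e, sval e = idem (tpower X n) & (n`! <= M ^
         2)%N]) ->
  superexponential_growth (karoubi_envelope C) R.
Proof.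
move=> oX sys; split; first exact: karoubi_krull_schmidt L.
have /boolp.choice[b bP] : forall n, exists N,
    number_of_summands (tpower X n) N /\ (n`! <= N ^ 2)%N.
  move=> n; have [M [s [e [os eE nM]]]] := sys n.
  have [N [Y [MN loc sum]]] := karoubi_decomposition os eE.
  exists N; split; last by rewrite (leq_trans nM) // leq_exp2r.
  exists Y; split=> // i; have [oY lY] := loc i;
    exact: (local_indecomposable L).
exists X, b; split=> // [n|gamma gamma1]; first by case: (bP n).
have [|A [A0 AP]] := @factorial_superexponential R (gamma ^+ 2).
  by rewrite exprn_ege1 // ltW.
exists (Num.min 1 A), 0%N; split; first by rewrite lt_min ltr01.
move=> n _; have g0 : 0 <= gamma by rewrite (le_trans ler01) // ltW.
have m0 : 0 <= Num.min 1 A by rewrite le_min ler01 ltW.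
rewrite -(@ler_pXn2r _ 2) ?nnegrE ?mulr_ge0 ?exprn_ge0 //.
apply: (@le_trans _ _ (n`!)%:R); last by have [_] := bP n;
  rewrite -natrX ler_nat.
apply: le_trans (AP n); rewrite exprMn -!exprM mulnC.
rewrite ler_wpM2r ?exprn_ge0 // expr2.
apply: (@le_trans _ _ (1 * Num.min 1 A));
  last by rewrite mul1r ge_min lexx orbT.
by rewrite ler_wpM2r // ge_min lexx.
Qed.

(** * Additive envelopes *)

Section AdditiveEnvelope.
Variables (F : fieldType) (C : monoidal) (L : linear_category F C).
Local Notation M := (additive_envelope C).
Implicit Types X Y Z : family C.

Lemma matrix_hom_ext X Y (f g : matrix_hom X Y) :
  (forall j i, f j i = g j i) -> f = g.
Proof.
move=> fg; apply: boolp.functional_extensionality_dep => j.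
by apply: boolp.functional_extensionality_dep => i.
Qed.

Lemma matrix_mor1_diag X i : @matrix_mor1 C X i i = mor1 (entry i).
Proof. by rewrite /matrix_mor1; case: eqP => // e; rewrite (eq_axiomK e). Qed.

Lemma matrix_mor1_offdiag X i j : i != j -> @matrix_mor1 C X j i = mor0 _ _.
Proof. by rewrite /matrix_mor1; case: eqP. Qed.

Lemma is_mor_matrix_mor1 X i j : is_mor (@matrix_mor1 C X j i).
Proof.
case: (eqVneq i j) => [->|ij]; first by rewrite matrix_mor1_diag;
  apply: is_mor1 L _.
by rewrite matrix_mor1_offdiag //; apply: is_mor0 L _ _.
Qed.

Lemma matrix_compE X Y Z (g : @hom M Y Z) (f : @hom M X Y) k i :
  comp g f k i = \sum_(j : index Y) (comp (g k j) (f j i) : Hom L (entry i)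
    (entry k)).
Proof. by []. Qed.

Lemma matrix_is_mor_comp X Y Z (g : @hom M Y Z) (f : @hom M X Y) :
  is_mor g -> is_mor f -> is_mor (comp g f).
Proof. by move=> mg mf k i; apply: (@is_mor_sum _ _ L) => j _;
  apply: (is_mor_comp L). Qed.

Lemma matrix_compA X Y Z W (h : @hom M Z W) (g : @hom M Y Z) (f : @hom M X Y) :
  is_mor h -> is_mor g -> is_mor f -> comp h (comp g f) = comp (comp h g) f.
Proof.
move=> mh mg mf; apply: matrix_hom_ext => l i; rewrite !matrix_compE.
transitivity (\sum_(k : index Z) \sum_(j : index Y)
    (comp (h l k) (comp (g k j) (f j i)) : Hom L (entry i) (entry l))).
  apply: eq_bigr => k _; rewrite matrix_compE (@comp_sumr _ _ L) // => j.
  exact: (is_mor_comp L).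
rewrite exchange_big; apply: eq_bigr => j _.
rewrite matrix_compE (@comp_suml _ _ L) // => [|k]; last exact: (is_mor_comp L).
by apply: eq_bigr => k _; apply: (compA L).
Qed.

Lemma matrix_comp1m X Y (f : @hom M X Y) : is_mor f -> comp (@mor1 M Y) f = f.
Proof.
move=> mf; apply: matrix_hom_ext => k i; rewrite matrix_compE (bigD1 k) //=.
rewrite matrix_mor1_diag (comp1m L) // big1 ?addr0 // => j jk.
by rewrite matrix_mor1_offdiag // (comp0m L).
Qed.

Lemma matrix_compm1 X Y (f : @hom M X Y) : is_mor f -> comp f (@mor1 M X) = f.
Proof.
move=> mf; apply: matrix_hom_ext => k i; rewrite matrix_compE (bigD1 i) //=.
rewrite matrix_mor1_diag (compm1 L) // big1 ?addr0 // => j jk.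
by rewrite matrix_mor1_offdiag 1?eq_sym // (compm0 L).
Qed.

Lemma matrix_coordinates X Y :
  exists (T : finType) (phi : matrix_hom X Y -> T -> F),
    [/\ forall f g t, phi (@morD M _ _ f g) t = phi f t + phi g t,
        forall a f t, phi (fun j i => scale L a (f j i)) t = a * phi f t
      & forall f g, @is_mor M _ _ f -> @is_mor M _ _ g -> phi f =1 phi g -> f =
        g].
Proof.
pose c (p : index Y * index X) := boolp.cid (coordinates L (entry p.2) (entry
  p.1)).
pose T p : finType := sval (c p).
pose d p := boolp.cid (svalP (c p)).
exists {p : index Y * index X & T p}, (fun f t =>
  sval (d (tag t)) (f (tag t).1 (tag t).2) (tagged t)).
split=> [f g [p t]|a f [p t]|f g mf mg fg] /=.
- by case: (svalP (d p)) => D _ _; apply: D.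
- by case: (svalP (d p)) => _ Z _; apply: Z.
apply: matrix_hom_ext => j i; case: (svalP (d (j, i))) => _ _ inj.
by apply: inj => // t; apply: (fg (@Tagged _ (j, i) T t)).
Qed.

Definition additive_envelope_linear : linear_category F M.
Proof.
pose op (X Y : obj M) (f : hom X Y) : hom X Y := fun j i => opp L (f j i).
pose sc (X Y : obj M) a (f : hom X Y) : hom X Y := fun j i => scale L a (f j i).
apply: (@LinearCategory F M op sc).
- by move=> X i; apply: all_obj L _.
- by move=> X Y f g h; apply: matrix_hom_ext => j i; apply: morDA L _ _ _ _ _.
- by move=> X Y f g; apply: matrix_hom_ext => j i; apply: morDC L _ _ _ _.
- by move=> X Y f; apply: matrix_hom_ext => j i; apply: mor0D L _ _ _.
- by move=> X Y f; apply: matrix_hom_ext => j i; apply: morND.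
- by move=> X Y a b f; apply: matrix_hom_ext => j i; apply: scaleA.
- by move=> X Y f; apply: matrix_hom_ext => j i; apply: scale1.
- by move=> X Y a f g; apply: matrix_hom_ext => j i; apply: scaleDr.
- by move=> X Y f a b; apply: matrix_hom_ext => j i; apply: scaleDl.
- by move=> X Y j i; apply: is_mor0 L _ _.
- by move=> X Y f g mf mg j i; apply: (is_morD L).
- by move=> X Y a f mf j i; apply: is_mor_scale.
- by move=> X j i; apply: is_mor_matrix_mor1.
- exact: matrix_is_mor_comp.
- exact: matrix_compA.
- exact: matrix_comp1m.
- exact: matrix_compm1.
- move=> X Y Z g h f mg mh mf; apply: matrix_hom_ext => k i /=.
  rewrite (morDE L) -big_split; apply: eq_bigr => j _; exact: (compDl L).
- move=> X Y Z h f g mh mf mg; apply: matrix_hom_ext => k i /=.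
  rewrite (morDE L) -big_split; apply: eq_bigr => j _; exact: (compDr L).
- move=> X Y Z a g f mg mf; apply: matrix_hom_ext => k i.
  apply: etrans (esym (scaler_sumr a _ _ (fun j =>
    comp (g k j) (f j i) : Hom L (entry i) (entry k)))).
  by apply: eq_bigr => j _; apply: comp_scalel.
- move=> X Y Z a g f mg mf; apply: matrix_hom_ext => k i.
  apply: etrans (esym (scaler_sumr a _ _ (fun j =>
    comp (g k j) (f j i) : Hom L (entry i) (entry k)))).
  by apply: eq_bigr => j _; apply: comp_scaler.
- exact: matrix_coordinates.
Defined.

End AdditiveEnvelope.

(** * Growth from actions of the symmetric groups *)

Section SymmetricGroups.
Variables (R : realType) (F : numClosedFieldType) (C : monoidal).
Variables (L : linear_category F C) (pw : nat -> obj C).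
Variable rho : forall n, 'S_n -> hom (pw n) (pw n).
Hypotheses (pw0 : tunit = pw 0) (pwS : forall n, tens (pw n) (pw 1) = pw n.+1).
Hypothesis tens1 : forall n, tensm (mor1 (pw n)) (mor1 (pw 1)) = mor1 _.
Hypothesis rho_mor : forall n s, is_mor (@rho n s).
Hypothesis rho1 : forall n, @rho n 1%g = mor1 (pw n).
Hypothesis rhoM : forall n s s', @rho n (s * s')%g = comp (rho s) (rho s').
Hypothesis rho_free : forall n (a : 'S_n -> F),
  \sum_s a s *: (rho s : Hom L (pw n) (pw n)) = 0 -> forall s, a s = 0.

Local Notation M := (additive_envelope C).
Local Notation K := (karoubi_envelope M).

Definition one_entry (I : finType) (Z : obj C) : family C := @Family C I (fun=>
  Z).

Lemma one_entry_mor1 (I : finType) Z : #|I| = 1%N ->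
  @matrix_mor1 C (one_entry I Z) = fun j i => mor1 Z.
Proof.
move=> /fintype1[x Ix]; apply: matrix_hom_ext => j i.
by rewrite (Ix j) (Ix i) matrix_mor1_diag.
Qed.

Definition generator : obj K := @Idempotent M (one_entry unit (pw 1)) (mor1 _).

(** The index type is a product of copies of [unit], which is why it is only
    known to have one element. *)
Lemma tpower_generator n : exists I : finType, #|I| = 1%N /\
  tpower generator n = @Idempotent M (one_entry I (pw n)) (mor1 _).
Proof.
elim: n => [|n [I [I1 IH]]].
  by exists unit; rewrite card_unit; split;
    rewrite //= /additive_envelope /= pw0.
exists (I * unit)%type; rewrite card_prod I1 card_unit; split=> //.
rewrite [tpower _ _]/= IH -(pwS n).
apply: (congr1 (@Idempotent M (one_entry (I * unit)%type (tens (pw n) (pw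
  1))))).
have c1 : #|{: I * unit}| = 1%N by rewrite card_prod I1 card_unit.
rewrite [RHS](one_entry_mor1 _ c1) /= (one_entry_mor1 _ I1).
rewrite (one_entry_mor1 _ card_unit); apply: matrix_hom_ext => j i.
exact: tens1.
Qed.

(** Linear independence of the permutations makes the idempotents of the group
    algebra of ['S_n] act as nonzero idempotents of the [n]-th tensor power. *)
Lemma growth_from_symmetric_groups : superexponential_growth K R.
Proof.
pose LM := additive_envelope_linear L.
have oX : is_obj generator.
  split; first by move=> i; apply: all_obj L _.
    by apply: is_mor1 LM _.
  by apply: (comp1m LM); apply: is_mor1 LM _.
apply: (growth_from_idempotents R (L := LM) oX) => n.
have [I [I1 ->]] := tpower_generator n; set Z := one_entry I (pw n).
have [i0 I0] := fintype1 I1.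
have sumI (V : nmodType) (f : I -> V) : \sum_i f i = f i0.
  by rewrite (big_pred1 i0) // => i; rewrite (I0 i) /= eqxx.
pose r (s : 'S_n) : endo LM Z :=
  exist (@is_mor M Z Z) (fun _ _ => rho s) (fun _ _ => rho_mor s).
have r1 : r 1%g = 1.
  by apply: endo_inj; rewrite /= one_entry_mor1 // rho1.
have rM s s' : r (s * s')%g = r s * r s'.
  apply: endo_inj; apply: matrix_hom_ext => j i /=.
  apply: etrans (rhoM s s') _.
  exact: esym (sumI (Hom L (pw n) (pw n)) (fun=> comp (rho s) (rho s'))).
have indep (a : 'S_n -> F) : \sum_s endo_sc LM Z (a s) * r s = 0 -> forall s,
  a s = 0.
  move=> S0; apply: (@rho_free n); have := congr1 (fun f => sval f i0 i0) S0.
  have ev (f : endo LM Z) g :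
    sval (f + g) i0 i0 = (sval f i0 i0 : Hom L (pw n) (pw n)) + sval g i0 i0 by
      [].
  rewrite (big_morph (fun f : endo LM Z => sval f i0 i0) ev erefl) => E.
  apply: etrans E; apply: eq_bigr => s _.
  by rewrite endo_scE.
have [N [s [os nN]]] := idempotents_from_group (@endo_scC _ _ _ _) r1 rM indep.
by exists N, s, 1; split=> //; rewrite card_Sn in nN.
Qed.

End SymmetricGroups.

(** * Tensor powers of the defining representation *)

Section LinearFunctions.
Variables (F : pzRingType) (U V : lmodType F) (f : U -> V).
Hypothesis lf : linear f.

Lemma linear0_of : f 0 = 0.
Proof. by have := lf (-1) 0 0; rewrite scaler0 addr0 scaleN1r addNr. Qed.

Lemma linearD_of u v : f (u + v) = f u + f v.
Proof. by have := lf 1 u v; rewrite !scale1r. Qed.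

Lemma linearZ_of a u : f (a *: u) = a *: f u.
Proof. by have := lf a u 0; rewrite linear0_of !addr0. Qed.

End LinearFunctions.

Section TensorPowers.
Variable F : numClosedFieldType.
Local Notation word n := {ffun 'I_n -> nat}.
Local Notation tpow := (tpow F).

Lemma coef_basis n (w v : word n) : mcoeff v (basis F w) = (w == v)%:R.
Proof. by rewrite mcoeffU. Qed.

Lemma sum_coef_delta n (u : tpow n) (c : word n) :
  \sum_(a <- msupp u) mcoeff a u * (a == c)%:R = mcoeff c u.
Proof.
have [cu|cu] := boolP (c \in msupp u); last first.
  rewrite mcoeff_outdom // big_seq big1 // => a au.
  by case: eqP => [E|]; rewrite ?mulr0 //; move: cu; rewrite -E au.
rewrite (bigD1_seq c) ?fset_uniq //= eqxx mulr1 big1 ?addr0 // => a /negPf->.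
by rewrite mulr0.
Qed.

Lemma coef_extend m n (f : word m -> tpow n) u v :
  mcoeff v (extend f u) = \sum_(w <- msupp u) mcoeff w u * mcoeff v (f w).
Proof.
rewrite /extend (big_morph _ (mcoeffD v) (mcoeff0 v)).
by apply: eq_bigr => w _; rewrite mcoeffZ.
Qed.

Lemma extend_widen m n (f : word m -> tpow n) u (D : {fset word m}) :
  (msupp u `<=` D)%fset -> extend f u = \sum_(w <- D) mcoeff w u *: f w.
Proof.
move=> uD; apply: big_fset_incl => // w _ wu.
by rewrite mcoeff_outdom // scale0r.
Qed.

Lemma extend_linear m n (f : word m -> tpow n) : linear (extend f).
Proof.
move=> a u v; pose D := (msupp (a *: u + v) `|` (msupp u `|` msupp v))%fset.
have uD : (msupp u `<=` D)%fset by rewrite fsubsetU // fsubsetUl orbT.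
have vD : (msupp v `<=` D)%fset by rewrite fsubsetU // fsubsetUr orbT.
rewrite (extend_widen f uD) (extend_widen f vD) (@extend_widen _ _ f _ D)
  ?fsubsetUl //.
rewrite scaler_sumr -big_split; apply: eq_bigr => w _.
by rewrite mcoeffD mcoeffZ scalerDl scalerA.
Qed.

Lemma extend_basis m n (f : word m -> tpow n) w : extend f (basis F w) = f w.
Proof. by rewrite /extend msuppU oner_eq0 big_seq_fset1 mcoeffU eqxx scale1r.
  Qed.

Lemma linear_expand m n (f : tpow m -> tpow n) : linear f ->
  f = extend (fun w => f (basis F w)).
Proof.
move=> lf; apply: boolp.funext => u.
have fsum (r : seq (word m)) (c : word m -> F) :
    f (\sum_(w <- r) c w *: basis F w) = \sum_(w <- r) c w *: f (basis F w).
  elim: r => [|w r IH]; first by rewrite !big_nil linear0_of.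
  by rewrite !big_cons lf IH.
rewrite {1}(monalgE u) /extend -fsum; congr f; apply: eq_bigr => w _.
by apply/malgP => v; rewrite mcoeffZ !mcoeffU mulr_natr.
Qed.

Lemma linear_ext m n (f g : tpow m -> tpow n) : linear f -> linear g ->
  (forall w, f (basis F w) = g (basis F w)) -> f = g.
Proof.
move=> lf lg fg; rewrite (linear_expand lf) (linear_expand lg).
by congr extend; apply: boolp.funext.
Qed.

Lemma concat_parts m n (w : word (m + n)) : concat (left_part w) (right_part w)
  = w.
Proof.
by apply/ffunP => i; rewrite ffunE; case: splitP => j E; rewrite ffunE;
  congr (w _); apply: val_inj.
Qed.

Lemma concat_eq m n (a : word m) (b : word n) w :
  (concat a b == w) = (a == left_part w) && (b == right_part w).
Proof.
apply/eqP/andP => [<-|[/eqP-> /eqP->]]; last exact: concat_parts.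
split; apply/eqP/ffunP => i; rewrite !ffunE.
  by have := unsplitK (inl i : 'I_m + 'I_n) => /= ->.
by have := unsplitK (inr i : 'I_m + 'I_n) => /= ->.
Qed.

Lemma coef_tpow_mul m n (u : tpow m) (v : tpow n) w :
  mcoeff w (tpow_mul u v) = mcoeff (left_part w) u * mcoeff (right_part w) v.
Proof.
rewrite coef_extend -(sum_coef_delta u) mulr_suml; apply: eq_bigr => a _.
rewrite -mulrA; congr (_ * _); rewrite coef_extend -(sum_coef_delta v)
  mulr_sumr.
apply: eq_bigr => b _; rewrite coef_basis concat_eq mulrCA.
by congr (_ * _); rewrite -natrM mulnb.
Qed.

Lemma tpow_mul_basis m n (a : word m) (b : word n) :
  tpow_mul (basis F a) (basis F b) = basis F (concat a b).
Proof. by rewrite /tpow_mul !extend_basis. Qed.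

Lemma tpow_map_id m n : tpow_map (@id (tpow m)) (@id (tpow n)) = id.
Proof.
apply: linear_ext => [||w]; [exact: extend_linear | by [] |].
by rewrite /tpow_map extend_basis tpow_mul_basis concat_parts.
Qed.

(** Matrix entries of the infinite matrix by which [A] acts. *)
Definition act_entry N (A : 'M[F]_N) (i j : nat) : F :=
  if insub j is Some j' then if insub i is Some i' then A i' j' else 0
  else (i == j)%:R.

Lemma coef_act1 N (A : 'M[F]_N) (w v : word 1) :
  mcoeff v (act1 A (basis F w)) = act_entry A (v ord0) (w ord0).
Proof.
have eqw (a : word 1) : (a == v) = (a ord0 == v ord0).
  apply/eqP/eqP => [->//|E].
  by apply/ffunP => x; rewrite ord1.
rewrite /act1 extend_basis /act_entry; case: insubP => [j _ _|_]; last first.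
  by rewrite coef_basis eqw eq_sym.
rewrite (big_morph _ (mcoeffD v) (mcoeff0 v)).
under eq_bigr => i _ do rewrite mcoeffZ coef_basis eqw ffunE.
case: insubP => [i _ Ei|].
  rewrite (bigD1 i) //= Ei eqxx mulr1 big1 ?addr0 // => k /negPf ki.
  by rewrite -Ei (inj_eq val_inj) ki mulr0.
rewrite -leqNgt => vN; rewrite big1 // => i _.
by rewrite ltn_eqF ?mulr0 // (leq_trans _ vN).
Qed.

Lemma act_linear N (A : 'M[F]_N) n : linear (@act F N A n).
Proof. by case: n => // n; apply: extend_linear. Qed.

Lemma coef_act N (A : 'M[F]_N) n (w v : word n) :
  mcoeff v (act A (basis F w)) = \prod_i act_entry A (v i) (w i).
Proof.
elim: n w v => [|n IH] w v.
  rewrite big_ord0 coef_basis; suff -> : w == v by [].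
  by apply/eqP/ffunP => [[]].
rewrite /= /tpow_map extend_basis (@coef_tpow_mul 1 n) coef_act1 IH.
rewrite (@big_split_ord _ _ _ 1 n) big_ord1 /= !ffunE; congr (_ * _).
by apply: eq_bigr => i _; rewrite !ffunE.
Qed.

Lemma equivariantP m n (f : tpow m -> tpow n) : linear f ->
  equivariant f <-> forall N (A : 'M[F]_N) w, \det A = 1 ->
    f (act A (basis F w)) = act A (f (basis F w)).
Proof.
move=> lf; split=> [ef N A w dA|H N A dA u]; first exact: ef.
have E : (fun u => f (act A u)) = (fun u => act A (f u)).
  apply: linear_ext => [a x y|a x y|w]; last exact: H.
    by rewrite act_linear lf.
  by rewrite lf act_linear.
by have := congr1 (fun g => g u) E.
Qed.

(** ** The permutation action *)

Definition place_perm n (s : 'S_n) : tpow n -> tpow n :=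
  extend (fun w => basis F [ffun i => w (s i)]).

Lemma coef_place_perm n (s : 'S_n) u v :
  mcoeff v (place_perm s u) = mcoeff [ffun i => v (s^-1%g i)] u.
Proof.
rewrite coef_extend -sum_coef_delta; apply: eq_bigr => w _; rewrite coef_basis.
congr (_ * (_ : bool)%:R); apply/eqP/eqP => [<-|->]; apply/ffunP => i.
  by rewrite !ffunE permKV.
by rewrite !ffunE permK.
Qed.

Lemma place_perm_mor n (s : 'S_n) : @is_mor (tensor_powers F) n n (place_perm
  s).
Proof.
split; first exact: extend_linear.
apply/equivariantP => [|N A w _]; first exact: extend_linear.
apply/malgP => v; rewrite {2}/place_perm extend_basis coef_place_perm !coef_act.
rewrite [RHS](reindex_inj (@perm_inj _ s^-1%g)) /=; apply: eq_bigr => i _.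
by rewrite !ffunE permKV.
Qed.

Lemma place_perm1 n : place_perm (1%g : 'S_n) = id.
Proof.
apply: linear_ext => // [|w]; first exact: extend_linear.
by rewrite /place_perm extend_basis; congr basis; apply/ffunP => i;
  rewrite ffunE perm1.
Qed.

Lemma place_permM n (s s' : 'S_n) :
  place_perm (s * s')%g = fun u => place_perm s (place_perm s' u).
Proof.
apply: linear_ext => [|a u v|w]; try exact: extend_linear.
  by rewrite /place_perm !extend_linear.
rewrite /place_perm !extend_basis; congr basis; apply/ffunP => i.
by rewrite !ffunE permM.
Qed.

(** ** Equivariant maps out of a tensor power *)

(** The word of the basis vector [e_0 (x) ... (x) e_(m-1)]. *)
Definition inc_word m : word m := [ffun i : 'I_m => i : nat].

Section EquivariantMaps.
Variables (m n : nat) (f : tpow m -> tpow n).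
Hypotheses (lf : linear f) (ef : equivariant f).

(** The diagonal matrix with entries [2] at a letter [k >= m] and [1/2] at a
    letter [B] that does not occur fixes [e_0 (x) ... (x) e_(m-1)] and
    multiplies a word by a power of [2] that is at least [2] if [k] occurs. *)
Lemma support_inc_word (v : word n) (i0 : 'I_n) : (m <= v i0)%N ->
  mcoeff v (f (basis F (inc_word m))) = 0.
Proof.
move=> mv; set k := v i0; pose B := (\sum_i v i + m).+1.
have vB i : (v i < B)%N.
  by rewrite ltnS (bigD1 i) //= -addnA leq_addr.
pose d (i : nat) : F := if i == k then 2 else if i == B then 2^-1 else 1.
pose A : 'M[F]_B.+1 := diag_mx (\row_i d i).
have kB : (k < B)%N := vB i0.
have two0 : (2 : F) != 0 by rewrite pnatr_eq0.
have detA : \det A = 1.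
  rewrite det_diag (bigD1 ord_max) //= (bigD1 (Ordinal (ltnW kB : k < B.+1)%N))
    /=.
    rewrite !mxE /d /= eqxx gtn_eqF // eqxx mulrA mulVf // mul1r big1 // => i.
    by case/andP=> iB ik; rewrite mxE /d -!(inj_eq val_inj) /= in iB ik *;
      rewrite (negPf ik) (negPf iB).
  by rewrite -(inj_eq val_inj) /= ltn_eqF.
have entryA i j : act_entry A i j = d j * (i == j)%:R.
  rewrite /act_entry; case: insubP => [j' _ Ej|]; last first.
    rewrite -leqNgt => Bj; rewrite /d (gtn_eqF (ltn_trans kB Bj)) (gtn_eqF Bj).
    by rewrite mul1r.
  case: insubP => [i' _ Ei|].
    by rewrite !mxE -Ei -Ej (inj_eq val_inj) eq_sym; case: eqP => [->|_];
      rewrite ?mulr1 ?mulr0.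
  rewrite -leqNgt => Bi; suff /gtn_eqF-> : (j < i)%N by rewrite mulr0.
  by apply: leq_trans Bi; rewrite -Ej ltn_ord.
have actA p (w : word p) : act A (basis F w) = (\prod_i d (w i)) *: basis F w.
  apply/malgP => u; rewrite coef_act mcoeffZ coef_basis.
  under eq_bigr => i _ do rewrite entryA.
  rewrite big_split /=; congr (_ * _).
  have [<-|wu] := eqVneq w u; first by rewrite big1 // => i _; rewrite eqxx.
  have [i wui] : exists i, w i != u i.
    apply/existsP; apply: contraR wu => /existsPn wu; apply/eqP/ffunP => i.
    by have := wu i; rewrite negbK => /eqP.
  by rewrite (bigD1 i) //= eq_sym (negPf wui) mul0r.
have fixA : act A (basis F (inc_word m)) = basis F (inc_word m).
  rewrite actA big1 ?scale1r // => i _; rewrite ffunE /d.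
  rewrite ltn_eqF ?(leq_trans (ltn_ord i)) // ltn_eqF //.
  by rewrite (leq_trans (ltn_ord i)) // ltnW // ltnS leq_addl.
have := congr1 (mcoeff v) (ef detA (basis F (inc_word m))).
rewrite fixA; set x := f _ => E; set P := \prod_i d (v i).
have cP : mcoeff v (act A x) = mcoeff v x * P.
  rewrite (linear_expand (@act_linear _ A n)) coef_extend -(sum_coef_delta x)
    mulr_suml.
  apply: eq_bigr => w _; rewrite actA mcoeffZ coef_basis.
  by case: eqP => [->|_]; rewrite ?mulr0 ?mul0r ?mulr1.
have P1 : P != 1.
  have ge1 : 1 <= \prod_(i < n | i != i0) d (v i).
    apply: (big_ind (fun y => 1 <= y)) => // [y z y1 z1|i _].
      by rewrite -[1]mulr1 ler_pM.
    by rewrite /d (ltn_eqF (vB i)); case: ifP => // _; rewrite ler1n.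
  rewrite /P (bigD1 i0) //= /d eqxx gt_eqF //.
  by apply: lt_le_trans (_ : 2 <= _); rewrite ?ltr1n // -{1}[2]mulr1 ler_pM2l.
apply/eqP; move/eqP: E; rewrite cP -{1}[mcoeff v x]mulr1 -subr_eq0 -mulrBr.
by rewrite mulf_eq0 subr_eq0 (eq_sym 1) (negPf P1) orbF.
Qed.

Definition change_letter p (w : word p) (i0 : 'I_p) a : word p :=
  [ffun i => if i == i0 then a else w i].

(** The transvection [e_b |-> e_b + e_a] replaces an isolated occurrence of the
    letter [b] by [a], up to a term that [f] already kills. *)
Lemma kill_change_letter (w : word m) i0 a :
  f (basis F w) = 0 -> a != w i0 -> (forall i, i != i0 -> w i != w i0) ->
  f (basis F (change_letter w i0 a)) = 0.
Proof.
move=> fw ab uniq; set b := w i0 in ab uniq; pose N := (a + b).+1.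
have aN : (a < N)%N by rewrite ltnS leq_addr.
have bN : (b < N)%N by rewrite ltnS leq_addl.
pose a' := Ordinal aN; pose b' := Ordinal bN.
have ab' : a' != b' by rewrite -(inj_eq val_inj).
pose A : 'M[F]_N := 1%:M + delta_mx a' b'.
have detA : \det A = 1.
  pose D : 'M[F]_N := \matrix_(i, j) ((if i == a' then b' else i) == j)%:R.
  have offrow i : (lift a' i == a') = false by rewrite eq_sym (negPf (neq_lift
    _ _)).
  rewrite (@determinant_multilinear _ _ A 1%:M D a' 1 1).
  - rewrite det1 (@determinant_alternate _ _ D a' b') ?mulr1 ?mulr0 ?addr0 //.
    by move=> j; rewrite !mxE eqxx (eq_sym b' a') (negPf ab').
  - by apply/rowP => j; rewrite !mxE eqxx !mul1r (eq_sym b').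
  - by apply/matrixP => i j; rewrite !mxE offrow addr0.
  - by apply/matrixP => i j; rewrite !mxE offrow addr0.
have entryA i j : act_entry A i j = (i == j)%:R + ((i == a) && (j == b))%:R.
  rewrite /act_entry; case: insubP => [j' _ Ej|]; last first.
    by rewrite -leqNgt => Nj; rewrite (gtn_eqF (leq_trans bN Nj)) andbF addr0.
  case: insubP => [i' _ Ei|].
    by rewrite !mxE -Ei -Ej -!(inj_eq val_inj).
  rewrite -leqNgt => Ni; rewrite (gtn_eqF (leq_trans aN Ni)) addr0.
  suff /gtn_eqF-> : (j < i)%N by [].
  by apply: leq_trans Ni; rewrite -Ej ltn_ord.
have actA : act A (basis F w) = basis F w + basis F (change_letter w i0 a).
  apply/malgP => v; rewrite coef_act mcoeffD !coef_basis.
  under eq_bigr => i _ do rewrite entryA.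
  rewrite (bigD1 i0) //= eqxx andbT.
  under eq_bigr => i /uniq/negPf wi do rewrite wi andbF addr0.
  have [/forall_inP agree|/forall_inPn[i ii0 vwi]] :=
      boolP [forall i in predC1 i0, v i == w i].
    rewrite big1 ?mulr1 => [|i ii0]; last by rewrite agree.
    congr (_%:R + _%:R); congr (nat_of_bool _); apply/eqP/eqP => [vw|<-//].
    - apply/ffunP => i; have [->//|ii0] := eqVneq i i0.
      exact/esym/eqP/agree.
    - apply/ffunP => i; rewrite ffunE; have [->//|ii0] := eqVneq i i0.
      exact/esym/eqP/agree.
    - by rewrite ffunE eqxx.
  rewrite (bigD1 i) //= (negPf vwi) mul0r mulr0.
  have -> : (w == v) = false.
    by apply: contraNF vwi => /eqP->.
  have -> : (change_letter w i0 a == v) = false.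
    by apply: contraNF vwi => /eqP<-; rewrite ffunE (negPf ii0).
  by rewrite addr0.
have := ef detA (basis F w).
by rewrite actA (linearD_of lf) fw (linear0_of (@act_linear _ A n)) add0r.
Qed.

(** The letters of [u] are changed one position at a time; each of them is
    isolated when its turn comes. *)
Lemma kill_disjoint_word (u u' : word m) : injective u ->
  (forall i j, u i != u' j) -> f (basis F u) = 0 -> f (basis F u') = 0.
Proof.
move=> uinj uu' fu.
pose h k : word m := [ffun i : 'I_m => if (i < k)%N then u' i else u i].
suff H k : (k <= m)%N -> f (basis F (h k)) = 0.
  rewrite -(H m (leqnn m)); congr (f (basis F _)).
  by apply/ffunP => i; rewrite ffunE ltn_ord.
elim: k => [_|k IH km].
  by rewrite -fu; congr (f (basis F _)); apply/ffunP => i; rewrite ffunE.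
pose i0 := Ordinal km; have hi0 : h k i0 = u i0 by rewrite ffunE ltnn.
have -> : h k.+1 = change_letter (h k) i0 (u' i0).
  apply/ffunP => i; rewrite !ffunE ltnS leq_eqVlt -(inj_eq val_inj) /=.
  by case: eqP => //= E; congr (u' _); apply: val_inj.
apply: kill_change_letter; rewrite ?hi0 1?eq_sym //; first exact/IH/ltnW.
move=> i ii0; rewrite ffunE; case: ifP => _; first by rewrite eq_sym.
by rewrite (inj_eq uinj).
Qed.

(** Every word is reached from [inc_word m] by changing isolated letters, if the
    letters are first made larger than all those of the target word. *)
Lemma inc_word_determines : f (basis F (inc_word m)) = 0 -> forall u, f u = 0.
Proof.
move=> f0.
suff H w : f (basis F w) = 0.
  by move=> u; rewrite (linear_expand lf) /extend big1 // => w _;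
    rewrite H scaler0.
pose K := (\sum_i w i + m).+1.
have wK i : (w i < K)%N by rewrite ltnS (bigD1 i) //= -addnA leq_addr.
pose far : word m := [ffun i : 'I_m => (K + i)%N].
apply: (@kill_disjoint_word far).
- by move=> i j; rewrite !ffunE => /addnI; apply: val_inj.
- by move=> i j; rewrite ffunE gtn_eqF // (leq_trans (wK j)) // leq_addr.
apply: (@kill_disjoint_word (inc_word m)) => // [i j|i j].
  by rewrite !ffunE; apply: val_inj.
rewrite !ffunE ltn_eqF // (leq_trans (ltn_ord i)) // (leq_trans _ (leq_addr _
  _)) //.
by rewrite ltnW // ltnS leq_addl.
Qed.

End EquivariantMaps.

(** The coordinates are the coefficients of the words with letters below [m] in
    the image of [inc_word m]. *)
Lemma tensor_powers_coordinates m n : exists (T : finType)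
    (phi : (tpow m -> tpow n) -> T -> F),
  [/\ forall f g t, phi (fun u => f u + g u) t = phi f t + phi g t,
      forall a f t, phi (fun u => a *: f u) t = a * phi f t
    & forall f g, @is_mor (tensor_powers F) m n f ->
        @is_mor (tensor_powers F) m n g -> phi f =1 phi g -> f = g].
Proof.
pose wd (t : {ffun 'I_n -> 'I_m}) : word n := [ffun i => t i : nat].
exists {ffun 'I_n -> 'I_m}, (fun f t =>
  mcoeff (wd t) (f (basis F (inc_word m)))).
split=> [f g t|a f t|f g [lf ef] [lg eg] fg].
- exact: mcoeffD.
- exact: mcoeffZ.
pose h u := f u - g u.
have lh : linear h by move=> a u v; rewrite /h lf lg scalerBr opprD addrACA.
have eh : equivariant h.
  move=> N A dA u; rewrite /h (ef _ _ dA) (eg _ _ dA).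
  by rewrite (linearD_of (@act_linear _ A n)) -!scaleN1r (linearZ_of
    (@act_linear _ A n)).
suff H u : h u = 0 by apply: boolp.funext => u; apply/eqP;
  rewrite -subr_eq0 -/(h u) H.
apply: inc_word_determines => //; apply/malgP => v; rewrite mcoeff0.
have [/forallP vm|nvm] := boolP [forall i, (v i < m)%N]; last first.
  have [j] := forallPn nvm.
  by rewrite -leqNgt; apply: support_inc_word.
have -> : v = wd [ffun i => Ordinal (vm i)] by apply/ffunP => i; rewrite !ffunE.
by rewrite mcoeffB fg subrr.
Qed.

Definition tensor_powers_linear : linear_category F (tensor_powers F).
Proof.
apply: (@LinearCategory F (tensor_powers F) (fun m n f u => - f u)
  (fun m n a f u => a *: f u)).
- by [].
- by move=> m n f g h; apply: boolp.funext => u; apply: addrA.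
- by move=> m n f g; apply: boolp.funext => u; apply: addrC.
- by move=> m n f; apply: boolp.funext => u; apply: add0r.
- by move=> m n f; apply: boolp.funext => u; apply: addNr.
- by move=> m n a b f; apply: boolp.funext => u; apply: scalerA.
- by move=> m n f; apply: boolp.funext => u; apply: scale1r.
- by move=> m n a f g; apply: boolp.funext => u; apply: scalerDr.
- by move=> m n f a b; apply: boolp.funext => u; apply: scalerDl.
- move=> m n; split=> [a u v|N A dA u] /=; first by rewrite scaler0 addr0.
  by rewrite (linear0_of (@act_linear _ A n)).
- move=> m n f g [lf ef] [lg eg]; split=> [a u v|N A dA u] /=.
    by rewrite lf lg scalerDr addrACA.
  by rewrite (ef _ _ dA) (eg _ _ dA) (linearD_of (@act_linear _ A n)).
- move=> m n a f [lf ef]; split=> [b u v|N A dA u] /=.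
    by rewrite lf scalerDr !scalerA mulrC.
  by rewrite (ef _ _ dA) (linearZ_of (@act_linear _ A n)).
- by [].
- move=> m l n g f [lg eg] [lf ef]; split=> [a u v|N A dA u] /=.
    by rewrite lf lg.
  by rewrite (ef _ _ dA) (eg _ _ dA).
- by [].
- by [].
- by [].
- by [].
- move=> m l n h f g [lh _] _ _; apply: boolp.funext => u /=.
  exact: linearD_of.
- by [].
- move=> m l n a g f [lg _] _; apply: boolp.funext => u /=.
  exact: linearZ_of.
- exact: tensor_powers_coordinates.
Defined.

Lemma place_perm_free n (a : 'S_n -> F) :
  \sum_s a s *: (place_perm s : Hom tensor_powers_linear n n) = 0 -> forall s,
    a s = 0.
Proof.
move=> S0 s; have := congr1 (fun f => mcoeff [ffun i =>
  s i : nat] (f (basis F (inc_word n)))) S0.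
have ev (f g : Hom tensor_powers_linear n n) :
  (f + g) (basis F (inc_word n)) = f (basis F (inc_word n)) + g (basis F
    (inc_word n)) by [].
rewrite (big_morph (fun f : Hom tensor_powers_linear n n =>
  f (basis F (inc_word n))) ev erefl).
rewrite (big_morph _ (mcoeffD _) (mcoeff0 _)) mcoeff0 => <-.
have val_s s' : mcoeff [ffun i =>
  s i : nat] (place_perm s' (basis F (inc_word n))) = (s' == s)%:R.
  rewrite /place_perm extend_basis coef_basis; congr (nat_of_bool _)%:R.
  apply/eqP/eqP => [/ffunP E|->]; last by apply/ffunP => i; rewrite !ffunE.
  by apply/permP => i; have := E i; rewrite !ffunE => /val_inj.
transitivity (\sum_s' a s' * (s' == s)%:R).
  by rewrite (bigD1 s) //= eqxx mulr1 big1 ?addr0 // => s' /negPf->;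
    rewrite mulr0.
apply: eq_bigr => s' _; rewrite -val_s; exact/esym/mcoeffZ.
Qed.

Theorem Rep_SL_infinity_growth (R : realType) :
  superexponential_growth (Rep_SL_infinity F) R.
Proof.
apply: (@growth_from_symmetric_groups R F (tensor_powers F)
  tensor_powers_linear id place_perm) => //.
- exact: addn1.
- by move=> n; apply: tpow_map_id.
- exact: place_perm_mor.
- exact: place_perm1.
- exact: place_permM.
- exact: place_perm_free.
Qed.

End TensorPowers.

(** * The partition category *)

(** ** Colourings constant on the blocks of a set partition *)

Section Colourings.
Variable S : finType.
Implicit Types P Q : {set {set S}}.

Definition constant_on (T : eqType) P (c : S -> T) : bool :=
  [forall B in P, forall x in B, forall y in B, c x == c y].

Lemma constant_onP (T : eqType) P (c : S -> T) :
  reflect (forall B x y, B \in P -> x \in B -> y \in B -> c x = c y)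
          (constant_on P c).
Proof.
apply: (iffP forall_inP) => [H B x y BP xB yB|H B BP].
  by have /forall_inP/(_ x xB)/forall_inP/(_ y yB)/eqP := H B BP.
by apply/forall_inP => x xB; apply/forall_inP => y yB; apply/eqP/(H B).
Qed.

Lemma eq_constant_on (T : eqType) P (c c' : S -> T) :
  c =1 c' -> constant_on P c = constant_on P c'.
Proof.
by move=> cc'; apply/constant_onP/constant_onP => H B x y BP xB yB;
  have := H B x y BP xB yB; rewrite !cc'.
Qed.

(** Colouring each point by its own block recovers the partition. *)
Lemma constant_on_inj P Q : partition P [set: S] -> partition Q [set: S] ->
  (forall c : S -> {set S}, constant_on P c = constant_on Q c) -> P = Q.
Proof.
have half P1 P2 : partition P1 [set: S] -> partition P2 [set: S] ->
    (forall c : S -> {set S}, constant_on P1 c = constant_on P2 c) ->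
    forall x, pblock P2 x \subset pblock P1 x.
  move=> /and3P[/eqP cov1 triv1 _] /and3P[/eqP cov2 triv2 _] E x.
  have /constant_onP H : constant_on P2 (pblock P1).
    rewrite -E; apply/constant_onP => B y z BP yB zB.
    by rewrite !(def_pblock triv1 BP).
  apply/subsetP => y yx; have x2 : x \in cover P2 by rewrite cov2 inE.
  rewrite (H _ x y (pblock_mem x2)) ?mem_pblock //.
  by rewrite cov1 inE.
move=> pP pQ E; have E' c := esym (E c).
have sub P1 P2 : partition P1 [set: S] -> partition P2 [set: S] ->
    (forall x, pblock P1 x = pblock P2 x) -> P1 \subset P2.
  move=> /and3P[_ triv1 n01] /and3P[/eqP cov2 triv2 _] B12;
    apply/subsetP => B BP.
  have [B0|[x xB]] := set_0Vmem B; first by move: n01; rewrite -B0 BP.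
  by rewrite -(def_pblock triv1 BP xB) B12 pblock_mem // cov2 inE.
have PQ x : pblock P x = pblock Q x by apply/eqP; rewrite eqEsubset !half.
by apply/eqP; rewrite eqEsubset !sub.
Qed.

End Colourings.

Section Semantics.
Variable T : finType.
Local Notation col n := {ffun 'I_n -> T}.

Definition glue m n (x : col m) (z : col n) (v : 'I_m + 'I_n) : T :=
  match v with inl i => x i | inr k => z k end.

(** The entries of the matrix by which a diagram acts on functions of colours:
    stacking becomes the matrix product, with loop parameter [#|T|]. *)
Definition sem m n (p : diagram m n) (x : col m) (z : col n) : bool :=
  constant_on (val p) (glue x z).

End Semantics.

Lemma sem_inj m n (p p' : diagram m n) :
  (forall (T : finType) (t0 : T) (x : {ffun 'I_m -> T}) (z : {ffun 'I_n -> T}),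
     sem p x z = sem p' x z) -> p = p'.
Proof.
move=> E; apply: val_inj; apply: (constant_on_inj (valP p) (valP p')) => c.
have := E _ set0 [ffun i => c (inl i)] [ffun k => c (inr k)]; rewrite /sem.
have gc : glue [ffun i => c (inl i)] [ffun k => c (inr k)] =1 c.
  by move=> [i|i] /=; rewrite ffunE.
by rewrite !(eq_constant_on _ gc).
Qed.

Lemma sem_const (T : finType) (t0 : T) m n (p : diagram m n) :
  sem p [ffun=> t0] [ffun=> t0].
Proof. by apply/constant_onP => B [i|i] [j|j] _ _ _ /=; rewrite !ffunE. Qed.

(** ** Stacking counts colourings *)

Section Stacking.
Variables (m l n : nat) (q : diagram l n) (p : diagram m l).
Local Notation S := ('I_m + 'I_l + 'I_n)%type.
Local Notation con := (connect (stack_rel q p)).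

Lemma stack_rel_sym : symmetric (stack_rel q p).
Proof.
move=> x y; rewrite /stack_rel; congr (_ || _); apply/exists_inP/exists_inP;
  by move=> [B BP /andP[xB yB]]; exists B => //; rewrite yB.
Qed.

Lemma con_equiv : equivalence_rel con.
Proof.
by apply/equivalence_relP; split=> [x|x y /(same_connect (sym_connect_sym
  stack_rel_sym))];
  [exact: connect0 | move=> E z; rewrite E].
Qed.

Lemma con_sym : symmetric con.
Proof. exact: (sym_connect_sym stack_rel_sym). Qed.

Lemma componentsE K : reflect (exists x,
  K = [set y | con x y]) (K \in components q p).
Proof.
apply: (iffP imsetP) => [[x _ ->]|[x ->]]; exists x => //;
  by apply/setP => y; rewrite !inE.
Qed.

Lemma stackE : stack q p =
  equivalence_partition (fun u v =>
    con (outer l u) (outer l v)) [set: 'I_m + 'I_n].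
Proof.
apply/setP => B; rewrite !inE; apply/andP/imsetP.
  case=> B0 /imsetP[K /componentsE[x ->] EB].
  have [u uB] := set0Pn _ B0; have xu : con x (outer l u) by rewrite EB !inE in
    uB.
  exists u => //; apply/setP => v; rewrite EB !inE /=.
  by rewrite (same_connect (sym_connect_sym stack_rel_sym) xu).
case=> u _ ->; split.
  by apply/set0Pn; exists u; rewrite !inE connect0.
apply/imsetP; exists [set y | con (outer l u) y]; first by apply/componentsE;
  exists (outer l u).
by apply/setP => v; rewrite !inE.
Qed.

Fact stack_partition : partition (stack q p) [set: 'I_m + 'I_n].
Proof.
rewrite stackE; apply: equivalence_partitionP => u v w _ _ _.
by have := con_equiv (outer l u) (outer l v) (outer l w).
Qed.

Definition stackd : diagram m n := exist _ (stack q p) stack_partition.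

Variables (T : finType) (t0 : T).
Variables (x : {ffun 'I_m -> T}) (z : {ffun 'I_n -> T}).

Definition glue3 (y : {ffun 'I_l -> T}) (v : S) : T :=
  match v with inl (inl i) => x i | inl (inr j) => y j | inr k => z k end.

Lemma sem_conP (y : {ffun 'I_l -> T}) :
  reflect (forall u v, con u v -> glue3 y u = glue3 y v) (sem p x y && sem q y
    z).
Proof.
have lowE u : glue3 y (lower n u) = glue x y u by case: u.
have upE u : glue3 y (upper m u) = glue y z u by case: u.
apply: (iffP andP) => [[/constant_onP Hp /constant_onP Hq] u v /connectP[s]|H].
  elim: s u => [|w s IH] u /=; first by move=> _ ->.
  case/andP => uw ws vs; rewrite -(IH w ws vs) => {ws vs IH}.
  case/orP: uw => /exists_inP[B BP /andP[/imsetP[a aB ->] /imsetP[b bB ->]]].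
    by rewrite !lowE; apply: Hp BP aB bB.
  by rewrite !upE; apply: Hq BP aB bB.
split; apply/constant_onP => B a b BP aB bB.
  rewrite -!lowE; apply/H/connect1/orP; left; apply/exists_inP; exists B => //.
  by rewrite !imset_f.
rewrite -!upE; apply/H/connect1/orP; right; apply/exists_inP; exists B => //.
by rewrite !imset_f.
Qed.

Lemma sem_stackP :
  reflect (forall u v, con (outer l u) (outer l v) -> glue x z u = glue x z v)
          (sem stackd x z).
Proof.
apply: (iffP (constant_onP _ _)); rewrite /= stackE => H.
  move=> u v uv; apply: (H [set w | con (outer l u) (outer l w)]);
    rewrite ?inE ?connect0 //.
  by apply/imsetP; exists u => //; apply/setP => w; rewrite !inE.
move=> B u v /imsetP[w _ ->]; rewrite !inE /= => wu wv; apply: H.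
by rewrite -(same_connect (sym_connect_sym stack_rel_sym) wu).
Qed.

Local Notation removed_set := [set K in components q p | @outer m l n @^-1: K
  == set0].

(** Once the outer points are coloured consistently, the middle points joined
    to them have a forced colour, while each removed component can be coloured
    freely. *)
Lemma card_sem_stack :
  (\sum_y sem p x y * sem q y z = sem stackd x z * #|T| ^ removed q p)%N.
Proof.
pose mid (j : 'I_l) : S := inl (inr j).
pose comp_of (v : S) : {set S} := [set w | con v w].
pose R : finType := {K : {set S} | K \in removed_set}.
have outE y u : glue3 y (outer l u) = glue x z u by case: u.
have sumE : (\sum_y sem p x y * sem q y z = #|[set y | sem p x y && sem q y
  z]|)%N.
  rewrite -sum1_card [RHS]big_mkcond /=; apply: eq_bigr => y _.
  by rewrite inE; case: (sem p x y); case: (sem q y z).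
rewrite sumE; have [/sem_stackP cons|ncons] := boolP (sem stackd x z);
  last first.
  rewrite mul0n; apply/eqP; rewrite cards_eq0;
    apply: contraR ncons => /set0Pn[y].
  rewrite inE => /sem_conP H; apply/sem_stackP => u v uv.
  by rewrite -!(outE y); apply: H.
rewrite mul1n.
pose g (h : {ffun R -> T}) : {ffun 'I_l -> T} := [ffun j =>
  if insub (comp_of (mid j)) is Some K then h K
  else if [pick u | con (mid j) (outer l u)] is Some u then glue x z u else t0].
have removedP j : (comp_of (mid j) \in removed_set) =
    [forall u, ~~ con (mid j) (outer l u)].
  rewrite inE; have -> /= : comp_of (mid j) \in components q p.
    by apply/componentsE; exists (mid j).
  apply/eqP/forallP => [E u|H]; first by move/setP/(_ u): E; rewrite !inE => ->.
  by apply/setP => u; rewrite !inE; apply/negbTE/H.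
have comp_eq u v : con u v -> comp_of u = comp_of v.
  move=> uv; apply/setP => w; rewrite !inE.
  exact: (same_connect (sym_connect_sym stack_rel_sym) uv).
have gout h j u : con (mid j) (outer l u) -> g h j = glue x z u.
  move=> ju; rewrite ffunE insubN; last first.
    by rewrite removedP; apply/forallPn; exists u; rewrite negbK.
  case: pickP => [v jv|/(_ u)]; last by rewrite ju.
  apply: cons; rewrite con_sym in jv.
  exact: connect_trans jv ju.
have gsem h : g h \in [set y | sem p x y && sem q y z].
  rewrite inE; apply/sem_conP.
  have case_outer (v : S) : (exists u, v = outer l u) \/ (exists j, v = mid j).
    by case: v => [[i|j]|k]; [left; exists (inl i) | right; exists j | left;
      exists (inr k)].
  move=> u v uv; case: (case_outer u) (case_outer v) =>
    [[a ->]|[i ->]] [[b ->]|[j ->]] in uv *.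
  - by rewrite !outE; apply: cons.
  - by rewrite outE; symmetry; apply: gout; rewrite con_sym.
  - by rewrite outE; apply: gout.
  have [/existsP[a ia]|nout] := boolP [exists a, con (mid i) (outer l a)].
    rewrite /= (gout h i a) // (gout h j a) //.
    by rewrite con_sym in uv; apply: connect_trans uv ia.
  have ir : comp_of (mid i) \in removed_set by rewrite removedP -negb_exists.
  by rewrite /= !ffunE -(comp_eq _ _ uv) insubT.
have midK (K : R) : {j | sval K = comp_of (mid j)}.
  case: K => K /=; rewrite inE => /andP[/componentsE KP K0].
  suff /sigW : exists j, K == comp_of (mid j) by case=> j /eqP E; exists j.
  case: KP K0 => [[[i|j]|k]] -> K0; [| by exists j|].
    by move/eqP/setP/(_ (inl i)): K0; rewrite !inE connect0.
  by move/eqP/setP/(_ (inr k)): K0; rewrite !inE connect0.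
have ginj : injective g.
  move=> h h' /ffunP gg; apply/ffunP => K; have [j Kj] := midK K.
  have := gg j; rewrite !ffunE -Kj; case: insubP => [K' _ E|];
    last by rewrite (valP K).
  by have -> : K' = K by apply: val_inj.
rewrite -[removed q p](card_sig (mem removed_set)) -card_ffun -(card_imset _
  ginj).
apply: eq_card => y; apply/idP/imsetP => [|[h _ ->]]; last exact: gsem.
rewrite inE => /sem_conP H; exists [ffun K : R => y (sval (midK K))] => //.
apply/ffunP => j; rewrite ffunE; case: insubP => [K Kr E|].
  rewrite ffunE; case: (midK K) => i /= Ei; have := H (mid j) (mid i); apply.
  have : mid i \in comp_of (mid i) by rewrite inE connect0.
  by rewrite -Ei E inE.
rewrite removedP negb_forall => /existsP[a]; rewrite negbK => ja.
case: pickP => [b jb|/(_ a)]; last by rewrite ja.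
by rewrite -(outE y); apply: (H (mid j)).
Qed.

End Stacking.

(** Constant colourings detect the exponent, colourings by blocks the diagram. *)
Lemma sem_determines m n (a b : diagram m n) (i j : nat) :
  (forall (T : finType) (t0 : T) (x : {ffun 'I_m -> T}) (z : {ffun 'I_n -> T}),
     (sem a x z * #|T| ^ i = sem b x z * #|T| ^ j)%N) ->
  a = b /\ i = j.
Proof.
move=> E; have ij : i = j.
  have := E _ true [ffun=> true] [ffun=> true].
  by rewrite !sem_const !mul1n card_bool => /eqP; rewrite eqn_exp2l // => /eqP.
split=> //; apply: sem_inj => T t0 x z; have := E T t0 x z; rewrite ij.
have T0 : (0 < #|T| ^ j)%N.
  by rewrite expn_gt0; apply/orP; left; apply/card_gt0P; exists t0.
by move/eqP; rewrite eqn_pmul2r //; do 2 case: sem.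
Qed.

Lemma sem_stack_determines m l n (q : diagram l n) (p : diagram m l)
    (r : diagram m n) (i : nat) :
  (forall (T : finType) (t0 : T) (x : {ffun 'I_m -> T}) (z : {ffun 'I_n -> T}),
     (\sum_(y : {ffun 'I_l -> T}) sem p x y * sem q y z =
      sem r x z * #|T| ^ i)%N) ->
  stackd q p = r /\ removed q p = i.
Proof.
by move=> H; apply: sem_determines => T t0 x z;
  rewrite -(card_sem_stack q p t0) (H T t0).
Qed.

(** Both sides count the colourings of the two middle rows. *)
Lemma stack_assoc m l1 l2 n (r : diagram l2 n) (q : diagram l1 l2)
    (p : diagram m l1) :
  stackd r (stackd q p) = stackd (stackd r q) p /\
  (removed q p + removed r (stackd q p) =
   removed r q + removed (stackd r q) p)%N.
Proof.
apply: sem_determines => T t0 x z.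
rewrite addnC expnD mulnA -(card_sem_stack _ _ t0) addnC expnD mulnA.
rewrite -[in RHS](card_sem_stack _ _ t0) !big_distrl /=.
under eq_bigr => y _ do rewrite -mulnA (mulnC (sem r _ _ : nat)) mulnA
  -(card_sem_stack _ _ t0) big_distrl /=.
under [RHS]eq_bigr => y _ do rewrite -mulnA -(card_sem_stack _ _ t0)
  big_distrr /=.
rewrite exchange_big; apply: eq_bigr => y _; apply: eq_bigr => y' _.
by rewrite mulnA.
Qed.

(** ** Permutation diagrams *)

Section PermutationDiagrams.
Variable n : nat.
Implicit Types s : 'S_n.

Definition perm_blocks s : {set {set 'I_n + 'I_n}} :=
  [set [set inl i; inr (s i)] | i in 'I_n].

Fact perm_partition s : partition (perm_blocks s) [set: 'I_n + 'I_n].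
Proof.
pose f (u : 'I_n + 'I_n) := match u with inl i => s i | inr k => k end.
suff -> : perm_blocks s = preim_partition f [set: 'I_n + 'I_n] by apply:
  preim_partitionP.
have blockE i : [set inl i; inr (s i)] = [set v in [set: 'I_n + 'I_n] | f v ==
  s i].
  apply/setP => [[j|j]]; rewrite !inE /=; last by [].
  by rewrite (inj_eq perm_inj) orbF.
apply/setP => B; apply/imsetP/imsetP => [[i _ ->]|[u _ ->]].
  exists (inl i) => //; rewrite blockE; apply/setP => v; rewrite !inE.
  by rewrite eq_sym.
exists (s^-1%g (f u)) => //; rewrite blockE permKV; apply/setP => v;
  rewrite !inE.
by rewrite eq_sym.
Qed.

Definition perm_diagram s : diagram n n := exist _ (perm_blocks s)
  (perm_partition s).

Lemma sem_perm (T : finType) s (x z : {ffun 'I_n -> T}) :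
  sem (perm_diagram s) x z = (x == [ffun i => z (s i)]).
Proof.
apply/constant_onP/eqP => [H|-> B u v /imsetP[i _ ->]].
  apply/ffunP => i; rewrite ffunE.
  by apply: (H [set inl i; inr (s i)] (inl i) (inr (s i)));
    rewrite ?inE ?eqxx ?orbT //; apply: imset_f.
by rewrite !inE => /orP[/eqP->|/eqP->] /orP[/eqP->|/eqP->]; rewrite /= ?ffunE.
Qed.

Lemma stack_perm s s' :
  stackd (perm_diagram s) (perm_diagram s') = perm_diagram (s' * s)%g /\
  removed (perm_diagram s) (perm_diagram s') = 0%N.
Proof.
apply: sem_stack_determines => T t0 x z.
rewrite (bigD1 [ffun i => z (s i)]) //= big1 => [|y /negPf yz].
  rewrite !sem_perm eqxx muln1 addn0 expn0 muln1; congr (nat_of_bool (_ == _)).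
  by apply/ffunP => i; rewrite !ffunE permM.
by rewrite !sem_perm yz muln0.
Qed.

Lemma perm_diagram_inj : injective perm_diagram.
Proof.
move=> s s' ss'; apply/permP => i.
have : [set inl i; inr (s i)] \in val (perm_diagram s) by apply: imset_f.
rewrite ss' => /imsetP[j _ E].
have : inl i \in [set inl j; inr (s' j)] by rewrite -E !inE eqxx.
rewrite !inE orbF => /eqP[ij]; subst j.
have : inr (s i) \in [set inl i; inr (s' i)] by rewrite -E !inE eqxx.
by rewrite !inE orFb => /eqP[].
Qed.

Lemma val_perm_diagram1 : val (perm_diagram 1%g) = identity_diagram n.
Proof. by apply: eq_imset => i; rewrite perm1. Qed.

End PermutationDiagrams.

Lemma stack_id_l m n (p : diagram m n) :
  stackd (perm_diagram 1%g) p = p /\ removed (perm_diagram 1%g) p = 0%N.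
Proof.
apply: sem_stack_determines => T t0 x z.
rewrite (bigD1 z) //= big1 => [|y /negPf yz]; rewrite sem_perm.
  have -> : z == [ffun i => z ((1 : 'S_n)%g i)] by apply/eqP/ffunP => i;
    rewrite ffunE perm1.
  by rewrite addn0.
by have -> : [ffun i => z ((1 : 'S_n)%g i)] = z by [apply/ffunP => i;
  rewrite ffunE perm1]; rewrite yz muln0.
Qed.

Lemma stack_id_r m n (p : diagram m n) :
  stackd p (perm_diagram 1%g) = p /\ removed p (perm_diagram 1%g) = 0%N.
Proof.
apply: sem_stack_determines => T t0 x z.
have E (y : {ffun 'I_m -> T}) : [ffun i =>
  y ((1 : 'S_m)%g i)] = y by apply/ffunP => i; rewrite ffunE perm1.
rewrite (bigD1 x) //= big1 => [|y /negPf yx]; rewrite sem_perm E.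
  by rewrite eqxx mul1n addn0 muln1.
by rewrite eq_sym yx.
Qed.

(** ** The linear category *)

Lemma eq_stackd m l n (q : diagram l n) (p : diagram m l) r :
  (stack q p == val r) = (stackd q p == r).
Proof. by rewrite -(inj_eq val_inj (stackd q p) r). Qed.

(* From here on, stacks are only known through the laws proved above. *)
Local Opaque stackd removed perm_diagram stack.

Section PartitionCategory.
Variables (F : fieldType) (t : F).
Local Notation hom m n := {ffun diagram m n -> F}.

Definition delta_diagram m n (p : diagram m n) : hom m n := [ffun r =>
  (r == p)%:R].

Lemma diagram_compE m l n (g : hom l n) (f : hom m l) r :
  diagram_comp t g f r =
    \sum_q \sum_p (stackd q p == r)%:R * (g q * f p * t ^+ removed q p).
Proof.
rewrite ffunE; apply: eq_bigr => q _; rewrite big_mkcond; apply: eq_bigr => p _.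
by rewrite eq_stackd; case: (stackd q p == r); rewrite ?mul1r ?mul0r.
Qed.

Lemma diagram_comp_delta m l n (q : diagram l n) (p : diagram m l) :
  diagram_comp t (delta_diagram q) (delta_diagram p) =
  [ffun r => (stackd q p == r)%:R * t ^+ removed q p].
Proof.
apply/ffunP => r; rewrite diagram_compE ffunE (bigD1 q) //= (bigD1 p) //=.
rewrite !ffunE !eqxx !mul1r !big1 ?addr0 // => [q' /negPf qq'|p' /negPf pp'].
  by rewrite big1 // => p' _; rewrite !ffunE qq' !mul0r mulr0.
by rewrite !ffunE pp' mulr0 mul0r mulr0.
Qed.

Lemma partition_mor1E n : @mor1 (partition_category t) n = delta_diagram
  (perm_diagram 1%g).
Proof.
apply/ffunP => r; rewrite [LHS]ffunE [RHS]ffunE -val_perm_diagram1.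
by rewrite (inj_eq val_inj r).
Qed.

Lemma sum_stack (I : finType) (c : I) (X : I -> F) :
  \sum_u (c == u)%:R * X u = X c.
Proof.
rewrite (bigD1 c) //= eqxx mul1r big1 ?addr0 // => u /negPf cu.
by rewrite eq_sym cu mul0r.
Qed.

Lemma shuffle_l (b c x y z v w : F) :
  b * (x * (c * (y * z * v)) * w) = c * (b * (x * y * z * (v * w))).
Proof. ring. Qed.

Lemma shuffle_r (b c x y z v w : F) :
  b * (c * (x * y * v) * z * w) = c * (b * (x * y * z * (v * w))).
Proof. ring. Qed.

Lemma diagram_compA m l1 l2 n (h : hom l2 n) (g : hom l1 l2) (f : hom m l1) :
  diagram_comp t h (diagram_comp t g f) = diagram_comp t (diagram_comp t h g) f.
Proof.
apply/ffunP => s; rewrite !diagram_compE.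
pose X r q p := (stackd r (stackd q p) == s)%:R *
  (h r * g q * f p * t ^+ (removed q p + removed r (stackd q p))).
transitivity (\sum_r \sum_q \sum_p X r q p).
  apply: eq_bigr => r _.
  under eq_bigr => u _.
    rewrite diagram_compE mulr_sumr mulr_suml mulr_sumr.
    under eq_bigr => q _ do rewrite mulr_sumr mulr_suml mulr_sumr.
    over.
  rewrite exchange_big; apply: eq_bigr => q _.
  rewrite exchange_big; apply: eq_bigr => p _.
  pose Y u := (stackd r u == s)%:R *
    (h r * g q * f p * t ^+ (removed q p + removed r u)).
  apply: etrans (sum_stack (stackd q p) Y).
  by apply: eq_bigr => u _; rewrite /Y exprD; apply: shuffle_l.
transitivity (\sum_p \sum_r \sum_q X r q p).
  under eq_bigr => r _ do rewrite exchange_big.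
  by rewrite exchange_big.
under [RHS]eq_bigr => u _.
  under eq_bigr => p _.
    rewrite diagram_compE mulr_suml mulr_suml mulr_sumr.
    under eq_bigr => r _ do rewrite mulr_suml mulr_suml mulr_sumr.
    over.
  over.
rewrite [RHS]exchange_big; apply: eq_bigr => p _.
rewrite [RHS]exchange_big; apply: eq_bigr => r _.
rewrite [RHS]exchange_big; apply: eq_bigr => q _.
rewrite /X; have [-> ->] := stack_assoc r q p.
pose Y u := (stackd u p == s)%:R *
  (h r * g q * f p * t ^+ (removed r q + removed u p)).
apply: etrans (esym (sum_stack (stackd r q) Y)) _.
by apply: eq_bigr => u _; rewrite /Y exprD; apply/esym/shuffle_r.
Qed.

Lemma diagram_comp1m m n (f : hom m n) : diagram_comp t (@mor1
  (partition_category t) n) f = f.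
Proof.
apply/ffunP => r; rewrite partition_mor1E diagram_compE (bigD1 (perm_diagram
  1%g)) //=.
rewrite [X in _ + X]big1 => [|q /negPf q1]; last first.
  by rewrite big1 // => p _; rewrite ffunE q1 !mul0r mulr0.
rewrite addr0 (bigD1 r) //= big1 => [|p /negPf pr]; last first.
  by have [-> _] := stack_id_l p; rewrite pr mul0r.
by have [-> ->] := stack_id_l r; rewrite ffunE !eqxx addr0 !mul1r mulr1.
Qed.

Lemma diagram_compm1 m n (f : hom m n) : diagram_comp t f (@mor1
  (partition_category t) m) = f.
Proof.
apply/ffunP => r; rewrite partition_mor1E diagram_compE exchange_big (bigD1
  (perm_diagram 1%g)) //=.
rewrite [X in _ + X]big1 => [|q /negPf q1]; last first.
  by rewrite big1 // => p _; rewrite ffunE q1 mulr0 mul0r mulr0.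
rewrite addr0 (bigD1 r) //= big1 => [|p /negPf pr]; last first.
  by have [-> _] := stack_id_r p; rewrite pr mul0r.
by have [-> ->] := stack_id_r r; rewrite ffunE !eqxx addr0 mul1r !mulr1.
Qed.

Definition partition_category_linear : linear_category F (partition_category t).
Proof.
apply: (@LinearCategory F (partition_category t) (fun m n f => [ffun r =>
  - f r])
  (fun m n a f => [ffun r => a * f r])) => //.
- by move=> m n f g h; apply/ffunP => r; rewrite !ffunE addrA.
- by move=> m n f g; apply/ffunP => r; rewrite !ffunE addrC.
- by move=> m n f; apply/ffunP => r; rewrite !ffunE add0r.
- by move=> m n f; apply/ffunP => r; rewrite !ffunE addNr.
- by move=> m n a b f; apply/ffunP => r; rewrite !ffunE mulrA.
- by move=> m n f; apply/ffunP => r; rewrite !ffunE mul1r.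
- by move=> m n a f g; apply/ffunP => r; rewrite !ffunE mulrDr.
- by move=> m n f a b; apply/ffunP => r; rewrite !ffunE mulrDl.
- by move=> *; apply: diagram_compA.
- by move=> *; apply: diagram_comp1m.
- by move=> *; apply: diagram_compm1.
- move=> m l n g h f _ _ _; apply/ffunP => r;
    rewrite [RHS]ffunE !diagram_compE -big_split.
  apply: eq_bigr => q _; rewrite -big_split; apply: eq_bigr => p _ /=.
  by rewrite ffunE !mulrDl mulrDr.
- move=> m l n h f g _ _ _; apply/ffunP => r;
    rewrite [RHS]ffunE !diagram_compE -big_split.
  apply: eq_bigr => q _; rewrite -big_split; apply: eq_bigr => p _ /=.
  by rewrite ffunE mulrDr mulrDl mulrDr.
- move=> m l n a g f _ _; apply/ffunP => r;
    rewrite [RHS]ffunE !diagram_compE mulr_sumr.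
  apply: eq_bigr => q _; rewrite mulr_sumr; apply: eq_bigr => p _ /=.
  by rewrite ffunE -!mulrA mulrCA.
- move=> m l n a g f _ _; apply/ffunP => r;
    rewrite [RHS]ffunE !diagram_compE mulr_sumr.
  apply: eq_bigr => q _; rewrite mulr_sumr; apply: eq_bigr => p _ /=.
  by rewrite ffunE -!mulrA [in LHS](mulrCA (g q)) [LHS]mulrCA.
- move=> m n; exists (diagram m n : finType), (fun (f : hom m n) r => f r).
  by split=> [f g r|a f r|f g _ _ /ffunP //]; rewrite ffunE.
Defined.

Lemma juxtapose_identity n (p : diagram n n) (p' : diagram 1 1) :
  val p = identity_diagram n -> val p' = identity_diagram 1 ->
  juxtapose p p' = identity_diagram (n + 1).
Proof.
move=> E E'; rewrite /juxtapose E E'; apply/setP => B; apply/setUP/imsetP.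
  case=> /imsetP[_ /imsetP[i _ ->] ->].
    by exists (lshift 1 i) => //; rewrite imsetU1 imset_set1.
  by exists (rshift n i) => //; rewrite imsetU1 imset_set1.
case=> i _ ->; case: (split_ordP i) => j ->; [left | right]; apply/imsetP.
  by exists [set inl j; inr j]; rewrite ?imsetU1 ?imset_set1 //; apply: imset_f.
by exists [set inl j; inr j]; rewrite ?imsetU1 ?imset_set1 //; apply: imset_f.
Qed.

Lemma diagram_tens1 n :
  diagram_tens (@mor1 (partition_category t) n) (@mor1 (partition_category t)
    1) =
  @mor1 (partition_category t) (n + 1)%N.
Proof.
apply/ffunP => r; rewrite !partition_mor1E [LHS]ffunE [RHS]ffunE.
rewrite (bigD1 (perm_diagram 1%g)) //= [X in _ + X]big1 ?addr0; last first.
  by move=> p /negPf pn; rewrite big1 // => p' _; rewrite ffunE pn mul0r.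
rewrite big_mkcond (bigD1 (perm_diagram 1%g)) //= big1 ?addr0; last first.
  move=> p' /negPf pn; case: ifP => // _.
  by rewrite [X in _ * X]ffunE pn mulr0.
rewrite juxtapose_identity ?val_perm_diagram1 // !ffunE !eqxx mulr1.
rewrite -(inj_eq val_inj r) val_perm_diagram1 eq_sym.
by case: eqP.
Qed.

End PartitionCategory.

Theorem Rep_St_growth (F : numClosedFieldType) (t : F) (R : realType) :
  superexponential_growth (Rep_St t) R.
Proof.
pose L := partition_category_linear t.
pose rho n (s : 'S_n) := delta_diagram F (perm_diagram s^-1%g).
apply: (@growth_from_symmetric_groups R F (partition_category t) L id rho) =>
  //.
- exact: addn1.
- exact: diagram_tens1.
- by move=> n; rewrite partition_mor1E /rho invg1.
- move=> n s s'; rewrite [RHS]diagram_comp_delta.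
  have [-> ->] := stack_perm s^-1%g s'^-1%g.
  by apply/ffunP => r; rewrite !ffunE expr0 mulr1 invMg eq_sym.
- move=> n a S0 s.
  pose ev (f : Hom L n n) := f (perm_diagram s^-1%g).
  have evD (f g : Hom L n n) : ev (f + g) = ev f + ev g by apply: ffunE.
  have ev0 : ev 0 = 0 by apply: ffunE.
  rewrite -[RHS]ev0 -S0 (big_morph ev evD ev0).
  transitivity (\sum_s' a s' * (s' == s)%:R).
    by rewrite (bigD1 s) //= eqxx mulr1 big1 ?addr0 // => s' /negPf->;
      rewrite mulr0.
  apply: eq_bigr => s' _; rewrite /ev ffunE /rho ffunE.
  by rewrite (inj_eq (@perm_diagram_inj n)) (inj_eq invg_inj) eq_sym.
Qed.

(** * Integration against the Euler characteristic *)

(** ** Increasing bijections of the line *)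

Section IncreasingBijections.
Variable R : realType.
Implicit Types (g h : R -> R) (u v s A : seq R).

Definition increasing_bij g := {homo g : a b / a < b} /\ bijective g.

Lemma increasing_mono g : increasing_bij g -> {mono g : a b / a < b}.
Proof. by case=> gh _; apply: leW_mono; apply: le_mono. Qed.

Lemma increasing_comp g h :
  increasing_bij g -> increasing_bij h -> increasing_bij (g \o h).
Proof. by move=> [gh gb] [hh hb]; split;
  [move=> a b /hh/gh | apply: bij_comp]. Qed.

Lemma increasing_inv g : increasing_bij g ->
  exists h, [/\ increasing_bij h, cancel g h & cancel h g].
Proof.
move=> gi; have [gh [h gK hK]] := gi; exists h; split=> //; split;
  last by exists g.
by move=> a b ab; rewrite -(increasing_mono gi) !hK.
Qed.

Lemma increasing_sorted g s : increasing_bij g ->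
  sorted <%R (map g s) = sorted <%R s.
Proof. by move=> gi; rewrite sorted_map; apply: eq_sorted => a b /=;
  apply: increasing_mono. Qed.

Lemma increasing_inj g : increasing_bij g -> injective g.
Proof. by case=> _ /bij_inj. Qed.

(** The piecewise linear map that fixes [c, +oo) and sends [a] to [b]. *)
Lemma move_point_below (a b c : R) : a < c -> b < c ->
  exists g, [/\ increasing_bij g, g a = b & forall x, c <= x -> g x = x].
Proof.
move=> ac bc.
have aux p q : 0 < p -> 0 < q ->
    {homo (fun x => if c <= x then x else c - (c - x) * p / q) : x y / x < y}.
  move=> p0 q0 x y xy; have r0 : 0 < p / q by rewrite divr_gt0.
  have [cx|xc] := leP c x; have [cy|yc] := leP c y => //.
  - by have := lt_le_trans xy (le_trans (ltW yc) cx); rewrite ltxx.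
  - have : 0 < (c - x) * (p / q) by rewrite mulr_gt0 // subr_gt0.
    by rewrite mulrA; lra.
  - rewrite ltrD2l ltrN2 -!mulrA ltr_pM2r //; lra.
have can p q : 0 < p -> 0 < q ->
    cancel (fun x => if c <= x then x else c - (c - x) * p / q)
           (fun x => if c <= x then x else c - (c - x) * q / p).
  move=> p0 q0 x /=; have [->//|xc] := leP c x.
  have r0 : 0 < (c - x) * p / q by rewrite divr_gt0 // mulr_gt0 // subr_gt0.
  have -> : (c <= c - (c - x) * p / q) = false by apply/negbTE;
    rewrite -ltNge; lra.
  by field; rewrite !gt_eqF.
have p0 : 0 < c - b by rewrite subr_gt0.
have q0 : 0 < c - a by rewrite subr_gt0.
exists (fun x => if c <= x then x else c - (c - x) * (c - b) / (c - a)); split.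
- split; first exact: aux.
  exists (fun x => if c <= x then x else c - (c - x) * (c - a) / (c - b));
    exact: can.
- by rewrite leNgt ac /=; field; rewrite gt_eqF.
- by move=> x ->.
Qed.

(** The induction adds the lowest point last, by a map that moves nothing above
    the second lowest one. *)
Lemma increasing_transitive u v : sorted <%R u -> sorted <%R v ->
  size u = size v -> exists g, increasing_bij g /\ map g u = v.
Proof.
elim: u v => [|a u IH] [|b v] //= su sv.
  by move=> _; exists id; split=> //; split=> //; exists id.
case=> uv; have [||g [gi guv]] := IH v _ _ uv.
- exact: path_sorted su.
- exact: path_sorted sv.
case: u v su sv uv guv {IH} => [|a' u] [|b' v] //= su sv _.
  move=> _; exists (fun x => x + (b - a)); split; last by rewrite addrC subrK.
  split; first by move=> x y xy; rewrite ltrD2r.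
  by exists (fun x => x - (b - a)) => x; rewrite ?addrK ?subrK.
case=> ga gu; have [aa' _] := andP su; have [bb' pv] := andP sv.
have gaa : g a < b' by rewrite -ga; case: gi => gh _; apply: gh.
have [h [hi hb hfix]] := move_point_below gaa bb'.
exists (h \o g); split; first exact: increasing_comp.
rewrite /= hb ga hfix // -gu; congr (_ :: _ :: _).
rewrite map_comp -[RHS]map_id; apply/eq_in_map => x; rewrite gu => xv.
by apply/hfix/ltW; have := order_path_min lt_trans pv => /allP; apply.
Qed.

Definition fixes A g := forall a, a \in A -> g a = a.

Lemma fixesP A g : map g A = A <-> fixes A g.
Proof.
rewrite -[X in _ = X]map_id; split=> [/eq_in_map//|H]; exact/eq_in_map.
Qed.

Lemma sorted_insertion A x : sorted <%R A -> x \notin A ->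
  exists s1 s2, A = s1 ++ s2 /\ sorted <%R (s1 ++ x :: s2).
Proof.
elim: A => [|a A IH] /= sA; first by exists [::], [::].
rewrite inE negb_or => /andP[xa xA]; case: (ltgtP x a) xa => // [xa|ax] _.
  by exists [::], (a :: A); rewrite /= xa.
have [s1 [s2 [E s12]]] := IH (path_sorted sA) xA.
exists (a :: s1), s2; split; first by rewrite E.
by move: sA; rewrite E; case: (s1) s12 => [|b t] /=;
  [rewrite ax | move=> -> /andP[->]].
Qed.

Lemma sorted_replace s1 s2 x y : sorted <%R (s1 ++ x :: s2) -> y \notin s1 ++
  s2 ->
  (forall a, a \in s1 ++ s2 -> (a < x) = (a < y)) -> sorted <%R (s1 ++ y :: s2).
Proof.
rewrite !(sorted_pairwise lt_trans) !pairwise_cat !allrel_consr /=.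
move=> /and3P[/andP[s1x ->] -> /andP[xs2 ->]] ys E; rewrite !andbT;
  apply/andP; split.
  by apply/allP => a as1; rewrite -E ?mem_cat ?as1 //; apply: (allP s1x).
apply/allP => a as2; rewrite ltNge le_eqVlt -E ?mem_cat ?as2 ?orbT //.
rewrite negb_or; have /= xa := allP xs2 a as2; rewrite -leNgt (ltW xa) andbT.
by apply: contra ys => /eqP<-; rewrite mem_cat as2 orbT.
Qed.

Lemma increasing_replace s1 u v s2 :
  sorted <%R (s1 ++ u ++ s2) -> sorted <%R (s1 ++ v ++ s2) -> size u = size v ->
  exists g, [/\ increasing_bij g, fixes (s1 ++ s2) g & map g u = v].
Proof.
move=> su sv uv; have [|g [gi]] := increasing_transitive su sv.
  by rewrite !size_cat uv.
rewrite !map_cat => /eqP; rewrite eqseq_cat ?size_map // =>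
  /andP[/eqP/fixesP f1].
rewrite eqseq_cat ?size_map // => /andP[/eqP guv /eqP/fixesP f2].
by exists g; split=> // a; rewrite mem_cat => /orP[/f1|/f2].
Qed.

End IncreasingBijections.

(** ** The integral over the line *)

Section Line.
Variables (R : realType) (k : fieldType).
Implicit Types (f : R -> k) (A B C s : seq R) (a b x y : R).

(** The value of the integral of [f] computed from the breakpoints [A]. *)
Definition alternating A f : k :=
  \sum_(a <- A) f a - \sum_(a <- gap_points A) f a.

(** The contribution of [(a, +oo)] when [s] lists the points above [a]. *)
Fixpoint tail_sum f a s : k :=
  if s is b :: s' then f b - f ((a + b) / 2) + tail_sum f b s' else - f (a + 1).

Lemma alternating_cons a s f :
  alternating (a :: s) f = f a - f (a - 1) + tail_sum f a s.
Proof.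
rewrite /alternating /= !big_cons opprD addrACA; congr (_ + _).
elim: s a => [|b s IH] a /=; first by rewrite !big_nil big_seq1 sub0r.
by rewrite !big_cons opprD addrACA IH.
Qed.

Lemma alternating_nil f : alternating [::] f = - f 0.
Proof. by rewrite /alternating /= big_nil big_seq1 sub0r. Qed.

Definition breaks_above f a s :=
  forall x y, a < x -> a < y -> x \notin s -> y \notin s ->
    (forall b, b \in s -> (b < x) = (b < y)) -> f x = f y.

Lemma breaks_above_cons f a b s : a < b ->
  breaks_above f a (b :: s) -> breaks_above f b s.
Proof.
move=> ab H x y bx by_ xs ys E; apply: H.
- exact: lt_trans bx.
- exact: lt_trans by_.
- by rewrite inE negb_or xs gt_eqF.
- by rewrite inE negb_or ys gt_eqF.
- by move=> c; rewrite inE => /predU1P[->|/E//]; rewrite bx by_.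
Qed.

Lemma breaks_above_behead f a s : breakpoints f (a :: s) -> breaks_above f a s.
Proof.
move=> [sA H] x y ax ay xs ys E; apply: H.
- by rewrite inE negb_or xs gt_eqF.
- by rewrite inE negb_or ys gt_eqF.
- by move=> c; rewrite inE => /predU1P[->|/E//]; rewrite ax ay.
Qed.

Lemma breaks_first_gap f a b s x y : path <%R b s -> breaks_above f a (b :: s)
  ->
  a < x < b -> a < y < b -> f x = f y.
Proof.
move=> /(order_path_min lt_trans)/allP bs H /andP[ax xb] /andP[ay yb].
have notin z : z < b -> z \notin b :: s.
  move=> zb; rewrite inE negb_or lt_eqF //=; apply/negP => /bs bz.
  by have := lt_trans zb bz; rewrite ltxx.
apply: H; rewrite ?notin // => c; rewrite inE => cs.
have bc : b <= c by case/predU1P: cs => [->//|/bs/ltW].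
by rewrite !ltNge (le_trans (ltW xb) bc) (le_trans (ltW yb) bc).
Qed.

Lemma mid_between a b : a < b -> a < (a + b) / 2 < b.
Proof. by move=> ab; apply/andP; split; lra. Qed.

Lemma tail_sum_insert f a s1 b s2 : path <%R a (s1 ++ b :: s2) ->
  breaks_above f a (s1 ++ s2) -> tail_sum f a (s1 ++ b :: s2) = tail_sum f a
    (s1 ++ s2).
Proof.
elim: s1 a => [|c s1 IH] a /=; last first.
  case/andP=> ac p H; rewrite IH //; exact: breaks_above_cons H.
case/andP=> ab; case: s2 => [|c s2] /= p H.
  have -> : f ((a + b) / 2) = f b.
    by apply: H; rewrite // ?in_nil // ; have /andP[] := mid_between ab.
  rewrite subrr add0r; congr (- _); apply: H; rewrite ?in_nil // ; lra.
have [bc pc] := andP p.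
have am : a < (a + c) / 2 < c by apply: mid_between; apply: lt_trans bc.
rewrite (breaks_first_gap pc H (x := (a + b) / 2) (y := (a + c) / 2)) //;
  last first.
  by have := mid_between ab; lra.
rewrite (breaks_first_gap pc H (x := (b + c) / 2) (y := (a + c) / 2)) //;
  last first.
  by have := mid_between bc; lra.
rewrite (breaks_first_gap pc H (x := b) (y := (a + c) / 2)) ?ab ?bc //.
by rewrite subrr add0r.
Qed.

Lemma alternating_insert f s1 b s2 : sorted <%R (s1 ++ b :: s2) ->
  breakpoints f (s1 ++ s2) -> alternating (s1 ++ b :: s2) f = alternating (s1
    ++ s2) f.
Proof.
case: s1 => [|a s1] /=; last first.
  move=> p H; rewrite !alternating_cons tail_sum_insert //.
  exact: breaks_above_behead H.
case: s2 => [|c s2] /= p [_ H].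
  rewrite alternating_cons alternating_nil /= (H (b - 1) 0) ?(H b 0) ?(H (b +
    1) 0) //.
  by rewrite subrr add0r.
have [bc pc] := andP p; rewrite !alternating_cons /=.
have low x y : x < c -> y < c -> f x = f y.
  move=> xc yc; pose z := Num.min x y - 1.
  have zxy : z < x /\ z < y by rewrite /z; case: (leP x y); lra.
  apply: (@breaks_first_gap f z c s2) => //; rewrite ?xc ?yc; last 2 first.
  - by case: zxy => ->.
  - by case: zxy => _ ->.
  by move=> u v _ _; apply: H.
have [e1 e2 e3] : [/\ b - 1 < c, c - 1 < c & (b + c) / 2 < c] by split; lra.
rewrite (low _ _ e1 e2) (low _ _ bc e2) (low _ _ e3 e2).
by rewrite subrr add0r.
Qed.

Lemma breakpoints_sub f A C : breakpoints f A -> sorted <%R C ->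
  {subset A <= C} -> breakpoints f C.
Proof.
move=> [_ H] sC AC; split=> // x y xC yC E; apply: H.
- by apply: contra xC => /AC.
- by apply: contra yC => /AC.
- by move=> a /AC/E.
Qed.

(** Superfluous breakpoints can be removed one at a time. *)
Lemma alternating_sub f A C : breakpoints f A -> sorted <%R C ->
  {subset A <= C} -> alternating C f = alternating A f.
Proof.
move=> bA; have [n] := ubnP (size C); elim: n C => // n IH C ltn sC AC.
have sA : sorted <%R A by case: bA.
have [/allP CA|/allPn[b bC bA']] := boolP (all (mem A) C).
  congr alternating; apply: lt_sorted_eq => // x.
  by apply/idP/idP => [/CA|/AC].
case/splitPr: bC ltn sC AC => s1 s2 ltn sC AC.
have sC' : sorted <%R (s1 ++ s2).
  by apply: (subseq_sorted lt_trans) sC; apply: cat_subseq => //;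
    apply: subseq_cons.
have AC' : {subset A <= s1 ++ s2}.
  move=> x xA; have := AC x xA; rewrite !mem_cat inE =>
    /or3P[->|/eqP E|->] //; last by rewrite orbT.
  by move: bA'; rewrite -E /= xA.
rewrite alternating_insert //; last exact: breakpoints_sub bA sC' AC'.
by apply: IH => //; move: ltn; rewrite !size_cat /= addnS.
Qed.

Lemma sorted_union A B : exists C, [/\ sorted <%R C, {subset A <= C},
  {subset B <= C}
  & forall x, x \in C -> x \in A ++ B].
Proof.
exists (sort <=%R (undup (A ++ B))).
have memC x : (x \in sort <=%R (undup (A ++ B))) = (x \in A ++ B).
  by rewrite mem_sort mem_undup.
split=> [|x xA|x xB|x].
- by rewrite sort_lt_sorted undup_uniq.
- by rewrite memC mem_cat xA.
- by rewrite memC mem_cat xB orbT.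
- by rewrite memC.
Qed.

Lemma euler1E f A : breakpoints f A -> euler1 f = alternating A f.
Proof.
move=> bA; rewrite /euler1; set B := classical_sets.xget _ _.
have bB : breakpoints f B by apply: classical_sets.xgetPex; exists A.
have [C [sC AC BC _]] := sorted_union A B.
by rewrite -(alternating_sub bA sC AC) (alternating_sub bB sC BC).
Qed.

Lemma alternatingD A f g : alternating A (fun x =>
  f x + g x) = alternating A f + alternating A g.
Proof. by rewrite /alternating !big_split /= opprD addrACA. Qed.

Lemma alternatingZ A c f : alternating A (fun x =>
  c * f x) = c * alternating A f.
Proof. by rewrite /alternating -!mulr_sumr mulrBr. Qed.

Lemma euler1_0 : euler1 (fun _ : R => 0 : k) = 0.
Proof. by rewrite /euler1 !big1 ?subrr. Qed.

(** ** Invariant functions on the line *)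

(** Step functions are handled as functions that are invariant under the
    increasing bijections fixing finitely many points: unlike a choice of
    breakpoints, this passes to functions defined by integrals. *)
Definition invariant1 A f := forall g, increasing_bij g -> fixes A g ->
  forall x, f (g x) = f x.

Lemma invariant1_breakpoints A f : sorted <%R A -> invariant1 A f ->
  breakpoints f A.
Proof.
move=> sA H; split=> // x y xA yA E.
have [s1 [s2 [A12 sx]]] := sorted_insertion sA xA; rewrite A12 in E yA.
have [g [gi gA [<-]]] := @increasing_replace _ s1 [:: x] [:: y] s2 sx
  (sorted_replace sx yA E) erefl.
by rewrite H // A12.
Qed.

Lemma tail_sum_change f g h a s : increasing_bij g -> cancel h g ->
  path <%R a s -> breaks_above f a s ->
  tail_sum (fun x => f (g x)) (h a) (map h s) = tail_sum f a s.
Proof.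
move=> gi hK; have gm := increasing_mono gi.
have hm : {mono h : x y / x < y} by move=> x y; rewrite -gm !hK.
elim: s a => [|b s IH] a /= => [_ H|/andP[ab p] H].
  congr (- _); apply: H; rewrite ?in_nil ?ltrDl ?ltr01 //.
  by rewrite -[ltLHS]hK gm ltrDl ltr01.
rewrite hK IH //; last exact: breaks_above_cons H.
congr (_ - _ + _); apply: (breaks_first_gap p H); last exact: mid_between.
rewrite -[X in X < _]hK -[X in _ && (_ < X)]hK !gm; apply: mid_between.
by rewrite hm.
Qed.

Lemma euler1_change f A g : breakpoints f A -> increasing_bij g ->
  euler1 (fun x => f (g x)) = euler1 f.
Proof.
move=> bA gi; have [h [hi gK hK]] := increasing_inv gi.
have [sA H] := bA.
have gh x y : (h x < y) = (x < g y) by rewrite -(increasing_mono gi) hK.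
have bA' : breakpoints (fun x => f (g x)) (map h A).
  split; first by rewrite increasing_sorted.
  have memh x : (g x \in A) = (x \in map h A).
    by rewrite -[in RHS](gK x) (mem_map (increasing_inj hi)).
  move=> x y xA yA E; apply: H; rewrite ?memh // => a aA.
  by rewrite -!gh; apply: E; apply: map_f.
rewrite (euler1E bA) (euler1E bA').
case: A bA sA {H bA'} => [|a s] bA sA /=.
  by rewrite !alternating_nil; case: bA => _ H; congr (- _); apply: H.
have bs := breaks_above_behead bA; have [_ H] := bA.
rewrite !alternating_cons hK (tail_sum_change gi hK sA bs).
congr (_ - _ + _).
have notin z : z < a -> z \notin a :: s.
  move=> za; rewrite inE negb_or lt_eqF //=; apply/negP => zs.
  by have := order_path_min lt_trans sA => /allP/(_ z zs) /(lt_trans za);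
    rewrite ltxx.
have low z b : z < a -> b \in a :: s -> (b < z) = false.
  move=> za; rewrite inE => bs'; apply/negbTE; rewrite -leNgt; apply/ltW.
  apply: lt_le_trans za _; case/predU1P: bs' => [->//|bs'].
  by have := order_path_min lt_trans sA => /allP/(_ b bs')/ltW.
have ga : g (h a - 1) < a by rewrite -[ltRHS]hK (increasing_mono gi) ltrBlDr
  ltrDl ltr01.
have a1 : a - 1 < a by rewrite ltrBlDr ltrDl ltr01.
apply: H => [||b bs']; try exact: notin.
by rewrite (low _ _ ga bs') (low _ _ a1 bs').
Qed.

(** A gap point [c] added to the breakpoints cuts its gap into [c] and two open
    intervals, which contain [l] and [h]. *)
Lemma tail_sum_refine a s c :
  path <%R a s -> c \in rcons (pairmap (fun x y =>
    (x + y) / 2) a s) (last a s + 1) ->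
  exists s1 s2 l h, [/\ s = s1 ++ s2, path <%R a (s1 ++ [:: l; c; h] ++ s2) &
    forall f, tail_sum f a (s1 ++ c :: s2) = tail_sum f a s + (f c + f c - f l
      - f h)].
Proof.
elim: s a => [|b s IH] a /=.
  move=> _; rewrite inE => /eqP->.
  exists [::], [::], ((a + (a + 1)) / 2), (a + 1 + 1); split=> //=.
    by rewrite !andbT; apply/and3P; split; lra.
  by move=> f; ring.
case/andP=> ab p; rewrite inE => /predU1P[->|cs].
  exists [::], (b :: s), ((a + (a + b) / 2) / 2), (((a + b) / 2 + b) / 2);
    split=> //=.
    by rewrite p; apply/and5P; split=> //; lra.
  by move=> f; ring.
have [s1 [s2 [l [h [E q H]]]]] := IH b p cs.
exists (b :: s1), s2, l, h; split=> [||f] /=; first by rewrite E.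
  by rewrite ab.
by rewrite H; ring.
Qed.

Lemma alternating_refine A c : sorted <%R A -> c \in gap_points A ->
  exists s1 s2 l h, [/\ A = s1 ++ s2, sorted <%R (s1 ++ [:: l; c; h] ++ s2) &
    forall f, alternating (s1 ++ c :: s2) f = alternating A f + (f c + f c - f
      l - f h)].
Proof.
case: A => [|a s] sA.
  rewrite /= inE => /eqP->; exists [::], [::], (-1), 1; split=> //=.
    by rewrite andbT; apply/andP; split; lra.
  move=> f; rewrite alternating_cons alternating_nil /= sub0r add0r; ring.
rewrite /= inE => /predU1P[->|cs].
  exists [::], (a :: s), (a - 1 - 1), ((a - 1 + a) / 2); split=> //=.
    by move: sA => /= ->; rewrite andbT; apply/and3P; split; lra.
  by move=> f; rewrite /= !alternating_cons /=; ring.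
have [s1 [s2 [l [h [E q H]]]]] := tail_sum_refine sA cs.
exists (a :: s1), s2, l, h; split=> [||f] //=; first by rewrite E.
by rewrite !alternating_cons H; ring.
Qed.

(** ** Fubini's theorem on the plane *)

Definition invariant2 A (F : R -> R -> k) :=
  forall g, increasing_bij g -> fixes A g -> forall x y, F (g x) (g y) = F x y.

Lemma invariant2_slice A (F : R -> R -> k) x : invariant2 A F -> invariant1 (x
  :: A) (F x).
Proof.
move=> H g gi gA y; rewrite -[in RHS](H g gi) => [|a aA].
  by rewrite (gA x) ?mem_head.
by apply: gA; rewrite inE aA orbT.
Qed.

Lemma invariant1_breaks A f : invariant1 A f -> exists B, breakpoints f B.
Proof.
move=> H; have [C [sC AC _ _]] := sorted_union A [::]; exists C.
by apply: invariant1_breakpoints => // g gi gC; apply: H => // a /AC; apply: gC.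
Qed.

Lemma invariant2_euler1 A (F : R -> R -> k) : invariant2 A F ->
  invariant1 A (fun x => euler1 (F x)).
Proof.
move=> H g gi gA x; have [B bB] := invariant1_breaks (invariant2_slice (x := g
  x) H).
rewrite -(euler1_change bB gi); congr euler1; apply: boolp.funext => y.
exact: H.
Qed.

(** At a gap point [c] the inner integral differs from its value for product
    functions by the contribution of the square of the gap, which is symmetric
    because the gap has automorphisms moving [l] to [c] and [c] to [h]. *)
Lemma euler1_gap_symmetric A (F : R -> R -> k) c :
  sorted <%R A -> invariant2 A F -> c \in gap_points A -> exists d,
    euler1 (F c) = alternating A (F c) + d /\
    euler1 (fun x => F x c) = alternating A (fun x => F x c) + d.
Proof.
move=> sA H cA; have [s1 [s2 [l [h [A12 sl E]]]]] := alternating_refine sA cA.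
have sc : sorted <%R (s1 ++ c :: s2).
  apply: (subseq_sorted lt_trans) sl; apply: cat_subseq => //.
  apply: (@subseq_trans _ (c :: h :: s2)); last exact: subseq_cons.
  by apply: (@cat_subseq _ [:: c] s2 [:: c]) => //; apply: subseq_cons.
have sub f : invariant1 (c :: A) f -> breakpoints f (s1 ++ c :: s2).
  move=> If; apply: invariant1_breakpoints => // g gi gC; apply: If => // a.
  rewrite A12 inE mem_cat => aC; apply: gC; rewrite mem_cat inE.
  by case/or3P: aC => ->; rewrite ?orbT.
have H' : invariant2 A (fun x y => F y x) by move=> g gi gA x y; rewrite H.
have s_lc : sorted <%R (s1 ++ [:: l; c] ++ s2).
  apply: (subseq_sorted lt_trans) sl; apply: cat_subseq => //.
  by apply: (@cat_subseq _ [:: l; c] s2 [:: l; c]) => //; apply: subseq_cons.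
have s_ch : sorted <%R (s1 ++ [:: c; h] ++ s2).
  apply: (subseq_sorted lt_trans) sl; apply: cat_subseq => //.
  exact: subseq_cons.
have [g1 [g1i g1A [g1l g1c]]] := increasing_replace s_lc s_ch erefl.
have Elc : F h c = F c l by rewrite -[in LHS]g1l -[in LHS]g1c H // A12.
have Ecl : F c h = F l c.
  by rewrite -[in RHS](H g1) ?A12 // g1l g1c.
exists (F c c + F c c - F c l - F c h); split.
  by rewrite (euler1E (sub _ (invariant2_slice (x := c) H))) E.
rewrite (euler1E (sub _ (invariant2_slice (x := c) H'))) E /= Elc Ecl; ring.
Qed.

Lemma fubini1 A (F : R -> R -> k) : invariant2 A F ->
  euler1 (fun x => euler1 (fun y => F x y)) = euler1 (fun y =>
    euler1 (fun x => F x y)).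
Proof.
move=> H0; have [C [sC AC _ _]] := sorted_union A [::].
have H : invariant2 C F.
  by move=> g gi gC; apply: H0 => // a /AC; apply: gC.
have H' : invariant2 C (fun x y => F y x) by move=> g gi gA x y; rewrite H.
have slice (G : R -> R -> k) a : invariant2 C G -> a \in C -> breakpoints (G a)
  C.
  move=> HG aC; apply: invariant1_breakpoints => // g gi gC.
  by apply: (invariant2_slice (x := a) HG) => // b;
    rewrite inE => /predU1P[->|]; apply: gC.
have inner (G : R -> R -> k) : invariant2 C G -> breakpoints (fun x =>
  euler1 (G x)) C.
  by move=> HG; apply: invariant1_breakpoints => //; apply: invariant2_euler1.
rewrite (euler1E (inner _ H)) (euler1E (inner _ H')) /alternating.
have /boolp.choice[d dP] : forall c, exists d, c \in gap_points C ->
    euler1 (F c) = alternating C (F c) + d /\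
    euler1 (fun x => F x c) = alternating C (fun x => F x c) + d.
  move=> c; have [cC|ncC] := boolP (c \in gap_points C); last by exists 0.
  by have [d dP] := euler1_gap_symmetric sC H cC; exists d.
have pts (G : R -> R -> k) : invariant2 C G ->
    \sum_(a <- C) euler1 (G a) = \sum_(a <- C) alternating C (G a).
  by move=> HG; apply: eq_big_seq => a aC; rewrite (euler1E (slice _ _ HG aC)).
rewrite (pts _ H) (pts _ H').
have gaps (G : R -> R -> k) :
    (forall c, c \in gap_points C -> euler1 (G c) = alternating C (G c) + d c)
      ->
    \sum_(c <- gap_points C) euler1 (G c) =
    \sum_(c <- gap_points C) (alternating C (G c) + d c) by move=> E;
      apply: eq_big_seq.
rewrite (gaps F) => [|c /dP[->]//].
rewrite (gaps (fun y x => F x y)) => [|c /dP[_ ->]//].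
rewrite !big_split /= !opprD !addrA; congr (_ - _).
rewrite /alternating !sumrN.
rewrite [\sum_(i <- C) \sum_(a <- C) F i a]exchange_big.
rewrite [\sum_(i <- gap_points C) \sum_(a <- gap_points C) F i a]exchange_big.
rewrite [\sum_(i <- C) \sum_(a <- gap_points C) F i a]exchange_big.
rewrite [\sum_(i <- gap_points C) \sum_(a <- C) F i a]exchange_big /=.
ring.
Qed.

End Line.

(** ** Iterated integrals *)

Section Iterated.
Variables (R : realType) (k : fieldType).
Implicit Types (A s z : seq R) (F G : seq R -> k).

Definition invariant A F := forall g, increasing_bij g -> fixes A g ->
  forall s, F (map g s) = F s.

Lemma fixes_sub A B (g : R -> R) : {subset A <= B} -> fixes B g -> fixes A g.
Proof. by move=> AB gB a /AB; apply: gB. Qed.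

Lemma invariant_sub A B F : {subset A <= B} -> invariant A F -> invariant B F.
Proof. by move=> AB H g gi gB; apply: H => //; apply: fixes_sub gB. Qed.

Lemma invariant_cons A F x : invariant A F -> invariant (x :: A) (fun s =>
  F (x :: s)).
Proof.
move=> H g gi gA s; rewrite -[in RHS](H g gi); last first.
  by apply: fixes_sub gA => a aA; rewrite inE aA orbT.
by rewrite /= (gA x) // mem_head.
Qed.

Arguments invariant_cons {A F} x.

Lemma euler_ext n F G : F =1 G -> euler n F = euler n G.
Proof. by move=> FG; congr euler; apply: boolp.funext. Qed.

Lemma euler1_ext (f g : R -> k) : f =1 g -> euler1 f = euler1 g.
Proof. by move=> fg; congr euler1; apply: boolp.funext. Qed.

(** The inner integrals are compared first, at the moved value of the outer
    variable; this also shows that they are invariant in that variable. *)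
Lemma euler_change n A F g : invariant A F -> increasing_bij g ->
  euler n (fun s => F (map g s)) = euler n F.
Proof.
elim: n A F g => [|n IH] A F g HF gi //=.
have slice x : euler n (fun s => F (g x :: map g s)) = euler n (fun s =>
  F (g x :: s)).
  by apply: (IH (g x :: A)) gi => //; apply: invariant_cons.
rewrite (euler1_ext slice).
have [|B bB] := @invariant1_breaks _ _ A (fun y => euler n (fun s =>
  F (y :: s))).
  move=> h hi hA y; rewrite -(IH (h y :: A) _ h (invariant_cons _ HF) hi).
  by apply: euler_ext => s; apply: (HF h hi hA (y :: s)).
exact: (euler1_change bB gi).
Qed.

Lemma euler_equivariant n A F G g : invariant A F -> increasing_bij g ->
  (forall s, F (map g s) = G s) -> euler n F = euler n G.
Proof. by move=> HF gi FG; rewrite -(euler_change n HF gi);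
  apply: euler_ext. Qed.

Lemma euler_slice_invariant n A F : invariant A F ->
  invariant1 A (fun x => euler n (fun s => F (x :: s))).
Proof.
move=> HF g gi gA x; apply: (euler_equivariant n (invariant_cons (g x) HF) gi).
by move=> s; apply: (HF g gi gA (x :: s)).
Qed.

Lemma euler0 n : euler n (fun _ : seq R => 0 : k) = 0.
Proof. by elim: n => //= n IH; rewrite (euler1_ext (fun _ => IH)) euler1_0. Qed.

Lemma eulerD n A F G : invariant A F -> invariant A G ->
  euler n (fun s => F s + G s) = euler n F + euler n G.
Proof.
elim: n A F G => [|n IH] A F G HF HG //=.
have E x := IH _ _ _ (invariant_cons x HF) (invariant_cons x HG).
rewrite (euler1_ext E).
have [C [sC AC _ _]] := sorted_union A [::].
have br H : invariant A H -> breakpoints (fun x => euler n (fun s =>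
  H (x :: s))) C.
  move=> HH; apply: invariant1_breakpoints => //; apply: euler_slice_invariant.
  exact: invariant_sub HH.
have bD : breakpoints (fun x => euler n (fun s =>
  F (x :: s)) + euler n (fun s => G (x :: s))) C.
  have [_ bF] := br F HF; have [_ bG] := br G HG.
  by split=> // x y xC yC c; rewrite (bF x y) // (bG x y).
by rewrite (euler1E bD) (euler1E (br _ HF)) (euler1E (br _ HG)) alternatingD.
Qed.

Lemma eulerZ n A c F : invariant A F -> euler n (fun s =>
  c * F s) = c * euler n F.
Proof.
elim: n A F => [|n IH] A F HF //=.
rewrite (euler1_ext (fun x => IH _ _ (invariant_cons x HF))).
have [B bB] := invariant1_breaks (euler_slice_invariant n HF).
have bc : breakpoints (fun x => c * euler n (fun s => F (x :: s))) B.
  by have [sB bF] := bB; split=> // x y xC yC E; rewrite (bF x y).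
by rewrite (euler1E bB) (euler1E bc) alternatingZ.
Qed.

Lemma euler_sum n (I : Type) (r : seq I) A (F : I -> seq R -> k) :
  (forall i, invariant A (F i)) ->
  euler n (fun s => \sum_(i <- r) F i s) = \sum_(i <- r) euler n (F i).
Proof.
move=> HF; elim: r => [|i r IH].
  by rewrite big_nil -[RHS](euler0 n); apply: euler_ext => s; rewrite big_nil.
rewrite big_cons -IH -(@eulerD n A) //.
  by apply: euler_ext => s; rewrite big_cons.
by move=> g gi gA s; apply: eq_bigr => j _; apply: HF.
Qed.

Lemma euler1_point (f : R -> k) (a : R) : (forall x,
  x != a -> f x = 0) -> euler1 f = f a.
Proof.
move=> H; have bf : breakpoints f [:: a].
  by split=> // x y; rewrite !inE => xa ya _; rewrite !H.
rewrite (euler1E bf) alternating_cons /= (H (a - 1)) ?(H (a + 1)) ?subr0 ?oppr0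
  ?addr0 //.
  by rewrite gt_eqF // ltrDl.
by rewrite lt_eqF // ltrBlDr ltrDl.
Qed.

Lemma euler_point n F z : size z = n -> (forall s,
  s != z -> F s = 0) -> euler n F = F z.
Proof.
elim: n F z => [|n IH] F [|a z] //= => [[sz]] H.
rewrite (@euler1_point _ a) => [|x xa].
  by apply: IH => // s sz'; apply: H; rewrite eqseq_cons eqxx.
rewrite -[RHS](euler0 n); apply: euler_ext => s; apply: H.
by rewrite eqseq_cons (negPf xa).
Qed.

Lemma fubini_line n A (F : R -> seq R -> k) :
  (forall g, increasing_bij g -> fixes A g -> forall x s,
    F (g x) (map g s) = F x s) ->
  euler1 (fun x => euler n (F x)) = euler n (fun s => euler1 (fun x => F x s)).
Proof.
elim: n A F => [|n IH] A F HF //=.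
have HFy y : forall g, increasing_bij g -> fixes (y :: A) g ->
    forall x s, F (g x) (y :: map g s) = F x (y :: s).
  move=> g gi gA x s; rewrite -[in RHS](HF g gi) /= ?(gA y) ?mem_head //.
  by apply: fixes_sub gA => a aA; rewrite inE aA orbT.
rewrite (@fubini1 _ _ A (fun x y => euler n (fun s => F x (y :: s)))).
  by apply: euler1_ext => y; apply: (IH (y :: A)); apply: HFy.
move=> g gi gA x y; apply: (@euler_equivariant n (g x :: g y :: A) _ _ g) =>
  // [h hi hA s|s].
  rewrite -[in RHS](HF h hi); last by apply: fixes_sub hA => a aA;
    rewrite !inE aA !orbT.
  by rewrite /= (hA (g x)) ?(hA (g y)) // !inE eqxx ?orbT.
exact: (HF g gi gA x (y :: s)).
Qed.

Lemma fubini m n A (F : seq R -> seq R -> k) :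
  (forall g, increasing_bij g -> fixes A g -> forall s t,
    F (map g s) (map g t) = F s t) ->
  euler m (fun s => euler n (F s)) = euler n (fun t => euler m (fun s =>
    F s t)).
Proof.
elim: m A F => [|m IH] A F HF /=; first exact: euler_ext.
have HFx x : forall g, increasing_bij g -> fixes (x :: A) g ->
    forall s t, F (x :: map g s) (map g t) = F (x :: s) t.
  move=> g gi gA s t; rewrite -[in RHS](HF g gi) /= ?(gA x) ?mem_head //.
  by apply: fixes_sub gA => a aA; rewrite inE aA orbT.
rewrite (euler1_ext (fun x => IH (x :: A) (fun s t => F (x :: s) t) (HFx x))).
apply: (@fubini_line n A) => g gi gA x t.
apply: (@euler_equivariant m (g x :: map g t ++ A) _ _ g) => // [h hi hA s|s].
  rewrite -[in RHS](HF h hi); last by apply: fixes_sub hA => a aA;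
    rewrite inE mem_cat aA !orbT.
  rewrite /= (hA (g x)) ?mem_head //; congr (F _ _); apply/esym/fixesP.
  by apply: fixes_sub hA => a at_; rewrite inE mem_cat at_ !orbT.
exact: (HF g gi gA (x :: s) t).
Qed.

End Iterated.

(** * The Delannoy category *)

(** ** Integrals over unions of orbits *)

Section Gsets.
Variables (R : realType) (k : fieldType).
Implicit Types (X Y Z : gset) (A : seq R).

Definition coords X (x : point R X) : seq R := (val x).2.

Fact move_subproof (g : R -> R) X (x : point R X) :
  increasing_bij g -> is_point (((val x).1,
    map g (coords x)) : orbit X * seq R).
Proof.
move=> gi; have /andP[sx px] := valP x.
by rewrite /is_point /= size_map increasing_sorted // sx.
Qed.

Definition move (g : R -> R) (gi : increasing_bij g) X (x : point R X) : point
  R X :=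
  exist _ ((val x).1, map g (coords x)) (move_subproof x gi).

Lemma move_fixes g (gi : increasing_bij g) X (x : point R X) :
  fixes (coords x) g -> move gi x = x.
Proof. by move/fixesP => E; apply: val_inj; rewrite /= E;
  case: (x) => [[]]. Qed.

Lemma move_inj g (gi : increasing_bij g) X : injective (@move g gi X).
Proof.
move=> x y /(congr1 val) [E1 E2]; apply: val_inj.
rewrite (surjective_pairing (val x)) (surjective_pairing (val y)) E1;
  congr (_, _).
exact: inj_map (increasing_inj gi) _ _ E2.
Qed.

Lemma translate_move g (gi : increasing_bij g) X (x x' : point R X) :
  translate g x x' -> x' = move gi x.
Proof.
by case: x' => [[i s] p] [/= ei es]; apply: val_inj; rewrite /= ei es.
Qed.

Lemma invariant_kernelP X Y (f : point R Y -> point R X -> k) :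
  invariant_kernel f <->
  forall g (gi : increasing_bij g) y x, f (move gi y) (move gi x) = f y x.
Proof.
split=> [H g gi y x|H g gh gb y y' x x' [y1 y2] [x1 x2]].
  by have [gh gb] := gi; apply: (H g gh gb); split.
pose gi : increasing_bij g := conj gh gb; rewrite -[RHS](H g gi).
have -> : y' = move gi y by apply: translate_move.
have -> : x' = move gi x by apply: translate_move.
by [].
Qed.

Definition invariant_on X A (f : point R X -> k) :=
  forall g (gi : increasing_bij g), fixes A g -> forall x, f (move gi x) = f x.

Definition extend0 X (f : point R X -> k) (i : orbit X) (s : seq R) : k :=
  oapp f 0 (insub (i, s)).

Lemma extend0_move X (f f' : point R X -> k) g (gi : increasing_bij g) :
  (forall x, f (move gi x) = f' x) ->
  forall i s, extend0 f i (map g s) = extend0 f' i s.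
Proof.
move=> ff i s; rewrite /extend0; case: (insubP _ (i, s)) => [x px E|px] /=.
  rewrite -ff; case: insubP => [x' _ E'|] /=.
    by congr f; apply: translate_move; rewrite /translate E' E.
  by rewrite /is_point /= size_map increasing_sorted // -/(is_point (X := X)
    (i, s)) px.
by rewrite insubN //; move: px; rewrite /is_point /= size_map increasing_sorted.
Qed.

Lemma extend0_invariant X A (f : point R X -> k) i :
  invariant_on A f -> invariant A (extend0 f i).
Proof. by move=> H g gi gA s; apply: (extend0_move (gi := gi)) => x;
  apply: H. Qed.

Lemma integral_move X A (f f' : point R X -> k) g (gi : increasing_bij g) :
  invariant_on A f -> (forall x, f (move gi x) = f' x) -> integral f = integral
    f'.
Proof.
move=> Hf ff; apply: eq_bigr => i _.
apply: (euler_equivariant _ (extend0_invariant i Hf) gi).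
exact: (extend0_move (gi := gi)).
Qed.

Lemma integral_ext X (f f' : point R X -> k) : f =1 f' -> integral f = integral
  f'.
Proof. by move=> ff; congr integral; apply: boolp.funext. Qed.

Lemma integralD X A (f f' : point R X -> k) : invariant_on A f -> invariant_on
  A f' ->
  integral (fun x => f x + f' x) = integral f + integral f'.
Proof.
move=> Hf Hf'; rewrite -big_split; apply: eq_bigr => i _ /=.
rewrite -(eulerD _ (extend0_invariant i Hf) (extend0_invariant i Hf')).
by apply: euler_ext => s; rewrite /extend0; case: insub => //=; rewrite addr0.
Qed.

Lemma integralZ X A c (f : point R X -> k) : invariant_on A f ->
  integral (fun x => c * f x) = c * integral f.
Proof.
move=> Hf; rewrite mulr_sumr; apply: eq_bigr => i _ /=.
rewrite -(eulerZ _ c (extend0_invariant i Hf)).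
by apply: euler_ext => s; rewrite /extend0; case: insub => //=; rewrite mulr0.
Qed.

Lemma integral_point X (f : point R X -> k) (x : point R X) :
  (forall y, y != x -> f y = 0) -> integral f = f x.
Proof.
move=> H; have px : is_point ((val x).1,
  (val x).2) by rewrite -surjective_pairing (valP x).
have extE i s : (i, s) != val x -> extend0 f i s = 0.
  move=> is_; rewrite /extend0; case: insubP => //= y _ E; apply: H.
  by apply: contra is_ => /eqP yx; rewrite -E yx.
rewrite /integral (bigD1 (val x).1) //= [X in _ + X]big1 => [|i ix]; last first.
  rewrite -[RHS](@euler0 R k (arity i)); apply: euler_ext => s; apply: extE.
  by apply: contra ix => /eqP <-.
have /andP[/eqP sx _] := px.
rewrite addr0 (@euler_point _ _ _ _ (val x).2) //.
  by rewrite -surjective_pairing valK.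
by move=> s sz; apply: extE; apply: contra sz => /eqP <-.
Qed.

Lemma integral_fubini X Y A (f : point R X -> point R Y -> k) :
  (forall g (gi : increasing_bij g), fixes A g ->
     forall x y, f (move gi x) (move gi y) = f x y) ->
  integral (fun x => integral (f x)) = integral (fun y => integral (fun x =>
    f x y)).
Proof.
move=> H.
pose F i j s t : k := oapp (fun x => extend0 (f x) j t) 0 (insub (i, s)).
have F2 i j s t : F i j s t = oapp (fun y => extend0 (fun x =>
  f x y) i s) 0 (insub (j, t)).
  by rewrite /F /extend0; case: insub => [x|] /=; case: insub.
have FA i j g : increasing_bij g -> fixes A g ->
    forall s t, F i j (map g s) (map g t) = F i j s t.
  move=> gi gA s t; rewrite /F.
  apply: (extend0_move (f := fun x => extend0 (f x) j (map g t))
    (f' := fun x => extend0 (f x) j t) (gi := gi)) => x.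
  by apply: (extend0_move (gi := gi)) => y; apply: H.
transitivity (\sum_i \sum_j euler (arity i) (fun s =>
  euler (arity j) (F i j s))).
  apply: eq_bigr => i _; rewrite -(@euler_sum _ _ _ _ _ A).
    apply: euler_ext => s; rewrite /F /extend0.
    case: (insub (i, s)) => [x|] //=.
    by rewrite big1 // => j _; apply: euler0.
  move=> j g gi gA s; apply: (@euler_equivariant _ _ _ (map g s ++ A) _ _ g) =>
    // [h hi hA t|t].
    rewrite -[in RHS](FA i j h hi); last by apply: fixes_sub hA => a aA;
      rewrite mem_cat aA orbT.
    congr (F _ _ _ _); apply/esym/fixesP; apply: fixes_sub hA => a as_.
    by rewrite mem_cat as_.
  exact: FA.
rewrite exchange_big; apply: eq_bigr => j _.
transitivity (\sum_i euler (arity j) (fun t => euler (arity i) (fun s =>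
  F i j s t))).
  by apply: eq_bigr => i _; apply: (@fubini _ _ _ _ A) => g gi gA s t;
    apply: FA.
rewrite -(@euler_sum _ _ _ _ _ A).
  apply: euler_ext => t; transitivity (\sum_i euler (arity i) (fun s =>
    oapp (fun y => extend0 (fun x => f x y) i s) 0 (insub (j, t)))).
    by apply: eq_bigr => i _; apply: euler_ext => s; apply: F2.
  rewrite /extend0; case: (insub (j, t)) => [y|] //=.
  by rewrite big1 // => i _; apply: euler0.
move=> i g gi gA t; apply: (@euler_equivariant _ _ _ (map g t ++ A) _ _ g) =>
  // [h hi hA s|s].
  rewrite -[in RHS](FA i j h hi); last by apply: fixes_sub hA => a aA;
    rewrite mem_cat aA orbT.
  congr (F _ _ _ _); apply/esym/fixesP; apply: fixes_sub hA => a at_.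
  by rewrite mem_cat at_.
exact: FA.
Qed.

(** ** The linear category of orbits *)

Local Notation D := (gset_category R k).

Lemma kernel_mor X Y (f : @hom D X Y) g (gi : increasing_bij g) y x :
  is_mor f -> f (move gi y) (move gi x) = f y x.
Proof. by move/invariant_kernelP; apply. Qed.

(** Moving all three points changes neither kernel, and the outer points stay
    in place. *)
Lemma integrand_invariant X Y Z (g : @hom D Y Z) (f : @hom D X Y) z x :
  is_mor g -> is_mor f -> invariant_on (coords z ++ coords x) (fun y =>
    g z y * f y x).
Proof.
move=> mg mf h hi hA y; rewrite -(kernel_mor hi z y mg) -(kernel_mor hi y x mf).
rewrite (@move_fixes _ hi _ z) ?(@move_fixes _ hi _ x) //;
  by apply: fixes_sub hA => a ain; rewrite mem_cat ain ?orbT.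
Qed.

Arguments integrand_invariant {X Y Z g f} z x.

Lemma gset_is_mor_comp X Y Z (g : @hom D Y Z) (f : @hom D X Y) :
  is_mor g -> is_mor f -> is_mor (comp g f).
Proof.
move=> mg mf; apply/invariant_kernelP => h hi z x.
apply: (integral_move (gi := hi)); first exact: (integrand_invariant _ _ mg mf).
by move=> y; rewrite (kernel_mor hi z y mg) (kernel_mor hi y x mf).
Qed.

Lemma kernel_ext X Y (f g : @hom D X Y) : (forall y x, f y x = g y x) -> f = g.
Proof. by move=> fg; do 2 apply: boolp.funext => ?; apply: fg. Qed.

Lemma gset_compA X Y Z W (h : @hom D Z W) (g : @hom D Y Z) (f : @hom D X Y) :
  is_mor h -> is_mor g -> is_mor f -> comp h (comp g f) = comp (comp h g) f.
Proof.
move=> mh mg mf; apply: kernel_ext => w x /=.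
transitivity (integral (fun z => integral (fun y => h w z * g z y * f y x))).
  apply: integral_ext => z; rewrite -(integralZ _ (integrand_invariant z x mg
    mf)).
  by apply: integral_ext => y; rewrite mulrA.
rewrite (@integral_fubini _ _ (coords w ++ coords x)).
  apply: integral_ext => y; rewrite mulrC -(integralZ _ (integrand_invariant w
    y mh mg)).
  by apply: integral_ext => z; rewrite mulrC.
move=> q qi qA z y.
rewrite -(kernel_mor qi w z mh) -(kernel_mor qi z y mg) -(kernel_mor qi y x mf).
rewrite (@move_fixes _ qi _ w) ?(@move_fixes _ qi _ x) //;
  by apply: fixes_sub qA => a ain; rewrite mem_cat ain ?orbT.
Qed.

Lemma gset_comp1m X Y (f : @hom D X Y) : is_mor f -> comp (@mor1 D Y) f = f.
Proof.
move=> mf; apply: kernel_ext => y x /=.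
rewrite (@integral_point _ _ y) ?eqxx ?mul1r // => z zy.
by rewrite eq_sym (negPf zy) mul0r.
Qed.

Lemma gset_compm1 X Y (f : @hom D X Y) : is_mor f -> comp f (@mor1 D X) = f.
Proof.
move=> mf; apply: kernel_ext => y x /=.
rewrite (@integral_point _ _ x) ?eqxx ?mulr1 // => z zx.
by rewrite (negPf zx) mulr0.
Qed.

(** Every pair of points can be moved to integer coordinates below the total
    number of coordinates, so an invariant kernel has finitely many values. *)
Definition grid_point X M (i : orbit X) (B : {set 'I_M}) : option (point R X) :=
  insub (i, [seq (val b)%:R | b <- enum B]).

Lemma grid_pointP X Y (y : point R Y) (x : point R X) (M := max_length X Y) :
  exists g (gi : increasing_bij g) (B A : {set 'I_M}),
    grid_point (val y).1 B = Some (move gi y) /\ grid_point (val x).1 A = Some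
      (move gi x).
Proof.
have [u [su yu xu ux]] := sorted_union (coords y) (coords x).
have szu : (size u <= M)%N.
  have szM : (size (coords y ++ coords x) <= M)%N.
    have /andP[/eqP sy _] := valP y; have /andP[/eqP sx _] := valP x.
    by rewrite size_cat addnC sy sx leq_add // leq_bigmax.
  apply: leq_trans szM; apply: uniq_leq_size => //.
  exact: sorted_uniq lt_trans ltxx _ su.
pose v : seq R := [seq a%:R | a <- iota 0 (size u)].
have sv : sorted <%R v.
  rewrite sorted_map (@eq_sorted _ _ ltn); first exact: iota_ltn_sorted.
  by move=> a b /=; rewrite ltr_nat.
have [|g [gi guv]] := increasing_transitive su sv;
  first by rewrite size_map size_iota.
have grid (V : gset) (p : point R V) : {subset coords p <= u} -> exists B :
  {set 'I_M},
    grid_point (val p).1 B = Some (move gi p).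
  move=> pu; exists [set b : 'I_M | (val b)%:R \in map g (coords p)].
  have E : [seq (val b)%:R | b <- enum [set b : 'I_M | (val b)%:R \in map g
    (coords p)]] =
      map g (coords p).
    apply: lt_sorted_eq.
    - rewrite sorted_map (@eq_sorted _ _ (relpre val ltn)); last first.
        by move=> a b /=; rewrite ltr_nat.
      rewrite -sorted_map; apply: (subseq_sorted ltn_trans (s2 := iota 0 M)).
        by rewrite -val_enum_ord map_subseq // {1}/enum_mem -enumT
          filter_subseq.
      exact: iota_ltn_sorted.
    - by rewrite increasing_sorted //; have /andP[] := valP p.
    move=> r; apply/mapP/idP => [[b]|rp];
      first by rewrite mem_enum inE => bp ->.
    have : r \in v by rewrite -guv; case/mapP: rp => c cp ->; apply/map_f/pu.
    case/mapP => a; rewrite mem_iota /= add0n => au ra.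
    have aM : (a < M)%N by apply: leq_trans szu.
    by exists (Ordinal aM); rewrite ?mem_enum ?inE //= -ra.
  rewrite /grid_point E; case: insubP => [p' _ E'|]; last first.
    by rewrite (move_subproof p gi).
  by congr Some; apply: val_inj; rewrite E'.
have [B BE] := grid _ y yu; have [A AE] := grid _ x xu.
by exists g, gi, B, A.
Qed.

Lemma gset_coordinates X Y : exists (T : finType) (phi : @hom D X Y -> T -> k),
  [/\ forall f g t, phi (fun y x => f y x + g y x) t = phi f t + phi g t,
      forall a f t, phi (fun y x => a * f y x) t = a * phi f t
    & forall f g, is_mor f -> is_mor g -> phi f =1 phi g -> f = g].
Proof.
pose M := max_length X Y.
exists (orbit Y * {set 'I_M} * (orbit X * {set 'I_M}))%type, (fun f t =>
  if (grid_point t.1.1 t.1.2, grid_point t.2.1 t.2.2) is (Some y, Some x)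
  then f y x else 0).
split=> [f g [[j B] [i A]]|a f [[j B] [i A]]|f g mf mg fg] /=.
- by case: grid_point => [y|]; [case: grid_point => [x|] //|]; rewrite addr0.
- by case: grid_point => [y|]; [case: grid_point => [x|] //|]; rewrite mulr0.
apply: kernel_ext => y x; have [h [hi [B [A [EB EA]]]]] := grid_pointP y x.
have := fg ((val y).1, B, ((val x).1, A)); rewrite /= EB EA.
by rewrite (kernel_mor _ _ _ mf) (kernel_mor _ _ _ mg).
Qed.

Definition gset_category_linear : linear_category k D.
Proof.
apply: (@LinearCategory k D (fun X Y f y x => - f y x) (fun X Y a f y x =>
  a * f y x)).
- by [].
- by move=> X Y f g h; apply: kernel_ext => y x; apply: addrA.
- by move=> X Y f g; apply: kernel_ext => y x; apply: addrC.
- by move=> X Y f; apply: kernel_ext => y x; apply: add0r.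
- by move=> X Y f; apply: kernel_ext => y x; apply: addNr.
- by move=> X Y a b f; apply: kernel_ext => y x; apply: mulrA.
- by move=> X Y f; apply: kernel_ext => y x; apply: mul1r.
- by move=> X Y a f g; apply: kernel_ext => y x; apply: mulrDr.
- by move=> X Y f a b; apply: kernel_ext => y x; apply: mulrDl.
- by [].
- move=> X Y f g mf mg; apply/invariant_kernelP => h hi y x /=.
  by rewrite (kernel_mor _ _ _ mf) (kernel_mor _ _ _ mg).
- move=> X Y a f mf; apply/invariant_kernelP => h hi y x /=.
  by rewrite (kernel_mor _ _ _ mf).
- move=> X; apply/invariant_kernelP => h hi y x /=.
  by rewrite (inj_eq (@move_inj _ hi X)).
- exact: gset_is_mor_comp.
- exact: gset_compA.
- exact: gset_comp1m.
- exact: gset_compm1.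
- move=> X Y Z g h f mg mh mf; apply: kernel_ext => z x /=.
  rewrite -(integralD (integrand_invariant z x mg mf) (integrand_invariant z x
    mh mf)).
  by apply: integral_ext => y; rewrite mulrDl.
- move=> X Y Z h f g mh mf mg; apply: kernel_ext => z x /=.
  rewrite -(integralD (integrand_invariant z x mh mf) (integrand_invariant z x
    mh mg)).
  by apply: integral_ext => y; rewrite mulrDr.
- move=> X Y Z a g f mg mf; apply: kernel_ext => z x /=.
  rewrite -(integralZ a (integrand_invariant z x mg mf)).
  by apply: integral_ext => y; rewrite mulrA.
- move=> X Y Z a g f mg mf; apply: kernel_ext => z x /=.
  rewrite -(integralZ a (integrand_invariant z x mg mf)).
  by apply: integral_ext => y; rewrite mulrCA.
- exact: gset_coordinates.
Defined.

End Gsets.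

(** ** Growth of the Delannoy category *)

Lemma mask_uniq_determines (T : eqType) (m : bitseq) (s : seq T) :
  uniq s -> size m = size s -> m = [seq x \in mask m s | x <- s].
Proof.
elim: s m => [|x s IH] [|b m] //= /andP[xs us] [sz]; rewrite {1}(IH m us sz).
congr (_ :: _).
  case: b => /=; rewrite ?mem_head //; apply/esym/negbTE.
  by apply: contra xs => /mem_mask.
apply/eq_in_map => y ys; case: b; rewrite ?inE //.
by case: eqP => // E; move: xs; rewrite -E ys.
Qed.

Section Delannoy.
Variables (R : realType) (k : fieldType).
Local Notation D := (gset_category R k).
Local Notation L := (gset_category_linear R k).
Implicit Types X Y Z : gset.

(** A point of a product is the increasing enumeration of the union of the
    coordinates of its projections, and its word records membership. *)
Lemma proj_inj X Y (z z' : point R (gset_prod X Y)) :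
  proj1 z = proj1 z' -> proj2 z = proj2 z' -> z = z'.
Proof.
move=> /(congr1 val)/= E1 /(congr1 val)/= E2; apply: val_inj.
case: z E1 E2 => [[[[[i j] w] hw] s] hz];
  case: z' => [[[[[i' j'] w'] hw'] s'] hz'].
rewrite /proj1_val /proj2_val /= => -[ei e1] [ej e2].
have /andP[/= /eqP sz ss] := hz; have /andP[/= /eqP sz' ss'] := hz'.
have /and3P[/= nff _ _] := hw; have /and3P[/= nff' _ _] := hw'.
have cover (v : seq (bool * bool)) (t : seq R) : (false,
  false) \notin v -> size t = size v ->
    t =i mask (map fst v) t ++ mask (map snd v) t.
  elim: v t => [|[b c] v IH] [|x t] //=;
    rewrite inE negb_or => /andP[bc nv] [szv] y.
  rewrite inE (IH t nv szv y) !mem_cat.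
  case: b c bc => [] [] //= _; rewrite ?inE; case: (y == x) => //=;
    rewrite ?orbT //.
have ess : s = s'.
  apply: lt_sorted_eq => // x.
  by rewrite (cover _ _ nff sz) (cover _ _ nff' sz') e1 e2.
have us : uniq s by apply: (sorted_uniq lt_trans ltxx).
have us' : uniq s' by rewrite -ess.
have szw : size (map fst w) = size s by rewrite size_map.
have szw2 : size (map snd w) = size s by rewrite size_map.
have szw' : size (map fst w') = size s' by rewrite size_map.
have szw2' : size (map snd w') = size s' by rewrite size_map.
have ew : bseqval w = bseqval w'.
  rewrite -(zip_unzip w) -(zip_unzip w'); congr zip.
    apply: etrans (mask_uniq_determines us szw) _.
    by rewrite e1 ess; apply/esym/mask_uniq_determines.
  apply: etrans (mask_uniq_determines us szw2) _.
  by rewrite e2 ess; apply/esym/mask_uniq_determines.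
congr (_, _); last exact: ess.
by apply: val_inj => /=; rewrite ei ej; congr (_, _); apply: val_inj.
Qed.

Lemma gset_tens1 X Y : tensm (@mor1 D X) (@mor1 D Y) = @mor1 D (gset_prod X Y).
Proof.
apply: kernel_ext => z z' /=; have [->|zz'] := eqVneq z z';
  first by rewrite !eqxx mulr1.
rewrite -natrM mulnb; congr (nat_of_bool _)%:R;
  apply: contraNF zz' => /andP[/eqP E1 /eqP E2].
exact/eqP/proj_inj.
Qed.

Section OrbitIdempotents.
Variable Z : gset.

Definition orbit_kernel (o : orbit Z) : @hom D Z Z :=
  fun y x => ((y == x) && ((val x).1 == o))%:R.

Lemma orbit_kernel_mor o : is_mor (orbit_kernel o).
Proof.
apply/invariant_kernelP => g gi y x.
by rewrite /orbit_kernel (inj_eq (@move_inj _ _ gi Z)).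
Qed.

Definition orbit_idem (o : orbit Z) : endo L Z := exist _ _ (orbit_kernel_mor
  o).

Lemma orbit_idemM o o' : orbit_idem o * orbit_idem o' = if o == o' then
  orbit_idem o else 0.
Proof.
apply: endo_inj; apply: kernel_ext => z x /=.
rewrite (@integral_point _ _ _ _ z) => [|y yz]; last first.
  by rewrite /orbit_kernel eq_sym (negPf yz) mul0r.
rewrite /orbit_kernel eqxx -natrM mulnb /=.
have [<-|zx] := eqVneq z x; last first.
  by rewrite andbF; case: (o == o') => //=; rewrite /orbit_kernel (negPf zx).
have [<-|oo'] := eqVneq o o'; first by rewrite /= /orbit_kernel eqxx andbb.
by have [->|//] := eqVneq (val z).1 o; rewrite (negPf oo').
Qed.

Lemma orbit_idem_neq0 o : orbit_idem o != 0.
Proof.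
have px : is_point (R := R) (o, [seq a%:R | a <- iota 0 (arity o)]).
  rewrite /is_point /= size_map size_iota eqxx sorted_map (@eq_sorted _ _ ltn).
    exact: iota_ltn_sorted.
  by move=> a b /=; rewrite ltr_nat.
pose x : point R Z := exist _ (o, [seq a%:R | a <- iota 0 (arity o)]) px.
apply/eqP => /(congr1 (fun f : endo L Z => sval f x x)) /= /eqP.
by rewrite /orbit_kernel !eqxx oner_eq0.
Qed.

Lemma orbit_system : exists s : 'I_#|orbit Z| -> endo L Z,
  orthogonal_system s 1.
Proof.
exists (fun i => orbit_idem (enum_val i)); split.
- by move=> i; rewrite orbit_idemM eqxx.
- by move=> i j ij; rewrite orbit_idemM (inj_eq enum_val_inj) (negPf ij).
- by move=> i; apply: orbit_idem_neq0.
apply: endo_inj; apply: kernel_ext => y x.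
have ev (f g : endo L Z) : sval (f + g) y x = sval f y x + sval g y x by [].
rewrite (big_morph (fun f : endo L Z => sval f y x) ev erefl) /= /orbit_kernel.
rewrite (bigD1 (enum_rank (val x).1)) //= enum_rankK eqxx andbT big1 ?addr0 //
  => i ix.
suff /negPf-> : (val x).1 != enum_val i by rewrite andbF.
by apply: contra ix => /eqP->; rewrite enum_valK.
Qed.

End OrbitIdempotents.

Definition line : gset := @GSet unit (fun=> 1%N).

Fixpoint line_power n : gset :=
  if n is n'.+1 then gset_prod (line_power n') line else @GSet unit (fun=> 0%N).

Definition top_orbits n := [set o : orbit (line_power n) | arity o == n].

(** A point of general position in [R^n] and the position of one more
    coordinate give a point of general position in [R^(n+1)]. *)
Lemma card_top_orbits n : (n`! <= #|top_orbits n|)%N.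
Proof.
elim: n => [|n IH]; first by rewrite card_gt0; apply/set0Pn; exists tt;
  rewrite inE.
pose w (i : nat) : seq (bool * bool) :=
  nseq i (true, false) ++ (false, true) :: nseq (n - i) (true, false).
have szw (i : 'I_n.+1) : size (w i) = n.+1.
  by rewrite size_cat /= !size_nseq addnS subnKC // -ltnS.
have maxl (o : orbit (line_power n)) : o \in top_orbits n ->
    (n.+1 <= max_length (line_power n) line)%N.
  rewrite inE => /eqP on; rewrite /max_length -addn1 leq_add //.
    by rewrite -[X in (X <= _)%N]on (@leq_bigmax _ (@arity (line_power n))).
  exact: (@leq_bigmax _ (@arity line) tt).
have ex (o : orbit (line_power n)) (i : 'I_n.+1) : o \in top_orbits n ->
    exists p : orbit (line_power n.+1),
      (val p).1.1 = o /\ (val p).2 = w i :> seq _.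
  move=> on; have wl : (size (w i) <= max_length (line_power n) line)%N by
    rewrite szw; apply: maxl on.
  have isw : is_word (arity o) (@arity line tt) (w i).
    move: on; rewrite inE => /eqP->;
      rewrite /is_word mem_cat inE !mem_nseq !andbF /=.
    rewrite !count_cat /= !count_nseq /= !mul1n !mul0n add0n subnKC ?eqxx //.
    by rewrite -ltnS.
  by exists (exist _ (o, tt, Bseq wl) isw).
have [E|[o0 on0]] := set_0Vmem (top_orbits n).
  by move: IH; rewrite E cards0 leqNgt fact_gt0.
have [f fP] : exists f : orbit (line_power n) * 'I_n.+1 -> orbit (line_power
  n.+1),
    forall o i, o \in top_orbits n -> (val (f (o, i))).1.1 = o /\ (val (f (o,
      i))).2 = w i :> seq _.
  have /boolp.choice[f fP] : forall q : orbit (line_power n) * 'I_n.+1,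
      exists p : orbit (line_power n.+1), q.1 \in top_orbits n ->
        (val p).1.1 = q.1 /\ (val p).2 = w q.2 :> seq _.
    move=> [o i]; have [on|non] := boolP (o \in top_orbits n).
      by have [p pP] := ex o i on; exists p.
    by have [p _] := ex o0 i on0; exists p => on; case/negP: non.
  by exists f => o i on; apply: (fP (o, i)).
pose Q := setX (top_orbits n) [set: 'I_n.+1].
have finj : {in Q &, injective f}.
  move=> [o i] [o' i'] /setXP[on _] /setXP[on' _] E.
  have [E1 E2] := fP o i on; have [E1' E2'] := fP o' i' on'.
  have eo : o = o' by rewrite -E1 -E1' E.
  rewrite eo; congr (_, _); apply: val_inj.
  have idx (j : 'I_n.+1) : seq.index (false, true) (w j) = j.
    by rewrite index_cat mem_nseq andbF size_nseq /= addn0.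
  by rewrite -[LHS]idx -[RHS]idx -E2 -E2' E.
rewrite factS -[X in (X * _)%N]card_ord mulnC.
apply: (@leq_trans #|Q|); first by rewrite cardsX cardsT leq_mul2r IH orbT.
rewrite -(card_in_imset finj); apply: subset_leq_card;
  apply/subsetP => _ /imsetP[[o i] /setXP[on _] ->].
by have [_ E] := fP o i on; rewrite inE /= E szw.
Qed.

Theorem Delannoy_growth : superexponential_growth (Delannoy R k) R.
Proof.
pose X : obj (Delannoy R k) := @Idempotent D line (mor1 _).
have powE n : tpower X n = @Idempotent D (line_power n) (mor1 _).
  elim: n => //= n ->.
  exact: (congr1 (@Idempotent D (line_power n.+1)) (gset_tens1 _ _)).
apply: (@growth_from_idempotents _ _ _ L X).
  split=> //; first exact: is_mor1 L _.
  by apply: comp1m L _ _ _ _; apply: is_mor1 L _.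
move=> n; rewrite powE; have [s os] := orbit_system (line_power n).
exists #|orbit (line_power n)|, s, 1; split=> //.
apply: leq_trans (card_top_orbits n) _; apply: leq_trans (max_card _) _.
by rewrite -[X in (X <= _)%N]expn1 leq_pexp2l // (leq_trans _ (max_card
  (top_orbits n))) //
  (leq_trans _ (card_top_orbits n)) ?fact_gt0.
Qed.

End Delannoy.

Theorem proposition3p0p22 (R : realType) :
  superexponential_growth (Rep_SL_infinity R[i]) R /\
  (forall t : R[i], (forall z : int, t <> z%:~R) ->
     superexponential_growth (Rep_St t) R) /\
  (forall k : fieldType, superexponential_growth (Delannoy R k) R).
Proof.
split; first exact: Rep_SL_infinity_growth.
split=> [t _|k]; [exact: Rep_St_growth | exact: Delannoy_growth].
Qed.
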